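(* Let $K\ge2$ and $d\ge2$, and let $p_d=\frac{2d}{d+1}$. Uniformly in $n$ and in the normalized local basis $\mathcal B$ of $M_K(\mathbb C)$, every $A\in\mathcal H_{\le d,K}(n)$ satisfies $$\|\widehat A_{\mathcal B}\|_{\ell_{p_d}}\le 8^d\Bigl(\sum_{r=0}^dC_{r,K}\Bigr)\|A\|_{\mathrm{op}}.$$ Consequently, if $C_{\le d,K}$ denotes the least constant, uniform in $n$ and in $\mathcal B$, such that $\|\widehat A_{\mathcal B}\|_{\ell_{p_d}}\le C_{\le d,K}\|A\|_{\mathrm{op}}$ for all $A\in\mathcal H_{\le d,K}(n)$, then $$\limsup_{d\to\infty}C_{\le d,K}^{1/d}\le 8\max\{1,\beta(K)\}.$$ In particular, $$\limsup_{d\to\infty}C_{\le d,K}^{1/d}\le 64a_1^2\sqrt e\,\sqrt K .$$ Moreover $C_{d,K}\le C_{\le d,K}$, and there is a universal constant $c>0$ such that for every $K\ge2$ $$cK^{1/4}\le\limsup_{d\to\infty}C_{\le d,K}^{1/d}\le 64a_1^2\sqrt e\,\sqrt K.$$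
   Context: $M_K(\mathbb C)$ is the algebra of complex $K\times K$ matrices and $M_K^0=\{A\in M_K(\mathbb C):\operatorname{tr}A=0\}$. A normalized local basis is a family $\mathcal B=\{B_0=I,B_1,\ldots,B_{K^2-1}\}$ that is an orthonormal basis of $M_K(\mathbb C)$ for $\langle A,B\rangle=\frac1K\operatorname{tr}(AB^* )$ (so $B_\mu\in M_K^0$ for $\mu\ge1$). For $\beta\in\{0,\ldots,K^2-1\}^n$ put $B_\beta=B_{\beta_1}\otimes\cdots\otimes B_{\beta_n}$, and for $A\in M_K(\mathbb C)^{\otimes n}\cong M_{K^n}(\mathbb C)$ let $\widehat A_{\mathcal B}(\beta)=K^{-n}\operatorname{tr}(AB_\beta^* )$, so $A=\sum_\beta\widehat A_{\mathcal B}(\beta)B_\beta$; $\|\widehat A_{\mathcal B}\|_{\ell_p}=(\sum_\beta|\widehat A_{\mathcal B}(\beta)|^p)^{1/p}$, and $\|\cdot\|_{\mathrm{op}}$ is the operator norm. For $S\subset[n]$ let $\mathcal H_S=(\bigotimes_{j\in S}M_K^0)\otimes(\bigotimes_{j\notin S}\mathbb CI)$, $\mathcal H_{r,K}(n)=\bigoplus_{|S|=r}\mathcal H_S$ and $\mathcal H_{\le d,K}(n)=\bigoplus_{r=0}^d\mathcal H_{r,K}(n)$. For $r\ge1$, $C_{r,K}$ is the least constant, uniform in $n$ and in the choice of the normalized local basis $\mathcal B$, such that $\|\widehat A_{\mathcal B}\|_{\ell_{p_r}}\le C_{r,K}\|A\|_{\mathrm{op}}$ for all $A\in\mathcal H_{r,K}(n)$,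 where $p_r=\frac{2r}{r+1}$; put $C_{0,K}=1$. Finally $\beta(K)=\limsup_{r\to\infty}C_{r,K}^{1/r}$. $a_1$ is a universal constant in the complex Khinchin--Steinhaus inequality at $p=1$: for every $N$ and all $c_1,\dots,c_N\in\mathbb C$, $(\sum_{j}|c_j|^2)^{1/2}\le a_1\int_{\mathbb T^N}|\sum_jc_jz_j|\,dz$, where $\mathbb T$ is the unit circle and $dz$ is normalized Haar measure. *)

(* Defs.v *)
From HB Require Import structures.
From mathcomp Require Import all_boot all_order all_algebra.
From mathcomp Require Import sesquilinear spectral.
From mathcomp Require Import all_classical all_reals all_analysis.
From mathcomp Require Import complex.

Set Implicit Arguments.
Unset Strict Implicit.
Unset Printing Implicit Defensive.

Import Order.TTheory GRing.Theory Num.Theory.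

Local Open Scope classical_set_scope.
Local Open Scope ring_scope.
Local Open Scope sesquilinear_scope.

Section Tensor.
Variables (R : realType) (K n : nat).

(* M_K(C)^{(x) n}: the K^n rows and columns are indexed by the words
   x : {ffun 'I_n -> 'I_K} through enum_val; their order plays no role. *)
Definition tensor_mx := 'M[R[i]]_#|{ffun 'I_n -> 'I_K}|.

Definition tensor (F : 'I_n -> 'M[R[i]]_K) : tensor_mx :=
  \matrix_(x, y) \prod_(j < n)
    F j ((enum_val x : {ffun 'I_n -> 'I_K}) j)
        ((enum_val y : {ffun 'I_n -> 'I_K}) j).

(* For S a set of sites, H_S is the linear span of the elementary tensors with
   traceless factors on S and scalar factors off S. *)
Definition elementary_on (S : {set 'I_n}) (F : 'I_n -> 'M[R[i]]_K) : Prop :=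
  (forall j, j \in S -> \tr (F j) = 0) /\
  (forall j, j \notin S -> is_scalar_mx (F j)).

Definition H_set (S : {set 'I_n}) : set tensor_mx :=
  [set A | exists (m : nat) (c : 'I_m -> R[i]) (F : 'I_m -> 'I_n -> 'M[R[i]]_K),
     (forall k, elementary_on S (F k)) /\ A = \sum_(k < m) c k *: tensor (F k)].

Definition H_hom (r : nat) : set tensor_mx :=
  [set A | exists D : {set 'I_n} -> tensor_mx,
     (forall S, H_set S (D S)) /\ A = \sum_(S : {set 'I_n} | #|S| == r) D S].

Definition H_le (d : nat) : set tensor_mx :=
  [set A | exists D : nat -> tensor_mx,
     (forall r, H_hom r (D r)) /\ A = \sum_(r < d.+1) D r].

Definition fourier_coef (B : 'I_(K ^ 2) -> 'M[R[i]]_K) (A : tensor_mx)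
    (b : {ffun 'I_n -> 'I_(K ^ 2)}) : R[i] :=
  K%:R ^- n * \tr (A *m (tensor (fun j => B (b j))) ^t*).

End Tensor.

Section Norms.
Variable R : realType.

Definition normalized_local_basis (K : nat) (B : 'I_(K ^ 2) -> 'M[R[i]]_K)
    : Prop :=
  [/\ forall mu, val mu = 0%N -> B mu = 1%:M,
      forall mu nu, K%:R^-1 * \tr (B mu *m (B nu) ^t*) = (mu == nu)%:R
    & basis_of fullv (codom B)].

(* [Normc.normc z] is the modulus of z as an element of R, whereas
   [`|z|] lives in R[i]. *)
Definition lp_norm (I : finType) (p : R) (f : I -> R[i]) : R :=
  (\sum_i Normc.normc (f i) `^ p) `^ p^-1.

Definition l2_norm (N : nat) (v : 'cV[R[i]]_N) : R :=
  Num.sqrt (\sum_i Normc.normc (v i 0) ^+ 2).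

Definition op_norm (N : nat) (A : 'M[R[i]]_N) : R :=
  sup [set l2_norm (A *m v) | v in [set v : 'cV[R[i]]_N | l2_norm v <= 1]].

Definition BH_exp (r : nat) : R := (2 * r)%:R / r.+1%:R.

(* The least constants take values in \bar R: a priori the set of admissible
   constants could be empty, in which case the infimum is +oo. *)
Definition C_hom (r K : nat) : \bar R :=
  if r == 0%N then 1%E else
  ereal_inf [set C%:E | C in [set C : R |
    forall (n : nat) (B : 'I_(K ^ 2) -> 'M[R[i]]_K) (A : tensor_mx R K n),
      normalized_local_basis B -> H_hom r A ->
      lp_norm (BH_exp r) (fourier_coef B A) <= C * op_norm A]].

Definition C_le (d K : nat) : \bar R :=
  ereal_inf [set C%:E | C in [set C : R |
    forall (n : nat) (B : 'I_(K ^ 2) -> 'M[R[i]]_K) (A : tensor_mx R K n),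
      normalized_local_basis B -> H_le d A ->
      lp_norm (BH_exp d) (fourier_coef B A) <= C * op_norm A]].

Definition limsup_root (u : nat -> \bar R) : \bar R :=
  limn_esup (fun r => poweR (u r) r%:R^-1).

Definition BH_beta (K : nat) : \bar R := limsup_root (fun r => C_hom r K).

End Norms.

Section Steinhaus.
Variable R : realType.

Definition circle_pt (t : R) : R[i] :=
  Complex (cos (2 * pi * t)) (sin (2 * pi * t)).

(* Integral over T^N for the normalized Haar measure, as an iterated integral
   in the parametrization z_j = exp (2 i pi t_j), t_j in [0, 1]. *)
Fixpoint torus_integral (N : nat) : (('I_N -> R[i]) -> \bar R) -> \bar R :=
  if N is N'.+1 then fun f =>
    (\int[lebesgue_measure]_(t in `[0%R, 1%R])
      torus_integral
        (fun z : 'I_N' -> R[i] =>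
           f (fun j => oapp z (circle_pt t) (unlift ord0 j))))%E
  else fun f => f (fun=> 1).

Definition khinchin_steinhaus1 (a : R) : Prop :=
  forall (N : nat) (c : 'I_N -> R[i]),
    ((Num.sqrt (\sum_j Normc.normc (c j) ^+ 2))%:E <=
     a%:E * torus_integral
       (fun z => (Normc.normc (\sum_j c j * z j))%:E))%E.

End Steinhaus.

(* Main.v *)
(* Passing from degree exactly r to degree at most d: the depolarizing channel
   with parameter t multiplies the r-homogeneous part by t^r and contracts the
   operator norm; Lagrange interpolation at t = q/d recovers each homogeneous
   part with total weight at most 8^d, and l_p norms decrease in p.

   Upper bound.  Test A on products of random states of C^K built from fourth
   roots of unity and signs.  This gives a bounded function of independent
   samples which has degree at most d in mixtures of states, so the coefficients
   of its first-order term (the partial derivatives) have sum at most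
   d (d + 1) 2^d |A| by Lagrange interpolation.  Hypercontractivity compares
   their L1 and L2 norms up to 9^(d-1), and orthogonality with the Fourier
   coefficients up to (4 sqrt K)^(d-1); Blei's inequality concludes.  The
   resulting rate 72 sqrt K is at most 64 a1^2 sqrt e sqrt K since a1 >= 1.

   Lower bound.  Take A = sum_e z_e T_e with z_e random roots of unity and T_e a
   tensor of one off-diagonal matrix unit in each of d blocks, of 1, 1, h, h^2,
   ... sites with h of order K.  By Wick's formula and a count of walks, the
   moment of order 2 h^d of d + 1 blocks is dominated by that of many independent
   copies of d blocks.  The norm of the latter is a convex function of weak
   variance so small that its moments of orders 2 h^(d-1) and 2 h^d agree up to
   a constant factor.  Hence some A has norm at most const^d times
   (K prod_i (m_i K))^(1/2), where m_i is the number of sites of the i-th block,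
   while its Fourier coefficients in a basis containing sqrt K E_kl (k <> l) are
   flat, and the number prod_i m_i (K^2 - K) of them supplies K^(d/4). *)
Require Import Defs.
From mathcomp Require Import all_boot all_order all_algebra.
From mathcomp Require Import sesquilinear spectral perm cyclic separable cyclotomic.
From mathcomp Require Import all_classical all_reals all_analysis.
From mathcomp Require Import complex.
From mathcomp Require Import ring lra zify.
Import Order.TTheory GRing.Theory Num.Theory.
Local Open Scope ring_scope.

Set Implicit Arguments.
Unset Strict Implicit.
Unset Printing Implicit Defensive.

Local Open Scope sesquilinear_scope.
Local Notation normc := Normc.normc.
Local Notation conjC := Num.conj.
Local Notation Re := complex.Re.
Local Notation Im := complex.Im.

(** * Operator norms, elementary tensors and Fourier coefficients *)

(** In the lower bound the obstacle is the sum over p! permutations in Wick's formula. The order p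
    must reach the logarithm of the dimension, and bounding the permutations one by one over all
    blocks would leave a factor p!. So only the last block, with m sites, is bounded permutation by
    permutation, by K^m (m K)^p. What remains is the pairing sum of the other blocks times T'^p with
    T' = T m K, and this is again, up to 2^p, a moment of T' independent copies of those blocks. Its
    order is too high by a factor h for the induction hypothesis, which is what concentration
    repairs. Each step constrains h: 2 h <= K makes the copies outnumber the order, h <= K keeps the
    weak variance small, K <= 4^h keeps the dimension below 4^p, and h is a power of two so that
    norms are reached by repeated squaring. The gain comes from the exponent p_d: the number of
    letters enters to the power d + 1 on the side of the coefficients but, through the norm, only to
    the power d in the product of the block sizes m_i. One factor prod m_i, of the order of
    h^(d^2/2), survives, and its 2d-th root is h^(d/4). *)

Section Complex.
Variable R : realType.
Implicit Types z w : R[i].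

Lemma conjCE z : conjC z = (conjc z : R[i]).
Proof. by []. Qed.

Lemma normc_ge0 z : 0 <= normc z.
Proof. by case: z => a b; rewrite sqrtr_ge0. Qed.

Lemma normc_sqrE z : normc z ^+ 2 = Re z ^+ 2 + Im z ^+ 2.
Proof. by case: z => a b; rewrite /= sqr_sqrtr// addr_ge0// sqr_ge0. Qed.

Lemma mulcJ z : z * conjC z = ((normc z ^+ 2)%:C)%C.
Proof.
rewrite normc_sqrE; case: z => a b /=; rewrite conjCE /=; simpc.
by congr Complex; ring.
Qed.

Lemma normc_conj z : normc (conjC z) = normc z.
Proof. by case: z => a b; rewrite conjCE /= sqrrN. Qed.

Lemma normc_real (x : R) : normc (x%:C)%C = `|x|.
Proof. by rewrite /= expr0n /= addr0 sqrtr_sqr. Qed.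

Lemma le_Re_normc z : Re z <= normc z.
Proof.
case: z => a b /=; apply: le_trans (ler_norm _) _.
by rewrite -sqrtr_sqr ler_wsqrtr// lerDl sqr_ge0.
Qed.

Lemma normcD_le z w : normc (z + w) <= normc z + normc w.
Proof. exact: (@le_normcD R z w). Qed.

Lemma normc_sum (I : Type) (r : seq I) (P : pred I) (F : I -> R[i]) :
  normc (\sum_(i <- r | P i) F i) <= \sum_(i <- r | P i) normc (F i).
Proof.
elim/big_rec2: _ => [|i x y _ h]; first by rewrite Normc.normc0.
by apply: le_trans (normcD_le _ _) _; rewrite lerD2l.
Qed.

Lemma normcX z n : normc (z ^+ n) = normc z ^+ n.
Proof.
elim: n => [|n ih]; first by rewrite !expr0 Normc.normc1.
by rewrite !exprS Normc.normcM ih.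
Qed.

Lemma normc_prod (I : Type) (r : seq I) (P : pred I) (F : I -> R[i]) :
  normc (\prod_(i <- r | P i) F i) = \prod_(i <- r | P i) normc (F i).
Proof.
elim/big_rec2: _ => [|i x y _ h]; first by rewrite Normc.normc1.
by rewrite Normc.normcM h.
Qed.

Lemma normcB z w : normc (z - w) = normc (w - z).
Proof. by rewrite -opprB normcN. Qed.

Lemma Re_sum (I : Type) (r : seq I) (P : pred I) (F : I -> R[i]) :
  Re (\sum_(i <- r | P i) F i) = \sum_(i <- r | P i) Re (F i).
Proof. by elim/big_rec2: _ => [//|i x [a b] _ /= ->]; case: (F i). Qed.

Lemma rC_sum (I : Type) (r : seq I) (P : pred I) (F : I -> R) :
  ((\sum_(i <- r | P i) F i)%:C)%C = \sum_(i <- r | P i) ((F i)%:C)%C.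
Proof. exact: rmorph_sum. Qed.

End Complex.

Section CauchySchwarz.
Variable R : realType.

Lemma CS_real (I : finType) (a b : I -> R) :
  (\sum_i a i * b i) ^+ 2 <= (\sum_i a i ^+ 2) * (\sum_i b i ^+ 2).
Proof.
rewrite -subr_ge0.
have -> : (\sum_i a i ^+ 2) * (\sum_i b i ^+ 2) - (\sum_i a i * b i) ^+ 2 =
    2^-1 * \sum_i \sum_j (a i * b j - a j * b i) ^+ 2.
  rewrite expr2 !big_distrlr /=.
  have e : \sum_i \sum_j a i ^+ 2 * b j ^+ 2 = \sum_i \sum_j a j ^+ 2 * b i ^+ 2.
    by rewrite exchange_big.
  have -> : \sum_i \sum_j (a i * b j - a j * b i) ^+ 2 =
     \sum_i \sum_j a i ^+ 2 * b j ^+ 2 + \sum_i \sum_j a j ^+ 2 * b i ^+ 2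
     - 2 * \sum_i \sum_j a i * b i * (a j * b j).
    rewrite mulr_sumr -sumrN -!big_split /=; apply: eq_bigr => i _.
    rewrite mulr_sumr -sumrN -!big_split /=; apply: eq_bigr => j _; ring.
  by rewrite -e; field.
by rewrite mulr_ge0 ?invr_ge0// sumr_ge0// => i _; rewrite sumr_ge0// => j _; rewrite sqr_ge0.
Qed.

Lemma CS_sqrt (I : finType) (a b : I -> R) :
  \sum_i a i * b i <= Num.sqrt (\sum_i a i ^+ 2) * Num.sqrt (\sum_i b i ^+ 2).
Proof.
apply: le_trans (ler_norm _) _.
rewrite -sqrtrM ?sumr_ge0// => [|i _]; last exact: sqr_ge0.
by rewrite -sqrtr_sqr ler_wsqrtr// CS_real.
Qed.

Lemma CS_normc (I : finType) (a b : I -> R[i]) :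
  normc (\sum_i a i * b i) <=
  Num.sqrt (\sum_i normc (a i) ^+ 2) * Num.sqrt (\sum_i normc (b i) ^+ 2).
Proof.
apply: le_trans (normc_sum _ _ _) _.
under eq_bigr do rewrite Normc.normcM.
exact: CS_sqrt.
Qed.

Lemma CS_normc_sqr (I : finType) (a b : I -> R[i]) :
  normc (\sum_i a i * b i) ^+ 2 <=
  (\sum_i normc (a i) ^+ 2) * (\sum_i normc (b i) ^+ 2).
Proof.
apply: le_trans (CS_real _ _); rewrite lerXn2r ?nnegrE ?normc_ge0//.
  by rewrite sumr_ge0// => i _; rewrite mulr_ge0// normc_ge0.
apply: le_trans (normc_sum _ _ _) _.
by under eq_bigr do rewrite Normc.normcM.
Qed.

End CauchySchwarz.

Section OpNorm.
Variable R : realType.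
Local Notation C := R[i].
Local Notation l2 := (@l2_norm R _).

Lemma l2_norm_ge0 N (v : 'cV[C]_N) : 0 <= l2 v.
Proof. exact: sqrtr_ge0. Qed.

Lemma l2_norm_sqr N (v : 'cV[C]_N) : l2 v ^+ 2 = \sum_i normc (v i 0) ^+ 2.
Proof. by rewrite sqr_sqrtr// sumr_ge0// => i _; rewrite sqr_ge0. Qed.

Lemma l2_norm_dot N (v : 'cV[C]_N) : (v ^t* *m v) 0 0 = ((l2 v ^+ 2)%:C)%C.
Proof.
rewrite l2_norm_sqr mxE rC_sum; apply: eq_bigr => i _.
by rewrite !mxE mulrC mulcJ.
Qed.

Lemma l2_normZ N (a : C) (v : 'cV[C]_N) : l2 (a *: v) = normc a * l2 v.
Proof.
rewrite /l2_norm -[normc a]ger0_norm ?normc_ge0// -sqrtr_sqr -sqrtrM ?sqr_ge0//.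
by congr Num.sqrt; rewrite mulr_sumr; apply: eq_bigr => i _; rewrite mxE Normc.normcM exprMn.
Qed.

Lemma l2_norm_eq0 N (v : 'cV[C]_N) : l2 v = 0 -> v = 0.
Proof.
move=> h; have := l2_norm_sqr v; rewrite h expr0n /= => /esym/eqP.
rewrite psumr_eq0 => [/allP h0|i _]; last exact: sqr_ge0.
apply/matrixP => i j; rewrite ord1 mxE; apply: Normc.eq0_normc.
by apply/eqP; rewrite -sqrf_eq0; apply: h0; rewrite mem_index_enum.
Qed.

Lemma dot_le_l2 N (u v : 'cV[C]_N) : normc ((u ^t* *m v) 0 0) <= l2 u * l2 v.
Proof.
rewrite mxE; apply: le_trans (CS_normc _ _) _.
by rewrite le_eqVlt; apply/orP; left; apply/eqP; congr (Num.sqrt _ * _);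
  apply: eq_bigr => i _; rewrite !mxE normc_conj.
Qed.

Lemma op_set_ubound N (A : 'M[C]_N) :
  has_ubound [set l2 (A *m v) | v in [set v : 'cV[C]_N | l2 v <= 1]]%classic.
Proof.
exists (Num.sqrt (\sum_i \sum_j normc (A i j) ^+ 2)) => _ [v /= hv <-].
rewrite ler_wsqrtr//; apply: ler_sum => i _; rewrite mxE.
apply: le_trans (CS_normc_sqr _ _) _.
rewrite -[leRHS]mulr1; apply: ler_wpM2l; first by rewrite sumr_ge0// => ? _; rewrite sqr_ge0.
by rewrite -l2_norm_sqr exprn_ile1// l2_norm_ge0.
Qed.

Lemma op_norm_ge0 N (A : 'M[C]_N) : 0 <= op_norm A.
Proof.
have h0 : l2 (0 : 'cV[C]_N) = 0.
  rewrite /l2_norm big1 ?sqrtr0// => i _; by rewrite mxE Normc.normc0 expr0n.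
apply: (ub_le_sup (op_set_ubound A)); exists 0 => /=; last by rewrite mulmx0 h0.
by rewrite h0.
Qed.

Lemma l2_mul_le_op N (A : 'M[C]_N) (v : 'cV[C]_N) : l2 (A *m v) <= op_norm A * l2 v.
Proof.
have [h|h] := eqVneq (l2 v) 0.
  by rewrite (l2_norm_eq0 h) mulmx0 -(l2_norm_eq0 h) h mulr0.
have hp : 0 < l2 v by rewrite lt_def h l2_norm_ge0.
rewrite -ler_pdivrMr//.
have nv : normc (((l2 v)^-1)%:C)%C = (l2 v)^-1.
  by rewrite normc_real ger0_norm// invr_ge0 ltW.
apply: (ub_le_sup (op_set_ubound A)); exists ((((l2 v)^-1)%:C)%C *: v) => /=.
  by rewrite l2_normZ nv mulVf.
by rewrite -scalemxAr l2_normZ nv mulrC.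
Qed.

Lemma op_norm_le N (A : 'M[C]_N) (c : R) : 0 <= c ->
  (forall v : 'cV[C]_N, l2 (A *m v) <= c * l2 v) -> op_norm A <= c.
Proof.
move=> c0 h; apply: ge_sup.
  exists (l2 (A *m 0)), 0 => //=.
  rewrite /l2_norm big1 ?sqrtr0// => i _; by rewrite mxE Normc.normc0 expr0n.
move=> _ [v /= hv <-]; apply: le_trans (h v) _.
by rewrite -[leRHS]mulr1 ler_wpM2l.
Qed.

Lemma bilin_le_op N (A : 'M[C]_N) (u v : 'cV[C]_N) :
  normc ((u ^t* *m A *m v) 0 0) <= op_norm A * (l2 u * l2 v).
Proof.
rewrite -mulmxA; apply: le_trans (dot_le_l2 _ _) _.
by rewrite mulrCA ler_wpM2l ?l2_norm_ge0// l2_mul_le_op.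
Qed.

Lemma op_norm_le_bilin N (A : 'M[C]_N) (c : R) : 0 <= c ->
  (forall u v : 'cV[C]_N, normc ((u ^t* *m A *m v) 0 0) <= c * (l2 u * l2 v)) ->
  op_norm A <= c.
Proof.
move=> c0 h; apply: op_norm_le => // v.
have [h0|h0] := eqVneq (l2 (A *m v)) 0; first by rewrite h0 mulr_ge0// l2_norm_ge0.
have hp : 0 < l2 (A *m v) by rewrite lt_def h0 l2_norm_ge0.
have := h (A *m v) v; rewrite -mulmxA l2_norm_dot normc_real ger0_norm ?sqr_ge0//.
by rewrite mulrCA expr2 ler_pM2l.
Qed.

Lemma op_norm_comb N (I : finType) (c : I -> C) (A : I -> 'M[C]_N) :
  op_norm (\sum_i c i *: A i) <= \sum_i normc (c i) * op_norm (A i).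
Proof.
apply: op_norm_le_bilin.
  by rewrite sumr_ge0// => i _; rewrite mulr_ge0 ?normc_ge0 ?op_norm_ge0.
move=> u v; rewrite mulmx_sumr mulmx_suml summxE.
apply: le_trans (normc_sum _ _ _) _; rewrite mulr_suml; apply: ler_sum => i _.
rewrite -scalemxAr -scalemxAl mxE Normc.normcM -mulrA ler_wpM2l ?normc_ge0//.
exact: bilin_le_op.
Qed.

Lemma trC_mul m n p (A : 'M[C]_(m, n)) (B : 'M[C]_(n, p)) :
  (A *m B) ^t* = B ^t* *m A ^t*.
Proof. by rewrite trmx_mul map_mxM. Qed.

Lemma trCK m n (A : 'M[C]_(m, n)) : (A ^t*) ^t* = A.
Proof. by apply/matrixP => i j; rewrite !mxE conjCK. Qed.

Lemma op_normJ N (A : 'M[C]_N) : op_norm (A ^t*) <= op_norm A.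
Proof.
apply: op_norm_le_bilin => [|u v]; first exact: op_norm_ge0.
have -> : (u ^t* *m A ^t* *m v) 0 0 = conjC ((v ^t* *m A *m u) 0 0).
  rewrite -[in LHS](trCK v) -!trC_mul mulmxA.
  by rewrite -[(v ^t* *m A *m u)]trCK !mxE conjCK.
by rewrite normc_conj [l2 u * _]mulrC bilin_le_op.
Qed.

Lemma op_normM N (A B : 'M[C]_N) : op_norm (A *m B) <= op_norm A * op_norm B.
Proof.
apply: op_norm_le => [|v]; first by rewrite mulr_ge0 ?op_norm_ge0.
rewrite -mulmxA -mulrA; apply: le_trans (l2_mul_le_op _ _) _.
by rewrite ler_wpM2l ?op_norm_ge0// l2_mul_le_op.
Qed.

Lemma op_norm1 N : op_norm (1%:M : 'M[C]_N) <= 1.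
Proof. by apply: op_norm_le => // v; rewrite mul1mx mul1r. Qed.

Lemma op_normX N (A : 'M[C]_N) k : op_norm (A ^+ k) <= op_norm A ^+ k.
Proof.
elim: k => [|k ih]; first by rewrite !expr0 op_norm1.
rewrite !exprS; apply: le_trans (op_normM _ _) _.
by rewrite ler_wpM2l ?op_norm_ge0.
Qed.

(** The i-th term evaluates the form of [A] at the images of [u] and [v] under the adjoint of [V i].
    By the hypothesis the squared norms of these images add up to those of [u] and [v], so
    Cauchy-Schwarz over [i] costs nothing. *)
Lemma op_norm_kraus N (I : finType) (V : I -> 'M[C]_N) (A : 'M[C]_N) :
  \sum_i V i *m V i ^t* = 1%:M ->
  op_norm (\sum_i V i *m A *m V i ^t*) <= op_norm A.
Proof.
move=> hV; apply: op_norm_le_bilin => [|u v]; first exact: op_norm_ge0.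
have hs w : \sum_i l2 (V i ^t* *m w) ^+ 2 = l2 w ^+ 2.
  apply: complexI; rewrite rC_sum -l2_norm_dot.
  under eq_bigr do rewrite -l2_norm_dot trC_mul trCK.
  have <- : (w ^t* *m (\sum_i V i *m V i ^t*) *m w) 0 0 = (w ^t* *m w) 0 0.
    by rewrite hV mulmx1.
  by rewrite mulmx_sumr mulmx_suml summxE; apply: eq_bigr => i _; rewrite !mulmxA.
rewrite mulmx_sumr mulmx_suml summxE; apply: le_trans (normc_sum _ _ _) _.
apply: (@le_trans _ _ (\sum_i op_norm A * (l2 (V i ^t* *m u) * l2 (V i ^t* *m v)))).
  apply: ler_sum => i _.
  have -> : u ^t* *m (V i *m A *m V i ^t*) *m v =
      (V i ^t* *m u) ^t* *m A *m (V i ^t* *m v).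
    by rewrite trC_mul trCK !mulmxA.
  exact: bilin_le_op.
rewrite -mulr_sumr ler_wpM2l ?op_norm_ge0//.
apply: le_trans (CS_sqrt _ _) _.
by rewrite !hs !sqrtr_sqr !ger0_norm ?l2_norm_ge0.
Qed.

End OpNorm.

Section Tensors.
Variables (R : realType) (K n : nat).
Local Notation C := R[i].
Local Notation word := {ffun 'I_n -> 'I_K}.
Implicit Types F G : 'I_n -> 'M[C]_K.

Lemma sum_enum_val (V : nmodType) (T : finType) (F : T -> V) :
  \sum_(i < #|T|) F (enum_val i) = \sum_t F t.
Proof. by rewrite [RHS](reindex _ (onW_bij _ (enum_val_bij T))). Qed.

Lemma tensor_mul F G : tensor F *m tensor G = tensor (fun j => F j *m G j).
Proof.
apply/matrixP => x y; rewrite !mxE.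
under eq_bigr do rewrite !mxE -big_split /=.
under [RHS]eq_bigr do rewrite mxE.
rewrite bigA_distr_bigA /=.
exact: (sum_enum_val (fun z : word => \prod_j (F j _ (z j) * G j (z j) _))).
Qed.

Lemma tensor_adj F : (tensor F) ^t* = tensor (fun j => (F j) ^t*).
Proof.
by apply/matrixP => x y; rewrite !mxE rmorph_prod; apply: eq_bigr => j _; rewrite !mxE.
Qed.

Lemma tensor1 : tensor (fun=> 1%:M : 'M[C]_K) = 1%:M :> 'M[C]_#|{: word}|.
Proof.
apply/matrixP => x y; rewrite !mxE.
under eq_bigr do rewrite mxE.
have [->|xy] := eqVneq x y; first by rewrite big1// => j _; rewrite eqxx.
have [j hj] : exists j, (enum_val x : word) j != (enum_val y : word) j.
  apply/existsP; rewrite -negb_forall; apply: contraNN xy => /forallP h.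
  by apply/eqP/enum_val_inj/ffunP => j; apply/eqP/h.
by rewrite (bigD1 j)//= (negbTE hj) mul0r.
Qed.

Lemma tr_tensor F : \tr (tensor F) = \prod_j \tr (F j).
Proof.
rewrite /mxtrace bigA_distr_bigA /=.
rewrite -(sum_enum_val (fun z : word => \prod_j F j (z j) (z j))).
by apply: eq_bigr => x _; rewrite mxE.
Qed.

Lemma tensor_sum (I : finType) (G : 'I_n -> I -> 'M[C]_K) :
  tensor (fun j => \sum_i G j i) =
  \sum_(f : {ffun 'I_n -> I}) tensor (fun j => G j (f j)).
Proof.
apply/matrixP => x y; rewrite !mxE summxE.
under eq_bigr do rewrite summxE.
by rewrite bigA_distr_bigA /=; apply: eq_bigr => f _; rewrite mxE.
Qed.

Lemma tensorZ (c : 'I_n -> C) F :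
  tensor (fun j => c j *: F j) = (\prod_j c j) *: tensor F.
Proof.
by apply/matrixP => x y; rewrite !mxE -big_split; apply: eq_bigr => j _; rewrite mxE.
Qed.

Lemma eq_tensor F G : F =1 G -> tensor F = tensor G.
Proof. by move=> h; congr tensor; apply/funext. Qed.

Lemma tr_sum (N : nat) (I : Type) (r : seq I) (P : pred I) (A : I -> 'M[C]_N) :
  \tr (\sum_(i <- r | P i) A i) = \sum_(i <- r | P i) \tr (A i).
Proof. exact: raddf_sum. Qed.

Definition tensor_vec (u : 'I_n -> 'cV[C]_K) : 'cV[C]_#|{: word}| :=
  \col_x \prod_j u j ((enum_val x : word) j) 0.

Lemma tensor_vec_rank1 u :
  tensor (fun j => u j *m (u j) ^t*) = tensor_vec u *m (tensor_vec u) ^t*.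
Proof.
apply/matrixP => x y; rewrite !mxE big_ord1 !mxE rmorph_prod -big_split.
by apply: eq_bigr => j _; rewrite !mxE big_ord1 !mxE.
Qed.

Lemma l2_tensor_vec u : l2_norm (tensor_vec u) ^+ 2 = \prod_j l2_norm (u j) ^+ 2.
Proof.
rewrite l2_norm_sqr.
under [LHS]eq_bigr do rewrite /tensor_vec mxE normc_prod -prodrXl.
rewrite (sum_enum_val (fun z : word => \prod_j normc (u j (z j) 0) ^+ 2)).
by under [RHS]eq_bigr do rewrite l2_norm_sqr; rewrite bigA_distr_bigA.
Qed.

(** Multiplying out the mixtures at all sites gives a mixture of pure product vectors with total
    weight 1; on each of them the trace is a diagonal value of the form of [A]. *)
Lemma tr_mul_state (A : tensor_mx R K n) (Q : finType) (w : 'I_n -> Q -> R)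
    (u : 'I_n -> Q -> 'cV[C]_K) :
  (forall j q, 0 <= w j q) ->
  (forall j, \sum_q w j q * l2_norm (u j q) ^+ 2 = 1) ->
  normc (\tr (A *m tensor (fun j => \sum_q ((w j q)%:C)%C *: (u j q *m (u j q) ^t*))))
  <= op_norm A.
Proof.
move=> w0 w1; rewrite tensor_sum mulmx_sumr tr_sum.
apply: le_trans (normc_sum _ _ _) _.
apply: (@le_trans _ _ (\sum_(f : {ffun 'I_n -> Q})
   op_norm A * \prod_j (w j (f j) * l2_norm (u j (f j)) ^+ 2))).
  apply: ler_sum => f _.
  rewrite (tensorZ (fun j => ((w j (f j))%:C)%C)) -scalemxAr mxtraceZ Normc.normcM.
  rewrite tensor_vec_rank1 mulmxA mxtrace_mulC mulmxA big_split/= mulrCA.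
  rewrite normc_prod; under eq_bigr do rewrite normc_real ger0_norm ?w0//.
  rewrite ler_wpM2l ?prodr_ge0//.
  rewrite /mxtrace big_ord1; apply: le_trans (bilin_le_op _ _ _) _.
  by rewrite -expr2 l2_tensor_vec.
rewrite -mulr_sumr -(bigA_distr_bigA (fun j q => w j q * l2_norm (u j q) ^+ 2)).
by rewrite /= big1 ?mulr1// => j _; rewrite w1.
Qed.

End Tensors.

Section Fourier.
Variables (R : realType) (K n : nat).
Local Notation C := R[i].
Hypothesis K_gt0 : (0 < K)%N.
Variable B : 'I_(K ^ 2) -> 'M[C]_K.
Hypothesis Bb : normalized_local_basis B.
Local Notation multi := {ffun 'I_n -> 'I_(K ^ 2)}.

Definition supp (b : multi) : {set 'I_n} := [set j | val (b j) != 0%N].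

Let KC0 : (K%:R : C) != 0.
Proof. by rewrite pnatr_eq0 -lt0n. Qed.

Lemma basis_orth mu nu : K%:R^-1 * \tr (B mu *m (B nu) ^t*) = (mu == nu)%:R.
Proof. by case: Bb. Qed.

Lemma basis0 mu : val mu = 0%N -> B mu = 1%:M.
Proof. by case: Bb => h _ _; apply: h. Qed.

Lemma basis_tr0 mu : val mu != 0%N -> \tr (B mu) = 0.
Proof.
move=> h; have K2 : (0 < K ^ 2)%N by rewrite expn_gt0 K_gt0.
have := basis_orth mu (Ordinal K2); rewrite [B (Ordinal _)]basis0//.
have -> : (mu == Ordinal K2) = false by apply/negbTE; rewrite -val_eqE.
rewrite trmx1 map_mx1 mulmx1 => /eqP.
by rewrite mulf_eq0 invr_eq0 (negbTE KC0) => /eqP.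
Qed.

Lemma basis_expand (M : 'M[C]_K) :
  M = \sum_mu (K%:R^-1 * \tr (M *m (B mu) ^t*)) *: B mu.
Proof.
have [c hc] : exists c : 'I_(K ^ 2) -> C, M = \sum_mu c mu *: B mu.
  case: Bb => _ _ hb.
  have hM : M \in <<codom_tuple B>>%VS.
    by rewrite (span_basis (X := codom_tuple B) hb) memvf.
  exists (fun mu => coord (codom_tuple B) (enum_rank mu) M).
  rewrite {1}(coord_span hM) (reindex _ (onW_bij _ (enum_rank_bij _))) /=.
  apply: eq_bigr => mu _; congr (_ *: _).
  by rewrite nth_codom enum_rankK.
rewrite {1}hc; apply: eq_bigr => nu _; congr (_ *: _).
rewrite hc mulmx_suml tr_sum mulr_sumr (bigD1 nu)//= big1 => [|mu ne].
  by rewrite -scalemxAl mxtraceZ mulrCA basis_orth eqxx mulr1 addr0.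
by rewrite -scalemxAl mxtraceZ mulrCA basis_orth (negbTE ne) mulr0.
Qed.

Lemma fourier_coef_tensor F (b : multi) :
  fourier_coef B (tensor F) b = \prod_j (K%:R^-1 * \tr (F j *m (B (b j)) ^t*)).
Proof.
rewrite /fourier_coef tensor_adj tensor_mul tr_tensor big_split /=.
by rewrite prodr_const card_ord exprVn.
Qed.

Lemma fourier_coef_basis (b b' : multi) :
  fourier_coef B (tensor (fun j => B (b j))) b' = (b == b')%:R.
Proof.
rewrite fourier_coef_tensor; under eq_bigr do rewrite basis_orth.
have [->|bb] := eqVneq b b'; first by rewrite big1// => j _; rewrite eqxx.
have [j hj] : exists j, b j != b' j.
  apply/existsP; rewrite -negb_forall; apply: contraNN bb => /forallP h.
  by apply/eqP/ffunP => j; apply/eqP/h.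
by rewrite (bigD1 j)//= (negbTE hj) mul0r.
Qed.

Lemma fourier_coef_sum (I : Type) (r : seq I) (P : pred I) (A : I -> tensor_mx R K n) b :
  fourier_coef B (\sum_(i <- r | P i) A i) b = \sum_(i <- r | P i) fourier_coef B (A i) b.
Proof. by rewrite /fourier_coef mulmx_suml tr_sum mulr_sumr. Qed.

Lemma fourier_coefZ c (A : tensor_mx R K n) b :
  fourier_coef B (c *: A) b = c * fourier_coef B A b.
Proof. by rewrite /fourier_coef -scalemxAl mxtraceZ mulrCA. Qed.

Lemma fourier_coef_comb (a : multi -> C) b :
  fourier_coef B (\sum_b a b *: tensor (fun j => B (b j))) b = a b.
Proof.
rewrite fourier_coef_sum (bigD1 b)//= big1 => [|b' ne].
  by rewrite fourier_coefZ fourier_coef_basis eqxx mulr1 addr0.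
by rewrite fourier_coefZ fourier_coef_basis (negbTE ne) mulr0.
Qed.

Definition expands (A : tensor_mx R K n) :=
  A = \sum_b fourier_coef B A b *: tensor (fun j => B (b j)).

Lemma tensor_expands F : expands (tensor F).
Proof.
rewrite /expands.
have -> : tensor F = tensor (fun j => \sum_mu (K%:R^-1 * \tr (F j *m (B mu) ^t*)) *: B mu).
  by apply: eq_tensor => j; apply: basis_expand.
rewrite {1}tensor_sum; apply: eq_bigr => b _.
rewrite tensorZ; congr (_ *: _).
rewrite -(fourier_coef_tensor F); congr (fourier_coef _ _ _).
by apply: eq_tensor => j; apply: basis_expand.
Qed.

Lemma expands_sum (I : Type) (r : seq I) (P : pred I) (A : I -> tensor_mx R K n) :
  (forall i, P i -> expands (A i)) -> expands (\sum_(i <- r | P i) A i).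
Proof.
move=> h; rewrite /expands; under [RHS]eq_bigr do rewrite fourier_coef_sum scaler_suml.
by rewrite exchange_big /=; apply: eq_bigr => i Pi; apply: h.
Qed.

Lemma expandsZ c (A : tensor_mx R K n) : expands A -> expands (c *: A).
Proof.
rewrite /expands => {1}->; rewrite scaler_sumr; apply: eq_bigr => b _.
by rewrite fourier_coefZ scalerA.
Qed.

(** The coefficient of an elementary tensor is a product over the sites. At a site in exactly one of
    [supp b] and [S], one of the two matrices is scalar and the other traceless, so this factor
    vanishes. *)
Lemma H_set_fourier S A : H_set S A ->
  expands A /\ (forall b, supp b != S -> fourier_coef B A b = 0).
Proof.
case=> m [c [F [hF ->]]]; split.
  by apply: expands_sum => k _; apply/expandsZ/tensor_expands.
move=> b hb; rewrite fourier_coef_sum big1// => k _; rewrite fourier_coefZ.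
apply/eqP; rewrite mulf_eq0; apply/orP; right; apply/eqP.
rewrite fourier_coef_tensor.
have [tr0 sc] := hF k.
have [j hj] : exists j, (j \in supp b) != (j \in S).
  apply/existsP; rewrite -negb_forall; apply: contraNN hb => /forallP h.
  by apply/eqP/setP => j; apply/eqP/h.
rewrite (bigD1 j)//=; apply/eqP; rewrite mulf_eq0; apply/orP; left.
move: hj; have [jS|jS] := boolP (j \in S).
  rewrite inE eqb_id negbK => /eqP b0.
  by rewrite basis0// trmx1 map_mx1 mulmx1 tr0// mulr0.
rewrite inE eqbF_neg negbK => b0.
have /is_scalar_mxP[x ->] := sc j jS.
have trJ (M : 'M[C]_K) : \tr (M ^t*) = conjC (\tr M).
  by rewrite /mxtrace rmorph_sum; apply: eq_bigr => i _; rewrite !mxE.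
by rewrite mul_scalar_mx mxtraceZ trJ basis_tr0// rmorph0 !mulr0.
Qed.

Lemma H_hom_fourier r A : H_hom r A ->
  expands A /\ (forall b, #|supp b| != r -> fourier_coef B A b = 0).
Proof.
case=> D [hD ->]; split.
  by apply: expands_sum => S _; have [] := H_set_fourier (hD S).
move=> b hb; rewrite fourier_coef_sum big1// => S /eqP hS.
have [_ ->//] := H_set_fourier (hD S).
by apply: contraNN hb => /eqP ->; rewrite hS.
Qed.

Lemma H_le_fourier d A : H_le d A ->
  expands A /\ (forall b, (d < #|supp b|)%N -> fourier_coef B A b = 0).
Proof.
case=> D [hD ->]; split.
  by apply: expands_sum => r _; have [] := H_hom_fourier (hD r).
move=> b hb; rewrite fourier_coef_sum big1// => r _.
have [_ ->//] := H_hom_fourier (hD r).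
by apply: contraTN hb => /eqP ->; rewrite -leqNgt -ltnS.
Qed.

Lemma H_set0 (S : {set 'I_n}) : H_set S (0 : tensor_mx R K n).
Proof. by exists 0%N, (fun=> 0), (fun _ _ => 0); split=> [[]//|]; rewrite big_ord0. Qed.

Lemma H_hom0 r : H_hom r (0 : tensor_mx R K n).
Proof. by exists (fun=> 0); split=> [S|]; [exact: H_set0|rewrite big1]. Qed.

Lemma H_hom_le r d A : (r <= d)%N -> H_hom r A -> H_le d (A : tensor_mx R K n).
Proof.
move=> rd h; exists (fun s => if s == r then A else 0); split.
  by move=> s; case: eqP => [->//|_]; exact: H_hom0.
rewrite (bigD1 (Ordinal (rd : (r < d.+1)%N)))//= eqxx big1 ?addr0// => i.
by rewrite -val_eqE /= => /negbTE ->.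
Qed.

Lemma elementary_on_basis b : elementary_on (supp b) (fun j => B (b j)).
Proof.
split=> j; rewrite inE; first exact: basis_tr0.
by rewrite negbK => /eqP/basis0 ->; exact: scalar_mx_is_scalar.
Qed.

Definition hom_part (a : multi -> C) r : tensor_mx R K n :=
  \sum_(b | #|supp b| == r) a b *: tensor (fun j => B (b j)).

Lemma hom_part_H a r : H_hom r (hom_part a r).
Proof.
exists (fun S => \sum_(b | supp b == S) a b *: tensor (fun j => B (b j))); split.
  move=> S.
  pose b' (k : 'I_#|{: multi}|) : multi := enum_val k.
  (* All multi-indices are enumerated; those with another support get the zero matrix at every site,
     which is both traceless and scalar. *)
  exists #|{: multi}|, (fun k => if supp (b' k) == S then a (b' k) else 0),
    (fun k j => if supp (b' k) == S then B (b' k j) else 0); split.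
    move=> k; case: eqP => [<-|_]; first exact: elementary_on_basis.
    by split=> j _; [rewrite mxtrace0|apply/is_scalar_mxP; exists 0; rewrite raddf0].
  rewrite big_mkcond /= -sum_enum_val; apply: eq_bigr => k _ /=; rewrite -/(b' k).
  by case: eqP => [//|_]; rewrite scale0r.
rewrite /hom_part (partition_big (fun b => supp b) (fun S => #|S| == r))//=.
apply: eq_bigr => S /eqP hS; apply: eq_bigl => b.
by case: (eqVneq (supp b) S) => [->|]; rewrite ?hS ?eqxx ?andbT ?andbF.
Qed.

Lemma fourier_hom_part a r b :
  fourier_coef B (hom_part a r) b = if #|supp b| == r then a b else 0.
Proof.
rewrite -[RHS](fourier_coef_comb (fun b => if #|supp b| == r then a b else 0)).
rewrite /hom_part big_mkcond; congr fourier_coef; apply: eq_bigr => b' _.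
by case: eqP => //; rewrite scale0r.
Qed.

End Fourier.

(** * Projection onto the homogeneous parts *)

Section Interpolation.
Variable R : realType.
Implicit Types p P Q : {poly R}.

(** Coefficientwise majorization. The Lagrange numerators have alternating signs; turning every
    minus into a plus makes a single coefficient accessible through one value, by [pmaj_coef]. *)
Definition pmaj p P := forall i, `|p`_i| <= P`_i.

Lemma pmaj_mul p p' P Q : pmaj p P -> pmaj p' Q -> pmaj (p * p') (P * Q).
Proof.
move=> h h' i; rewrite !coefM; apply: le_trans (ler_norm_sum _ _ _) _.
by apply: ler_sum => j _; rewrite normrM ler_pM.
Qed.

Lemma pmaj_prod (I : Type) (r : seq I) (A : pred I) (f g : I -> {poly R}) :
  (forall i, pmaj (f i) (g i)) ->
  pmaj (\prod_(i <- r | A i) f i) (\prod_(i <- r | A i) g i).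
Proof.
move=> h; elim/big_ind2: _ => //; last by move=> *; exact: pmaj_mul.
by move=> i; rewrite coef1; case: (i == 0)%N; rewrite ?normr1 ?normr0.
Qed.

Lemma pmaj_coef p P r x : 0 <= x -> pmaj p P -> `|p`_r| * x ^+ r <= P.[x].
Proof.
move=> x0 h; have P0 i : 0 <= P`_i by apply: le_trans (h i); rewrite normr_ge0.
have hs : 0 <= P.[x] by rewrite horner_coef sumr_ge0// => i _; rewrite mulr_ge0// exprn_ge0.
apply: (@le_trans _ _ (P`_r * x ^+ r)); first by rewrite ler_wpM2r// exprn_ge0.
have [rs|rs] := ltnP r (size P); last by rewrite nth_default// mul0r.
rewrite horner_coef (bigD1 (Ordinal rs))//= lerDl sumr_ge0// => i _.
by rewrite mulr_ge0// exprn_ge0.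
Qed.

(** This is the modulus of the Lagrange denominator at the node q / d once the factors d are
    cleared; divided into d! it gives a binomial coefficient. *)
Lemma prod_dist (d q : nat) : (q <= d)%N ->
  \prod_(k < d.+1 | k != q :> nat) `|q%:R - k%:R : R| = (q`! * (d - q)`!)%:R.
Proof.
elim: d q => [|d ih] q.
  by rewrite leqn0 => /eqP ->; rewrite big_pred0// => i; rewrite ord1.
rewrite leq_eqVlt => /orP[/eqP ->|].
  rewrite subnn muln1 big_mkcond big_ord_recr /= eqxx mulr1.
  have -> : \prod_(i < d.+1) (if i != d.+1 :> nat then `|d.+1%:R - i%:R : R| else 1) =
     \prod_(i < d.+1) (d.+1 - i)%:R.
    apply: eq_bigr => i _; rewrite neq_ltn ltn_ord /=.
    by rewrite -natrB ?normr_nat// ltnW.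
  rewrite fact_prod natr_prod -(big_mkord predT (fun i => (d.+1 - i)%:R)) /=.
  rewrite (big_addn 0 d.+2 1) subn1 /= big_nat_rev /= !big_mkord.
  by apply: eq_bigr => i _; congr (_%:R); have := ltn_ord i; lia.
rewrite ltnS => qd; rewrite big_mkcond big_ord_recr /= -big_mkcond /= ih//.
have -> : (d.+1 != q)%N by rewrite gtn_eqF.
rewrite distrC -natrB ?leqW// normr_nat -natrM subSn// factS.
by congr (_%:R); rewrite -mulnA [((d - q)`! * _)%N]mulnC.
Qed.

Lemma central_bin_le (d : nat) : ('C(d.*2, d) <= 4 ^ d)%N.
Proof.
have -> : (4 ^ d = \sum_(i < d.*2.+1) 'C(d.*2, i))%N.
  have -> : (4 ^ d = (1 + 1) ^ d.*2)%N by rewrite -muln2 mulnC expnM.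
  rewrite expnDn; apply: eq_bigr => i _; by rewrite !exp1n !muln1.
have h : (d < d.*2.+1)%N by rewrite ltnS -addnn leq_addr.
by rewrite (bigD1 (Ordinal h))//= leq_addr.
Qed.

Lemma sum_bin (d : nat) : \sum_(q < d.+1) ('C(d, q))%:R = 2 ^+ d :> R.
Proof.
rewrite -natr_sum -natrX; congr (_%:R).
rewrite (_ : 2 ^ d = (1 + 1) ^ d)%N// expnDn; apply: eq_bigr => i _.
by rewrite !exp1n !muln1.
Qed.

(* Lagrange interpolation at the nodes q/d; the binomial C(2d,d) <= 4^d and the
   sum 2^d of the binomials C(d,q) account for the bound 8^d. *)
Lemma lagrange_weights (d : nat) : (0 < d)%N ->
  exists lam : nat -> 'I_d.+1 -> R,
  [/\ forall r s, (r <= d)%N -> (s <= d)%N ->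
        \sum_q lam r q * (q%:R / d%:R) ^+ s = (r == s)%:R,
      forall r, \sum_q `|lam r q| <= 8 ^+ d &
      \sum_q `|lam 1%N q| <= (d * d.+1)%:R * 2 ^+ d].
Proof.
move=> d0; pose hE := (@hornerD R, @hornerN R, @hornerZ R, @hornerX R, @hornerC R).
have dR : (d%:R : R) != 0 by rewrite pnatr_eq0 -lt0n.
have dR0 : 0 <= d%:R :> R by exact: ler0n.
pose N (q : 'I_d.+1) : {poly R} := \prod_(k < d.+1 | k != q :> nat) (d%:R *: 'X - k%:R%:P).
pose W (q : 'I_d.+1) : R := \prod_(k < d.+1 | k != q :> nat) (q%:R - k%:R).
pose L (q : 'I_d.+1) : {poly R} := (W q)^-1 *: N q.
have W0 q : W q != 0.
  by apply/prodf_neq0 => k kq; rewrite subr_eq0 eqr_nat eq_sym.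
have sN q : (size (N q) <= d.+1)%N.
  have hle (k : nat) : (size (d%:R *: 'X - k%:R%:P : {poly R})%R <= 2)%N.
    apply: leq_trans (size_polyD _ _) _; rewrite geq_max size_polyN.
    by rewrite (leq_trans (size_scale_leq _ _)) ?size_polyX// (leq_trans (size_polyC_leq1 _)).
  apply: leq_trans (size_prod_leq _ _) _.
  have cP : #|[pred k : 'I_d.+1 | k != q :> nat]| = d.
    by rewrite -[RHS]/(d.+1.-1) -[in RHS](card_ord d.+1) -(cardC1 q); apply: eq_card => k.
  rewrite cP leq_subLR addnS ltnS.
  apply: (@leq_trans (\sum_(k < d.+1 | k != q :> nat) 2)); first by apply: leq_sum.
  by rewrite sum_nat_const cP muln2 addnn.
have Nv q (x : 'I_d.+1) : (N q).[x%:R / d%:R] = if x == q then W q else 0.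
  rewrite /N horner_prod; case: eqP => [->|/eqP xq].
    by apply: eq_bigr => k _; rewrite !hE mulrCA divff// mulr1.
  rewrite (bigD1 x)/=; last by rewrite val_eqE.
  by rewrite !hE mulrCA divff// mulr1 subrr mul0r.
have interp (s : nat) : (s <= d)%N -> 'X^s = \sum_(q < d.+1) (q%:R / d%:R) ^+ s *: L q.
  move=> sd; apply/eqP; rewrite -subr_eq0; apply/eqP.
  set D : {poly R} := _ - _.
  pose rs : seq R := [seq (val x)%:R / d%:R | x : 'I_d.+1 <- enum 'I_d.+1].
  have D0 := @roots_geq_poly_eq0 R D rs; apply: D0.
  - apply/allP => _ /mapP[x _ ->]; rewrite /root hornerD hornerN hornerXn horner_sum.
    rewrite (bigD1 x)//= big1 => [|y yx]; last by rewrite !hE Nv eq_sym (negbTE yx) !mulr0.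
    by rewrite !hE Nv eqxx mulVf// mulr1 addr0 subrr.
  - rewrite map_inj_uniq ?enum_uniq// => x y.
    by move/(mulIf (invr_neq0 dR))/eqP; rewrite eqr_nat val_eqE => /eqP.
  - rewrite size_map size_enum_ord; apply: leq_trans (size_polyD _ _) _.
    rewrite geq_max size_polyXn ltnS sd size_polyN.
    apply: leq_trans (size_sum _ _ _) _; apply/bigmax_leqP => q _.
    by rewrite !(leq_trans (size_scale_leq _ _))// sN.
have NW q : `|W q| = (q`! * (d - q)`!)%:R.
  by rewrite normr_prod; apply: prod_dist; rewrite -ltnS.
have maj q : pmaj (N q) (\prod_(k < d.+1 | k != q :> nat) (d%:R *: 'X + k%:R%:P)).
  apply: pmaj_prod => k i; rewrite !coefD coefN !coefZ coefX coefC.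
  case: i => [|[|i]] /=; rewrite ?mulr0 ?mulr1 ?oppr0 ?add0r ?addr0 ?subr0 ?normrN ?normr_nat//.
  by rewrite normr0.
(* The free point [x] is used twice: x = 1 treats all coefficients at once, while x = 1 / d reaches
   the linear coefficient at the cost d (d + 1) beside the binomial. *)
have cb r q x : 0 <= x -> `|(L q)`_r| * x ^+ r <=
    (\prod_(k < d.+1 | k != q :> nat) (d%:R * x + k%:R)) / (q`! * (d - q)`!)%:R.
  move=> x0; rewrite coefZ normrM normfV NW mulrC mulrCA [leRHS]mulrC.
  rewrite ler_wpM2l ?invr_ge0//.
  rewrite mulrC; apply: le_trans (pmaj_coef r x0 (maj q)) _.
  by rewrite horner_prod ler_prod// => k _; rewrite !hE lexx addr_ge0// mulr_ge0.
have wbin q : ('C(d, q : 'I_d.+1))%:R = d`!%:R / (q`! * (d - q)`!)%:R :> R.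
  have hq : (q <= d)%N by rewrite -ltnS.
  have w0 : (0 < q`! * (d - q)`!)%N by rewrite muln_gt0 !fact_gt0.
  rewrite -(bin_fact hq); set w := (q`! * _)%N in w0 *.
  by rewrite natrM mulfK// pnatr_eq0 -lt0n.
exists (fun r q => (L q)`_r); split.
- move=> r s rd sd; rewrite -coefXn (interp s sd) coef_sum; apply: eq_bigr => q _.
  by rewrite [RHS]coefZ mulrC.
- move=> r; apply: (@le_trans _ _ (\sum_(q < d.+1) ('C(d.*2, d))%:R * ('C(d, q))%:R)).
    apply: ler_sum => q _; have := cb r q 1 ler01; rewrite expr1n [leLHS]mulr1 => h1; apply: (le_trans h1).
    rewrite wbin mulrA ler_wpM2r ?invr_ge0//.
    (* The factors d + k with k <> q are compared with d + 1, ..., 2 d: the omitted factor d + q is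
       at least d. *)
    have -> : ('C(d.*2, d))%:R * d`!%:R = \prod_(k < d) (d%:R * 1 + k.+1%:R) :> R.
      rewrite -natrM bin_ffact ffact_prod natr_prod (reindex_inj rev_ord_inj) /=.
      apply: eq_bigr => k _; rewrite mulr1 -natrD; congr (_%:R).
      by rewrite -addnn -addnBA ?leq_subr// subKn.
    have hq : 0 < d%:R * 1 + q%:R :> R by rewrite mulr1 ltr_wpDr// ltr0n.
    rewrite -(ler_pM2l hq).
    have -> : (d%:R * 1 + q%:R) * \prod_(k < d.+1 | k != q :> nat) (d%:R * 1 + k%:R) =
       \prod_(k < d.+1) (d%:R * 1 + k%:R) :> R by rewrite [RHS](bigD1 q).
    rewrite big_ord_recl /= ler_wpM2r ?lerD2l ?ler_nat//.
    by rewrite prodr_ge0// => k _; rewrite addr_ge0// mulr1.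
  rewrite -mulr_sumr sum_bin (_ : 8 = 4 * 2) ?exprMn ?ler_wpM2r ?exprn_ge0//; last by ring.
  by rewrite -natrX ler_nat central_bin_le.
- apply: (@le_trans _ _ (\sum_(q < d.+1) (d * d.+1)%:R * ('C(d, q))%:R)).
    apply: ler_sum => q _.
    have := cb 1%N q d%:R^-1; rewrite invr_ge0 dR0 => /(_ isT).
    rewrite expr1 ler_pdivrMr ?ltr0n//; move/le_trans; apply.
    rewrite wbin mulrC [(d * d.+1)%:R]natrM -[leRHS]mulrA ler_wpM2l// [leRHS]mulrA ler_wpM2r ?invr_ge0//.
    rewrite divff// -natrM -factS.
    have -> : (d.+1)`!%:R = \prod_(k < d.+1) (1 + k%:R) :> R.
      rewrite fact_prod natr_prod (big_addn 0 d.+2 1) subn1 /= big_mkord.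
      by apply: eq_bigr => k _; rewrite -[1]/(1%:R) -natrD add1n addn1.
    rewrite [leRHS](bigD1 q)//= -[leLHS]mul1r ler_pM ?ler01//.
    - by rewrite prodr_ge0// => k _; rewrite addr_ge0.
    - by rewrite lerDl.
  by rewrite -mulr_sumr sum_bin.
Qed.

End Interpolation.

(** * The depolarizing channel *)

Section Noise.
Variables (R : realType) (K n : nat).
Local Notation C := R[i].
Hypothesis K_gt0 : (0 < K)%N.
Variable B : 'I_(K ^ 2) -> 'M[C]_K.
Hypothesis Bb : normalized_local_basis B.
Local Notation multi := {ffun 'I_n -> 'I_(K ^ 2)}.

Lemma sqrt_mulJ (x : R) : 0 <= x ->
  ((Num.sqrt x)%:C)%C * conjC ((Num.sqrt x)%:C)%C = (x%:C)%C.
Proof. by move=> x0; rewrite mulcJ normc_real ger0_norm ?sqrtr_ge0// sqr_sqrtr. Qed.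

(* Kraus operators of the depolarizing map X |-> t X + (1 - t) (tr X / K) I. *)
Definition noise_kraus (t : R) (o : option ('I_K * 'I_K)) : 'M[C]_K :=
  match o with
  | None => ((Num.sqrt t)%:C)%C *: 1%:M
  | Some kl => ((Num.sqrt ((1 - t) / K%:R))%:C)%C *: delta_mx kl.1 kl.2
  end.

Lemma sum_option (V : nmodType) (T : finType) (F : option T -> V) :
  \sum_o F o = F None + \sum_x F (Some x).
Proof.
rewrite (bigD1 None)//=; congr (_ + _).
rewrite (reindex_omap Some id) => [|[x|]//]; apply: eq_bigl => x /=.
by rewrite eqxx.
Qed.

Lemma noise_krausE t (F : 'M[C]_K) : 0 <= t <= 1 ->
  \sum_o noise_kraus t o *m F *m (noise_kraus t o) ^t* =
  (t%:C)%C *: F + (((1 - t) / K%:R)%:C)%C *: (\tr F)%:M.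
Proof.
case/andP=> t0 t1.
have adjZ c (M : 'M[C]_K) : (c *: M) ^t* = conjC c *: M ^t*.
  by apply/matrixP => i j; rewrite !mxE rmorphM.
rewrite sum_option; congr (_ + _).
  rewrite /= adjZ trmx1 map_mx1 -!scalemxAl mul1mx -scalemxAr mulmx1 scalerA.
  by rewrite sqrt_mulJ.
under eq_bigr do rewrite /= adjZ -!scalemxAl -scalemxAr scalerA sqrt_mulJ ?divr_ge0 ?subr_ge0//.
rewrite -scaler_sumr; congr (_ *: _).
rewrite -(pair_bigA _ (fun k l => delta_mx k l *m F *m (delta_mx k l) ^t*)) /=.
apply/matrixP => i j; rewrite summxE !mxE.
have e k l : (delta_mx k l *m F *m (delta_mx k l) ^t*) i j =
    ((i == k) && (j == k))%:R * F l l.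
  rewrite mxE (bigD1 l)//= big1 ?addr0 => [|m ml]; last first.
    by rewrite !mxE (negbTE ml) andbF rmorph0 mulr0.
  rewrite !mxE (bigD1 l)//= big1 ?addr0 => [|m ml]; last first.
    by rewrite !mxE (negbTE ml) andbF mul0r.
  rewrite !mxE eqxx !andbT [(_%:R)^*]rmorph_nat mulrAC -natrM mulnb.
  by [].
under eq_bigr do rewrite summxE; rewrite /=.
under eq_bigr do under eq_bigr do rewrite e.
under eq_bigr do rewrite -mulr_sumr.
rewrite -mulr_suml -/(\tr F) -mulr_natl; congr (_ * _).
rewrite (bigD1 i)//= eqxx big1 => [|k ki]; last by rewrite eq_sym (negbTE ki).
by rewrite addr0 eq_sym.
Qed.

Lemma noise_kraus_basis t mu : 0 <= t <= 1 ->
  \sum_o noise_kraus t o *m B mu *m (noise_kraus t o) ^t* =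
  ((t ^+ (val mu != 0)%N)%:C)%C *: B mu.
Proof.
move=> t01; rewrite noise_krausE//.
case: eqP => [h|/eqP h] /=.
  rewrite (basis0 Bb h) mxtrace1 expr0 -[K%:R%:M]scalemx1 scalerA -scalerDl.
  congr (_ *: _); rewrite -(rmorph_nat (real_complex R)) -rmorphM -rmorphD.
  by rewrite mulfVK ?pnatr_eq0 -?lt0n// addrC subrK.
by rewrite basis_tr0// raddf0 scaler0 addr0 expr1.
Qed.

Lemma sum_noise_krausM t : 0 <= t <= 1 ->
  \sum_o noise_kraus t o *m (noise_kraus t o) ^t* = 1%:M.
Proof.
move=> t01; have := noise_krausE 1%:M t01.
under eq_bigr do rewrite mulmx1; move=> ->.
rewrite mxtrace1 -[K%:R%:M]scalemx1 scalerA -scalerDl.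
rewrite -(rmorph_nat (real_complex R)) -rmorphM -rmorphD.
by rewrite mulfVK ?pnatr_eq0 -?lt0n// addrC subrK rmorph1 scale1r.
Qed.

(** The tensors [V w] are the Kraus operators of the n-fold tensor power of the channel, which is
    again unital; every site of the support contributes one factor t. *)
Lemma noise_contract (a : multi -> C) t : 0 <= t <= 1 ->
  op_norm (\sum_b (((t ^+ #|supp b|)%:C)%C * a b) *: tensor (fun j => B (b j))) <=
  op_norm (\sum_b a b *: tensor (fun j => B (b j))).
Proof.
move=> t01.
pose V (w : {ffun 'I_n -> option ('I_K * 'I_K)}) := tensor (fun j => noise_kraus t (w j)).
have hV : \sum_w V w *m (V w) ^t* = 1%:M.
  under eq_bigr do rewrite tensor_adj tensor_mul.
  rewrite -(tensor_sum (fun _ o => noise_kraus t o *m (noise_kraus t o) ^t*)) -tensor1.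
  by apply: eq_tensor => j; rewrite sum_noise_krausM.
apply: le_trans (op_norm_kraus _ hV); rewrite le_eqVlt; apply/orP; left; apply/eqP.
congr op_norm; under [RHS]eq_bigr do rewrite mulmx_sumr mulmx_suml.
rewrite exchange_big /=; apply: eq_bigr => b _.
under [RHS]eq_bigr do rewrite -scalemxAr -scalemxAl tensor_adj !tensor_mul.
rewrite -scaler_sumr mulrC -scalerA; congr (_ *: _).
rewrite -(tensor_sum (fun j o => noise_kraus t o *m B (b j) *m (noise_kraus t o) ^t*)).
have -> : ((t ^+ #|supp b|)%:C)%C = \prod_j ((t ^+ (val (b j) != 0)%N)%:C)%C.
  rewrite -rmorph_prod -prodr_const /= big_mkcond; congr (_%:C)%C.
  by apply: eq_bigr => j _; rewrite inE; case: (_ != _).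
by rewrite -tensorZ; apply: eq_tensor => j; rewrite noise_kraus_basis.
Qed.

Lemma hom_part_norm d r (a : multi -> C) : (0 < d)%N -> (r <= d)%N ->
  (forall b, (d < #|supp b|)%N -> a b = 0) ->
  op_norm (hom_part B a r) <=
  8 ^+ d * op_norm (\sum_b a b *: tensor (fun j => B (b j))).
Proof.
move=> d0 rd a0; have [lam [h1 h2 _]] := lagrange_weights R d0.
set A := \sum_b _.
have -> : hom_part B a r = \sum_(q < d.+1) ((lam r q)%:C)%C *:
    \sum_b (((((q%:R / d%:R) ^+ #|supp b|)%:C)%C * a b) *: tensor (fun j => B (b j))).
  under eq_bigr do rewrite scaler_sumr.
  rewrite exchange_big /hom_part big_mkcond /=; apply: eq_bigr => b _.
  under eq_bigr do rewrite scalerA mulrA -rmorphM.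
  rewrite -scaler_suml -mulr_suml -rC_sum.
  have [db|db] := ltnP d #|supp b|.
    by rewrite a0// mulr0 scale0r; case: ifP.
  by rewrite h1// eq_sym; case: eqP => _; rewrite ?rmorph1 ?mul1r// rmorph0 mul0r scale0r.
apply: le_trans (op_norm_comb _ _) _.
apply: (@le_trans _ _ (\sum_(q < d.+1) `|lam r q| * op_norm A)).
  apply: ler_sum => q _; rewrite normc_real.
  have q01 : 0 <= (q%:R / d%:R : R) <= 1.
    by rewrite divr_ge0//= ler_pdivrMr ?ltr0n// mul1r ler_nat -ltnS.
  exact: ler_wpM2l (normr_ge0 _) _ _ (noise_contract a q01).
by rewrite -mulr_suml ler_wpM2r ?op_norm_ge0.
Qed.

End Noise.

(** * Blei's inequality *)

Section LpNorms.
Variable R : realType.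

Lemma ler_powR2 (p x y : R) : 0 <= p -> 0 <= x -> x <= y -> x `^ p <= y `^ p.
Proof. by move=> p0 x0 xy; rewrite ge0_ler_powR ?nnegrE// (le_trans x0). Qed.

(** Each [x i] is at most [M], hence x^q <= x^p M^(q-p). Stated without roots so that it applies to
    partial sums, such as one homogeneous part. *)
Lemma sum_powR_mono (I : finType) (P : pred I) (x : I -> R) (p q M : R) :
  0 < p -> p <= q -> 0 <= M -> (forall i, 0 <= x i) ->
  \sum_(i | P i) x i `^ p <= M `^ p -> \sum_(i | P i) x i `^ q <= M `^ q.
Proof.
move=> p0 pq M0 x0 h.
have q0 : 0 < q := lt_le_trans p0 pq.
have xM i : P i -> x i <= M.
  move=> Pi; rewrite leNgt; apply/negP => Mx.
  have : M `^ p < x i `^ p by apply: gt0_ltr_powR; rewrite ?nnegrE.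
  rewrite ltNge; move/negP; apply; apply: le_trans h.
  by rewrite (bigD1 i)//= lerDl sumr_ge0// => j _; rewrite powR_ge0.
have [M00|Mn0] := eqVneq M 0.
  rewrite M00 powR0 ?gt_eqF// big1// => i Pi.
  have -> : x i = 0 by apply/eqP; rewrite eq_le x0 andbT -M00 xM.
  by rewrite powR0 ?gt_eqF.
have split_pow y : y != 0 -> y `^ q = y `^ p * y `^ (q - p) :> R.
  by move=> y0; rewrite -powRD ?y0 ?implybT//; congr (_ `^ _); ring.
rewrite [leRHS]split_pow//.
apply: (@le_trans _ _ (\sum_(i | P i) x i `^ p * M `^ (q - p))); last first.
  by rewrite -mulr_suml ler_wpM2r ?powR_ge0.
apply: ler_sum => i Pi; have [->|xi0] := eqVneq (x i) 0.
  by rewrite powR0 ?gt_eqF// mulr_ge0// powR_ge0.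
rewrite split_pow// ler_wpM2l ?powR_ge0// ge0_ler_powR ?nnegrE ?subr_ge0//.
exact: xM.
Qed.

Lemma sum_powR_le (I : finType) (P : pred I) (x : I -> R) (p : R) :
  1 <= p -> (forall i, 0 <= x i) ->
  \sum_(i | P i) x i `^ p <= (\sum_(i | P i) x i) `^ p.
Proof.
move=> p1 x0; apply: (@sum_powR_mono I P x 1) => //; first exact: sumr_ge0.
rewrite powRr1 ?sumr_ge0//; apply: ler_sum => i _; by rewrite powRr1.
Qed.

Lemma BH_exp_ge1 r : (0 < r)%N -> 1 <= BH_exp R r.
Proof.
move=> r0; rewrite /BH_exp ler_pdivlMr ?ltr0n// mul1r ler_nat.
by rewrite mul2n -addnn -addn1 leq_add2l.
Qed.

Lemma BH_exp_mono r d : (r <= d)%N -> BH_exp R r <= BH_exp R d.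
Proof.
move=> rd; rewrite /BH_exp ler_pdivlMr ?ltr0n// mulrAC ler_pdivrMr ?ltr0n//.
by rewrite -!natrM ler_nat; nia.
Qed.

Lemma lp_norm_ge0 (I : finType) p (f : I -> R[i]) : 0 <= lp_norm p f.
Proof. exact: powR_ge0. Qed.

Lemma lp_normX (I : finType) (p : R) (f : I -> R[i]) : p != 0 ->
  lp_norm p f `^ p = \sum_i normc (f i) `^ p.
Proof.
move=> p0; rewrite /lp_norm -powRrM mulVf// powRr1//.
by rewrite sumr_ge0// => i _; rewrite powR_ge0.
Qed.

Lemma lp_norm_le (I : finType) (p M : R) (f : I -> R[i]) : 0 < p -> 0 <= M ->
  \sum_i normc (f i) `^ p <= M `^ p -> lp_norm p f <= M.
Proof.
move=> p0 M0 h; have hs : 0 <= \sum_i normc (f i) `^ p.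
  by rewrite sumr_ge0// => i _; rewrite powR_ge0.
rewrite /lp_norm -[leRHS](powRr1 M0) -(mulfV (lt0r_neq0 p0)) powRrM.
by rewrite ge0_ler_powR ?nnegrE ?invr_ge0 ?powR_ge0// ltW.
Qed.

End LpNorms.

Section Blei.
Variables (R : realType) (K n : nat).
Local Notation multi := {ffun 'I_n -> 'I_(K ^ 2)}.

(** Over all supports together the sum factors into a product over j of 1 + s_j, where s_j is the
    sum of [v j mu] over non-zero mu, and 1 + s <= exp s. *)
Lemma sum_prod_supp_le (v : 'I_n -> 'I_(K ^ 2) -> R) :
  (forall j mu, 0 <= v j mu) ->
  \sum_(b : multi) \prod_(j in supp b) v j (b j) <=
  expR (\sum_j \sum_(mu | val mu != 0%N) v j mu).
Proof.
move=> v0; pose g j (mu : 'I_(K ^ 2)) := if val mu != 0%N then v j mu else 1.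
have -> : \sum_(b : multi) \prod_(j in supp b) v j (b j) = \prod_j \sum_mu g j mu.
  rewrite bigA_distr_bigA /=; apply: eq_bigr => b _.
  by rewrite big_mkcond; apply: eq_bigr => j _; rewrite inE.
rewrite expR_sum; apply: ler_prod => j _.
have g0 mu : 0 <= g j mu by rewrite /g; case: ifP.
rewrite sumr_ge0//=; apply: le_trans (expR_ge1Dx _).
rewrite (bigID (fun mu => val mu != 0%N))/= addrC lerD//; last first.
  by apply: ler_sum => mu h; rewrite /g h.
rewrite (eq_bigr (fun=> 1)) => [|mu /negPf h]; last by rewrite /g h.
rewrite sumr_const lern1.
have [m|m] := posnP (K ^ 2).
  by rewrite (leq_trans (max_card _))// card_ord m.
rewrite (@fintype.eq_card1 _ (Ordinal m))// => mu.
by rewrite -!topredE /= -val_eqE; case: (val mu == 0%N).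
Qed.

(* After normalizing the sum S of the influences to 1, AM-GM bounds each
   [x b ^ BH_exp r] by a weighted sum of the r quotients [x b ^ 2 / influence]
   and of the product of the influences along the support of [b]. *)
Lemma blei (x : multi -> R) (r : nat) : (0 < r)%N -> (forall b, 0 <= x b) ->
  \sum_(b | #|supp b| == r) x b `^ BH_exp R r <=
  (1 + expR 1) * (\sum_j \sum_(mu | val mu != 0%N)
     Num.sqrt (\sum_(b : multi | (#|supp b| == r) && (b j == mu)) x b ^+ 2)) `^ BH_exp R r.
Proof.
move=> r0 x0; set w := fun j mu => Num.sqrt (\sum_(b : multi | (#|supp b| == r) && (b j == mu)) x b ^+ 2).
have p0 : 0 < BH_exp R r := lt_le_trans ltr01 (BH_exp_ge1 R r0).
have w0 j mu : 0 <= w j mu by exact: sqrtr_ge0.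
rewrite -/(\sum_j \sum_(mu | val mu != 0%N) w j mu).
set S := \sum_j _.
have S0 : 0 <= S by apply: sumr_ge0 => j _; apply: sumr_ge0.
have xw (b : multi) j : #|supp b| == r -> x b <= w j (b j).
  move=> hb; rewrite -[leLHS](ger0_norm (x0 b)) -sqrtr_sqr ler_wsqrtr//.
  by rewrite (bigD1 b) ?hb ?eqxx//= lerDl sumr_ge0// => b' _; rewrite sqr_ge0.
have wS (b : multi) j : j \in supp b -> w j (b j) <= S.
  rewrite inE => jb; rewrite /S (bigD1 j)//= (bigD1 (b j))//= -addrA lerDl.
  by rewrite addr_ge0// ?sumr_ge0// => i _; rewrite sumr_ge0.
have exj (b : multi) : #|supp b| == r -> exists j, j \in supp b.
  by move=> /eqP hb; apply/set0Pn; rewrite -card_gt0 hb.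
have [Sz|Sn0] := eqVneq S 0.
  rewrite big1 ?mulr_ge0 ?powR_ge0 ?addr_ge0 ?expR_ge0// => b hb.
  have [j hj] := exj b hb.
  have -> : x b = 0.
    by apply/eqP; rewrite eq_le x0 andbT -Sz (le_trans (xw b j hb)) ?wS.
  by rewrite powR0 ?gt_eqF.
have Sp : 0 < S by rewrite lt_def Sn0.
pose y b := x b / S; pose v j mu := w j mu / S.
have y0 b : 0 <= y b by rewrite divr_ge0.
have v0 j mu : 0 <= v j mu by rewrite divr_ge0.
have xy b : x b `^ BH_exp R r = S `^ BH_exp R r * y b `^ BH_exp R r.
  by rewrite -powRM// mulrC divfK.
under eq_bigr do rewrite xy.
rewrite -mulr_sumr mulrC ler_wpM2r ?powR_ge0//.
apply: (@le_trans _ _ (\sum_(b : multi | #|supp b| == r)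
   (\sum_(j in supp b) y b ^+ 2 / v j (b j) + \prod_(j in supp b) v j (b j)))).
  apply: ler_sum => b hb.
  set M := _ + _.
  have M1 : 0 <= \sum_(j in supp b) y b ^+ 2 / v j (b j).
    by apply: sumr_ge0 => j _; rewrite divr_ge0// sqr_ge0.
  have M2 : 0 <= \prod_(j in supp b) v j (b j) by apply: prodr_ge0.
  have [yz|yn0] := eqVneq (y b) 0.
    by rewrite yz powR0 ?gt_eqF// addr_ge0// -?yz.
  have yp : 0 < y b by rewrite lt_def yn0 y0.
  have vy j : y b <= v j (b j) by rewrite ler_pM2r ?invr_gt0// xw.
  (* The r quotients and the product of the influences are r + 1 non-negative numbers, each at most
     their sum [M], and their product is y^(2r). *)
  have hM : y b ^+ (2 * r) <= M ^+ r.+1.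
    have -> : y b ^+ (2 * r) = \prod_(j in supp b) (y b ^+ 2 / v j (b j)) *
        \prod_(j in supp b) v j (b j).
      rewrite -big_split /= (eq_bigr (fun=> y b ^+ 2)) => [|j _].
        by rewrite prodr_const (eqP hb) exprM.
      by rewrite divfK// gt_eqF// (lt_le_trans yp).
    rewrite [M ^+ _]exprSr ler_pM ?prodr_ge0//.
    - by move=> j _; rewrite divr_ge0// sqr_ge0.
    - rewrite -[in leRHS](eqP hb) -prodr_const; apply: ler_prod => j hj.
      rewrite divr_ge0 ?sqr_ge0//= /M (bigD1 j)//= -addrA lerDl addr_ge0//.
      by apply: sumr_ge0 => i _; rewrite divr_ge0// sqr_ge0.
    - by rewrite /M lerDr.
  rewrite /BH_exp powRrM powR_mulrn//.
  have Mn : 0 <= M by rewrite addr_ge0.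
  have -> : M = (M ^+ r.+1) `^ (r.+1%:R^-1).
    by rewrite -powR_mulrn// -powRrM mulfV ?pnatr_eq0// powRr1.
  by rewrite ge0_ler_powR ?nnegrE ?exprn_ge0 ?invr_ge0.
rewrite big_split /= lerD//.
  (* For fixed j and mu the squares y^2 over the b with b j = mu add up to v^2, so the quotients add
     up to v, and over all (j, mu) to 1. The product term is where [expR 1] comes from: the
     influences now have total 1. *)
  under eq_bigr do rewrite big_mkcond /=.
  rewrite exchange_big /=.
  apply: (@le_trans _ _ (\sum_j \sum_(mu | val mu != 0%N) v j mu)); last first.
    by rewrite /v; under eq_bigr do rewrite -mulr_suml; rewrite -mulr_suml divff.
  apply: ler_sum => j _.
  rewrite -big_mkcondr /= (partition_big (fun b : multi => b j) (fun mu => val mu != 0%N)) /=; last first.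
    by move=> b /andP[_]; rewrite inE.
  apply: ler_sum => mu hmu.
  have [vz|vn0] := eqVneq (v j mu) 0.
    rewrite vz big1// => b /andP[_ /eqP ->]; by rewrite vz invr0 mulr0.
  rewrite (eq_bigr (fun b => y b ^+ 2 / v j mu)) => [|b /andP[_ /eqP ->]//].
  rewrite -mulr_suml ler_pdivrMr ?lt_def ?vn0 ?v0// -expr2 {1}/y.
  under eq_bigr do rewrite expr_div_n.
  rewrite -mulr_suml expr_div_n ler_wpM2r ?invr_ge0 ?sqr_ge0//.
  rewrite sqr_sqrtr ?sumr_ge0// => [|b _]; last exact: sqr_ge0.
  rewrite le_eqVlt; apply/orP; left; apply/eqP; apply: eq_bigl => b.
  by have [e|] := eqVneq (b j) mu; rewrite ?andbF// !andbT inE e hmu andbT.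
apply: (@le_trans _ _ (\sum_(b : multi) \prod_(j in supp b) v j (b j))).
  rewrite [leRHS](bigID (fun b : multi => #|supp b| == r)) /= lerDl.
  by apply: sumr_ge0 => b _; apply: prodr_ge0.
apply: le_trans (sum_prod_supp_le v0) _.
rewrite ler_expR /v; under eq_bigr do rewrite -mulr_suml.
by rewrite -mulr_suml divff.
Qed.

End Blei.

Section HomogeneousParts.
Variables (R : realType) (K n : nat).
Local Notation C := R[i].
Hypothesis K_gt0 : (0 < K)%N.
Variable B : 'I_(K ^ 2) -> 'M[C]_K.
Hypothesis Bb : normalized_local_basis B.
Local Notation multi := {ffun 'I_n -> 'I_(K ^ 2)}.

Lemma normc_tr_le N (A : 'M[C]_N) : normc (\tr A) <= N%:R * op_norm A.
Proof.
apply: le_trans (normc_sum _ _ _) _.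
rewrite mulrC -[N in N%:R]card_ord mulr_natr -sumr_const; apply: ler_sum => i _.
pose e : 'cV[C]_N := delta_mx i 0.
have l2e : l2_norm e = 1.
  rewrite /l2_norm (bigD1 i)//= big1 => [|j ji].
    by rewrite mxE !eqxx Normc.normc1 expr1n addr0 sqrtr1.
  by rewrite mxE (negbTE ji) Normc.normc0 expr0n.
have -> : A i i = (e ^t* *m A *m e) 0 0.
  rewrite mxE (bigD1 i)//= big1 => [|j ji]; last by rewrite [e _ _]mxE (negbTE ji) mulr0.
  rewrite [e _ _]mxE !eqxx mulr1 addr0 mxE (bigD1 i)//= big1 => [|j ji].
    by rewrite !mxE !eqxx rmorph1 mul1r addr0.
  by rewrite !mxE (negbTE ji) rmorph0 mul0r.
by apply: le_trans (bilin_le_op _ _ _) _; rewrite l2e !mulr1.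
Qed.

Lemma card_word : #|{: {ffun 'I_n -> 'I_K}}| = (K ^ n)%N.
Proof. by rewrite card_ffun !card_ord. Qed.

Lemma supp0E (b : multi) j : #|supp b| == 0%N -> val (b j) = 0%N.
Proof.
rewrite cards_eq0 => /eqP h; have : j \notin supp b by rewrite h inE.
by rewrite inE negbK => /eqP.
Qed.

Lemma fourier_coef0_le (A : tensor_mx R K n) b : #|supp b| == 0%N ->
  normc (fourier_coef B A b) <= op_norm A.
Proof.
move=> hb; rewrite /fourier_coef.
have -> : tensor (fun j => B (b j)) = 1%:M.
  by rewrite -tensor1; apply: eq_tensor => j; apply/(basis0 Bb)/supp0E.
have KnR : (K ^ n)%:R != 0 :> R by rewrite pnatr_eq0 -lt0n expn_gt0 K_gt0.
rewrite trmx1 map_mx1 mulmx1 Normc.normcM Normc.normcV normcX.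
have -> : normc (K%:R : C) = K%:R.
  by rewrite -(rmorph_nat (real_complex R)) normc_real normr_nat.
rewrite -natrX ler_pdivrMl ?lt_def ?KnR//= -card_word; exact: normc_tr_le.
Qed.

(** The parts have disjoint supports, so their p-th powers add up exactly; for p >= 1 a sum of p-th
    powers is at most the p-th power of the sum. *)
Lemma lp_of_parts d p (M : nat -> R) (f : multi -> C) : 1 <= p ->
  (forall r, 0 <= M r) -> (forall b, (d < #|supp b|)%N -> f b = 0) ->
  (forall r, (r <= d)%N -> \sum_(b | #|supp b| == r) normc (f b) `^ p <= M r `^ p) ->
  lp_norm p f <= \sum_(r < d.+1) M r.
Proof.
move=> p1 M0 f0 h; have p0 : 0 < p := lt_le_trans ltr01 p1.
have s0 : 0 <= \sum_(r < d.+1) M r by apply: sumr_ge0.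
apply: lp_norm_le => //; apply: le_trans (sum_powR_le predT p1 (fun r : 'I_d.+1 => M0 r)).
apply: (@le_trans _ _ (\sum_(r < d.+1) \sum_(b | #|supp b| == r) normc (f b) `^ p)); last first.
  by apply: ler_sum => r _; apply: h; rewrite -ltnS.
rewrite (exchange_big_dep predT) //=; apply: ler_sum => b _.
have [db|db] := ltnP d #|supp b|.
  by rewrite f0// Normc.normc0 powR0 ?gt_eqF// sumr_ge0// => r _; rewrite powR_ge0.
rewrite (bigD1 (Ordinal (db : (#|supp b| < d.+1)%N)))//= lerDl sumr_ge0// => r _.
by rewrite powR_ge0.
Qed.

Lemma part0_le (A : tensor_mx R K n) p : 0 < p ->
  \sum_(b | #|supp b| == 0%N) normc (fourier_coef B A b) `^ p <= op_norm A `^ p.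
Proof.
move=> p0; have K2 : (0 < K ^ 2)%N by rewrite expn_gt0 K_gt0.
pose b0 : multi := [ffun=> Ordinal K2].
have hb0 b : #|supp b| == 0%N -> b = b0.
  by move=> h; apply/ffunP => j; apply/val_inj; rewrite ffunE /= supp0E.
rewrite big_mkcond (bigD1 b0)//= big1 => [|b bb]; last first.
  by case: ifP => // /hb0 e; rewrite e eqxx in bb.
case: ifP => h; rewrite addr0 ?powR_ge0//.
by apply: ler_powR2 (ltW p0) (normc_ge0 _) _; exact: fourier_coef0_le.
Qed.

Lemma fourier_le_hom d (c : nat -> R) (A : tensor_mx R K n) : (0 < d)%N ->
  (forall r, 0 <= c r) ->
  (forall r (A' : tensor_mx R K n), (0 < r <= d)%N -> H_hom r A' ->
     lp_norm (BH_exp R r) (fourier_coef B A') <= c r * op_norm A') ->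
  1 <= c 0%N -> H_le d A ->
  lp_norm (BH_exp R d) (fourier_coef B A) <=
  8 ^+ d * (\sum_(r < d.+1) c r) * op_norm A.
Proof.
move=> d0 c0 hc c01 HA; have [exA suppA] := H_le_fourier K_gt0 Bb HA.
set a := fourier_coef B A.
have p1 := BH_exp_ge1 R d0; have p0 : 0 < BH_exp R d := lt_le_trans ltr01 p1.
have -> : 8 ^+ d * (\sum_(r < d.+1) c r) * op_norm A =
  \sum_(r < d.+1) c r * (8 ^+ d * op_norm A).
  by rewrite -mulr_suml; ring.
have e0 : 0 <= 8 ^+ d * op_norm A by rewrite mulr_ge0 ?exprn_ge0 ?op_norm_ge0.
apply: (@lp_of_parts d _ (fun r => c r * (8 ^+ d * op_norm A))) => //.
  by move=> r; apply: mulr_ge0.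
(* Degree 0 is a single coefficient, a normalized trace, and is bounded directly: [BH_exp R 0] is 0,
   so there is no inequality [hc] for it. *)
move=> r rd; have [->|r0] := posnP r.
  apply: le_trans (part0_le A p0) _.
  apply: ler_powR2 (ltW p0) (op_norm_ge0 _) _.
  rewrite -[leLHS]mul1r; apply: ler_pM => //; first exact: op_norm_ge0.
  by rewrite -[leLHS]mul1r ler_wpM2r ?op_norm_ge0// exprn_ege1// ler1n.
have q1 := BH_exp_ge1 R r0; have q0 : 0 < BH_exp R r := lt_le_trans ltr01 q1.
apply: (sum_powR_mono q0 (BH_exp_mono R rd)); first exact: mulr_ge0.
  by move=> b; apply: normc_ge0.
have hr := hc r _ _ (hom_part_H K_gt0 Bb a r); rewrite r0 rd in hr.
have {hr} hr := hr isT.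
apply: (@le_trans _ _ (lp_norm (BH_exp R r) (fourier_coef B (hom_part B a r)) `^ BH_exp R r)).
  rewrite (lp_normX _ (lt0r_neq0 q0)) [leLHS]big_mkcond; apply: ler_sum => b _.
  by rewrite fourier_hom_part//; case: ifP => // _; rewrite powR_ge0.
apply: ler_powR2 (ltW q0) (lp_norm_ge0 _ _) _.
apply: le_trans hr _; rewrite ler_wpM2l// [A in leRHS]exA.
exact: hom_part_norm.
Qed.

End HomogeneousParts.

(** * Hypercontractivity *)

Section Update.
Variables (I : finType) (T : eqType).

Definition upd (x : {ffun I -> T}) i t : {ffun I -> T} :=
  [ffun j => if j == i then t else x j].

Lemma upd_same x i t : upd x i t i = t.
Proof. by rewrite ffunE eqxx. Qed.

Lemma upd_other x i t j : j != i -> upd x i t j = x j.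
Proof. by rewrite ffunE => /negbTE ->. Qed.

Lemma upd_upd x i t t' : upd (upd x i t) i t' = upd x i t'.
Proof. by apply/ffunP => j; rewrite !ffunE; case: eqP. Qed.

Lemma upd_id x i : upd x i (x i) = x.
Proof. by apply/ffunP => j; rewrite !ffunE; case: eqP => // ->. Qed.

End Update.

Lemma sum_upd (V : nmodType) (I T : finType) (i : I) (F : {ffun I -> T} -> V) :
  \sum_x \sum_t F (upd x i t) = (\sum_x F x) *+ #|T|.
Proof.
rewrite pair_bigA /=.
(* Exchanging the coordinate at [i] with the fresh value is an involution of the pairs. *)
pose h (p : {ffun I -> T} * T) := (upd p.1 i p.2, p.1 i).
have hh : involutive h by move=> [x t]; rewrite /h /= upd_upd upd_same upd_id.
rewrite (reindex h) /=; last by exists h => x _; apply: hh.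
rewrite -(pair_bigA _ (fun x t => F (upd (upd x i t) i (x i)))) /=.
under eq_bigr do under eq_bigr do rewrite upd_upd upd_id.
by rewrite -sumrMnl; apply: eq_bigr => x _; rewrite sumr_const.
Qed.

Lemma sum_split_at (V : nmodType) (I T : finType) (i : I) (t0 : T) (F : {ffun I -> T} -> V) :
  \sum_x F x = \sum_t \sum_(x : {ffun I -> T} | x i == t0) F (upd x i t).
Proof.
rewrite (partition_big (fun x : {ffun I -> T} => x i) predT) //=.
apply: eq_bigr => t _.
rewrite (reindex_onto (fun x => upd x i t) (fun x => upd x i t0)) /=; last first.
  by move=> x /eqP <-; rewrite upd_upd upd_id.
apply: eq_bigl => x; rewrite upd_same eqxx upd_upd /=.
apply/eqP/eqP => [<-|<-]; first by rewrite upd_same.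
by rewrite upd_id.
Qed.

Section Hypercontractivity.
Variables (R : realType) (I W X : finType) (e : X -> W -> R[i]) (lam : R).
Local Notation C := R[i].
Local Notation multi := {ffun I -> option X}.

Definition eopt (o : option X) (w : W) : C := if o is Some r then e r w else 1.

Definition mono (a : multi) (x : {ffun I -> W}) : C := \prod_i eopt (a i) (x i).

Definition msupp (a : multi) : {set I} := [set i | a i != None].

Hypothesis lam0 : 0 <= lam.
Hypothesis W0 : (0 < #|W|)%N.
Hypothesis one_site : forall (g : C) (h : X -> C),
  \sum_w normc (g + \sum_r e r w * h r) ^+ 4 <=
  #|W|%:R * (normc g ^+ 2 + lam * \sum_r normc (h r) ^+ 2) ^+ 2.

(** The triangle inequality in L2, applied below to squared moduli: it lets the fourth moments of
    the pieces be bounded one at a time. *)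
Lemma minkowski2 (T J : finType) (k : J -> R) (u : J -> T -> R) :
  (forall j, 0 <= k j) ->
  \sum_x (\sum_j k j * u j x) ^+ 2 <= (\sum_j k j * Num.sqrt (\sum_x u j x ^+ 2)) ^+ 2.
Proof.
move=> k0.
have -> : \sum_x (\sum_j k j * u j x) ^+ 2 =
    \sum_j \sum_j' k j * k j' * \sum_x u j x * u j' x.
  under eq_bigr do rewrite expr2 big_distrlr /=.
  rewrite exchange_big /=; apply: eq_bigr => j _.
  rewrite exchange_big /=; apply: eq_bigr => j' _.
  by rewrite mulr_sumr; apply: eq_bigr => x _; ring.
rewrite expr2 big_distrlr /=; apply: ler_sum => j _; apply: ler_sum => j' _.
rewrite mulrACA ler_wpM2l ?mulr_ge0//; exact: CS_sqrt.
Qed.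

Lemma mono_upd (a : multi) (x : {ffun I -> W}) i w : a i = None -> mono a (upd x i w) = mono a x.
Proof.
move=> h; apply: eq_bigr => j _.
by have [->|ji] := eqVneq j i; [rewrite h|rewrite upd_other].
Qed.

Lemma mono_upd2 (a : multi) (x : {ffun I -> W}) i r w : a i = None ->
  mono (upd a i (Some r)) (upd x i w) = e r w * mono a x.
Proof.
move=> h; rewrite /mono (bigD1 i)//= !upd_same /= (bigD1 i (P := predT))//= h /= mul1r.
by congr (_ * _); apply: eq_bigr => j ji; rewrite !upd_other.
Qed.

(** Induction on the set of sites that carry letters. With the other coordinates fixed, the function
    is affine in the letters at [i], so [one_site] applies to the average over that coordinate;
    [minkowski2] then separates the coefficient functions [F o], which depend on fewer sites. *)
Lemma hypercontractive_on (A : {set I}) (c : multi -> C) :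
  (forall a, ~~ (msupp a \subset A) -> c a = 0) ->
  \sum_x normc (\sum_a c a * mono a x) ^+ 4 <=
  (#|W| ^ #|I|)%:R * (\sum_a lam ^+ #|msupp a| * normc (c a) ^+ 2) ^+ 2.
Proof.
have [m] := ubnP #|A|; elim: m => // m IH in A c * => Am cA.
have [A0|[i iA]] := set_0Vmem A.
  pose a0 : multi := [ffun=> None].
  have h a : a != a0 -> c a = 0.
    move=> aa; apply: cA; rewrite A0 finset.subset0; apply: contra aa => /eqP s0.
    apply/eqP/ffunP => j; rewrite ffunE; apply/eqP.
    by have : j \notin msupp a; [rewrite s0 inE|rewrite inE negbK].
  have m0 x : mono a0 x = 1 by rewrite /mono big1// => j _; rewrite ffunE.
  have s0 : msupp a0 = finset.set0 by apply/setP => j; rewrite !inE ffunE.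
  rewrite [X in _ <= _ * X ^+ 2](bigD1 a0)//= [X in _ <= _ * (_ + X) ^+ 2]big1 => [|a aa].
    rewrite s0 cards0 expr0 mul1r addr0 -exprM.
    rewrite (eq_bigr (fun=> normc (c a0) ^+ 4)) => [|x _].
      by rewrite sumr_const card_ffun mulr_natl.
    rewrite (bigD1 a0)//= big1 ?m0 ?mulr1 ?addr0// => a aa.
    by rewrite h// mul0r.
  by rewrite h// Normc.normc0 expr0n mulr0.
pose cc (o : option X) (a : multi) : C := if a i == None then c (upd a i o) else 0.
pose F (o : option X) x : C := \sum_a cc o a * mono a x.
pose al (o : option X) := \sum_a lam ^+ #|msupp a| * normc (cc o a) ^+ 2.
have al0 o : 0 <= al o.
  by apply: sumr_ge0 => a _; rewrite mulr_ge0 ?exprn_ge0 ?normc_ge0.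
have FE o x : F o x = \sum_(a : multi | a i == None) c (upd a i o) * mono a x.
  rewrite /F [RHS]big_mkcond; apply: eq_bigr => a _.
  by rewrite /cc; case: ifP; rewrite ?mul0r.
have ih o : \sum_x normc (F o x) ^+ 4 <= (#|W| ^ #|I|)%:R * al o ^+ 2.
  apply: (IH (A :\ i)); first by rewrite (cardsD1 i) iA add1n ltnS in Am.
  move=> a ha; rewrite /cc; case: eqP => // ai; apply: cA.
  apply: contra ha => /fintype.subsetP ha; apply/fintype.subsetP => j; rewrite inE => aj.
  have ji : j != i by apply: contraNneq aj => ->; apply/eqP.
  by rewrite !inE ji; apply: ha; rewrite inE upd_other.
have Fupd o x w : F o (upd x i w) = F o x.
  by rewrite !FE; apply: eq_bigr => a /eqP ai; rewrite mono_upd.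
have dec x w : \sum_a c a * mono a (upd x i w) =
    F None x + \sum_r e r w * F (Some r) x.
  rewrite (sum_split_at i None) sum_option; congr (_ + _).
    by rewrite FE; apply: eq_bigr => a /eqP ai; rewrite -{2}(upd_id a i) ai upd_upd -{2}ai upd_id mono_upd.
  apply: eq_bigr => r _; rewrite FE mulr_sumr; apply: eq_bigr => a /eqP ai.
  by rewrite mono_upd2// mulrCA.
have W0R : 0 < #|W|%:R :> R by rewrite ltr0n.
rewrite -(ler_pM2l W0R) [leLHS]mulr_natl -(sum_upd i).
under eq_bigr do under eq_bigr do rewrite dec.
apply: (@le_trans _ _ (\sum_(x : {ffun I -> W}) #|W|%:R *
   (normc (F None x) ^+ 2 + lam * \sum_r normc (F (Some r) x) ^+ 2) ^+ 2)).
  by apply: ler_sum => x _; apply: one_site.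
rewrite -mulr_sumr ler_wpM2l//.
pose k (o : option X) := if o is Some _ then lam else 1.
have k0 o : 0 <= k o by case: o => //= _; exact: ler01.
have -> : \sum_(x : {ffun I -> W}) (normc (F None x) ^+ 2 + lam * \sum_r normc (F (Some r) x) ^+ 2) ^+ 2
  = \sum_x (\sum_o k o * normc (F o x) ^+ 2) ^+ 2.
  by apply: eq_bigr => x _; rewrite sum_option /= mul1r mulr_sumr.
apply: le_trans (minkowski2 (fun o x => normc (F o x) ^+ 2) k0) _.
set M : R := (#|W| ^ #|I|)%:R.
have M0 : 0 <= M by exact: ler0n.
have -> : M * (\sum_a lam ^+ #|msupp a| * normc (c a) ^+ 2) ^+ 2 =
   (\sum_o k o * (Num.sqrt M * al o)) ^+ 2.
  under [in RHS]eq_bigr do rewrite mulrCA.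
  rewrite -[in RHS]mulr_sumr exprMn sqr_sqrtr//; congr (_ * _ ^+ 2).
  rewrite (sum_split_at i None); apply: eq_bigr => o _.
  rewrite /al mulr_sumr [RHS](bigID (fun a : multi => a i == None)) /= [X in _ = _ + X]big1 ?addr0 => [|a ai].
    apply: eq_bigr => a /eqP ai; rewrite /cc ai eqxx [RHS]mulrA; congr (_ * _).
    case: o => [r|]; last by rewrite [k None]/= mul1r -ai upd_id.
    rewrite [k _]/= -exprS; congr (_ ^+ _).
    have -> : msupp (upd a i (Some r)) = i |: msupp a.
      apply/setP => j; rewrite !inE; have [->|ji] := eqVneq j i; first by rewrite upd_same.
      by rewrite upd_other.
    by rewrite cardsU1 inE ai eqxx.
  by rewrite /cc (negbTE ai) Normc.normc0 expr0n !mulr0.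
rewrite lerXn2r ?nnegrE ?sumr_ge0//.
- by move=> o _; rewrite mulr_ge0 ?sqrtr_ge0.
- by move=> o _; rewrite !mulr_ge0 ?sqrtr_ge0.
apply: ler_sum => o _; rewrite ler_wpM2l//.
rewrite -[al o]ger0_norm// -sqrtr_sqr -sqrtrM// ler_wsqrtr//.
by under eq_bigr do rewrite -exprM; apply: ih.
Qed.

(** For families of monomials indexed by another type. It is used with [alpha], which writes one
    matrix entry as a monomial in several coins, and with the identity. *)
Lemma hypercontractive_inj (J : finType) (m : J -> multi) (c : J -> C) : injective m ->
  \sum_x normc (\sum_j c j * mono (m j) x) ^+ 4 <=
  (#|W| ^ #|I|)%:R * (\sum_j lam ^+ #|msupp (m j)| * normc (c j) ^+ 2) ^+ 2.
Proof.
move=> minj; pose c' (a : multi) : C := \sum_(j | m j == a) c j.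
have c'm j : c' (m j) = c j.
  by rewrite /c' (eq_bigl (pred1 j)) ?big_pred1_eq// => j'; rewrite /= (inj_eq minj).
have sumJ (V : nmodType) (G : multi -> V) : (forall a, (forall j, m j != a) -> G a = 0) ->
    \sum_a G a = \sum_j G (m j).
  move=> h; rewrite (bigID (fun a : multi => a \in codom m)) /= [X in _ + X]big1 ?addr0 => [|a ha].
    rewrite (eq_bigl (fun a => a \in [set m j | j in predT]%SET)) => [|a].
      by rewrite big_imset//= => j j' _ _; apply: minj.
    by apply/codomP/imsetP => [[j ->]|[j _ ->]]; exists j.
  by apply: h => j; apply: contraNneq ha => <-; apply: codom_f.
have z a : (forall j, m j != a) -> c' a = 0.
  by move=> h; rewrite /c' big_pred0// => j; apply/negbTE.
have := @hypercontractive_on [set: I]%SET c' (fun a => _).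
rewrite (sumJ _ (fun a => lam ^+ #|msupp a| * normc (c' a) ^+ 2)) => [h|a ha]; last first.
  by rewrite z// Normc.normc0 expr0n mulr0.
under [in leRHS]eq_bigr do rewrite -c'm.
apply: le_trans (h _); last by move=> a; rewrite finset.subsetT.
rewrite le_eqVlt; apply/orP; left; apply/eqP; apply: eq_bigr => x _; congr (normc _ ^+ 4).
rewrite (sumJ _ (fun a => c' a * mono a x)) => [|a ha]; last by rewrite z// mul0r.
by apply: eq_bigr => j _; rewrite c'm.
Qed.

End Hypercontractivity.

Section MonoOrth.
Variable R : realType.
Local Notation C := R[i].

Lemma orth_l2 (T J : finType) (f : J -> T -> C) (c : J -> C) (N : nat) :
  (forall j j', \sum_x f j x * conjC (f j' x) = N%:R * (j == j')%:R) ->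
  \sum_x normc (\sum_j c j * f j x) ^+ 2 = N%:R * \sum_j normc (c j) ^+ 2.
Proof.
move=> forth; apply: complexI; rewrite rC_sum.
under eq_bigr do rewrite -mulcJ rmorph_sum big_distrlr /=.
rewrite exchange_big /= rmorphM /= rC_sum mulr_sumr; apply: eq_bigr => j _.
rewrite exchange_big /= (bigD1 j)//= [X in _ + X]big1 ?addr0 => [|j' jj].
  under eq_bigr do rewrite rmorphM mulrACA.
  rewrite -mulr_sumr forth eqxx mulr1 mulcJ mulrC; congr (_ * _).
  by rewrite rmorph_nat.
under eq_bigr do rewrite rmorphM mulrACA.
by rewrite -mulr_sumr forth eq_sym (negbTE jj) !mulr0.
Qed.

Lemma prod_orth (I T J : finType) (f : J -> T -> C) (N : nat) :
  (forall j j', \sum_x f j x * conjC (f j' x) = N%:R * (j == j')%:R) ->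
  forall a a' : {ffun I -> J},
  \sum_(x : {ffun I -> T}) (\prod_i f (a i) (x i)) * conjC (\prod_i f (a' i) (x i)) =
  (N ^ #|I|)%:R * (a == a')%:R.
Proof.
move=> forth a a'.
under eq_bigr do rewrite rmorph_prod -big_split /=.
rewrite -(bigA_distr_bigA (fun i w => f (a i) w * conjC (f (a' i) w))) /=.
under eq_bigr do rewrite forth.
rewrite big_split /= prodr_const -natrX; congr (_ * _).
have [->|aa] := eqVneq a a'; first by rewrite big1// => i _; rewrite eqxx.
have [i hi] : exists i, a i != a' i.
  apply/existsP; rewrite -negb_forall; apply: contraNN aa => /forallP h.
  by apply/eqP/ffunP => i; apply/eqP/h.
by rewrite (bigD1 i)//= (negbTE hi) mul0r.
Qed.

End MonoOrth.

(** * Fourth moments of functions of random coins *)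

Section Coordinates.
Variable R : realType.
Local Notation C := R[i].
Local Notation coin := (bool * bool * bool)%type.

(* A uniform fourth root of unity together with an independent sign. *)
Definition zroot (w : coin) : C := (if w.1.1 then 1 else 'i%C) * (if w.1.2 then 1 else -1).

Definition zsign (w : coin) : R := if w.2 then 1 else -1.

(** The sign will test diagonal entries, the root and its conjugate off-diagonal ones. With signs in
    place of fourth roots, z and its conjugate would coincide, and the entries kl and lk could not
    be told apart. *)
Definition zfun (o : option bool) (w : coin) : C :=
  match o with
  | None => ((zsign w)%:C)%C
  | Some true => zroot w
  | Some false => conjC (zroot w)
  end.

Lemma sum_coin (V : nmodType) (F : coin -> V) :
  \sum_w F w = \sum_x \sum_y \sum_z F (x, y, z).
Proof.
rewrite (eq_bigr (fun w => F (w.1, w.2))) => [|[]//].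
rewrite -(pair_bigA _ (fun p z => F (p, z))) /=.
rewrite (eq_bigr (fun p : bool * bool => \sum_z F ((p.1, p.2), z))) => [|[]//].
by rewrite -(pair_bigA _ (fun x y => \sum_z F (x, y, z))).
Qed.

Lemma card_coin : #|{: coin}| = 8%N.
Proof. by rewrite !card_prod !card_bool. Qed.

Lemma zfun_orth (o o' : option (option bool)) :
  \sum_w eopt zfun o w * conjC (eopt zfun o' w) = #|{: coin}|%:R * (o == o')%:R.
Proof.
rewrite card_coin sum_coin !big_bool /=.
case: o => [[[]|]|]; case: o' => [[[]|]|]; rewrite /= /zfun /zroot /zsign /= !conjCE;
  apply/eqP; rewrite eq_complex; apply/andP; split; apply/eqP; rewrite /=; ring.
Qed.

Lemma normc2_addB (g h : C) :
  normc (g + h) ^+ 2 + normc (g - h) ^+ 2 = 2 * (normc g ^+ 2 + normc h ^+ 2).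
Proof. by rewrite !normc_sqrE; case: g h => a b [c d] /=; ring. Qed.

Lemma normc4_addB (g h : C) :
  normc (g + h) ^+ 4 + normc (g - h) ^+ 4 <=
  2 * (normc g ^+ 4 + 6 * (normc g ^+ 2 * normc h ^+ 2) + normc h ^+ 4).
Proof.
rewrite !(exprM _ 2 2) !normc_sqrE; case: g h => a b [c d] /=.
rewrite -subr_ge0; set E := (X in 0 <= X).
have -> : E = 8 * (a * d - b * c) ^+ 2 by rewrite /E; ring.
by rewrite mulr_ge0// sqr_ge0.
Qed.

(** The eight values of the linear part form four pairs of opposite numbers, to each of which the
    two-point inequality [normc4_addB] applies. Its cross terms add up to 48 G S, with G the square
    of |g| and S the sum of the squares of the |h r|; this matches the cross term of 8 (G + 3 S)^2,
    and the quartic terms stay within 72 S^2. *)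
Lemma zfun_one_site (g : C) (h : option bool -> C) :
  \sum_w normc (g + \sum_r zfun r w * h r) ^+ 4 <=
  #|{: coin}|%:R * (normc g ^+ 2 + 3 * \sum_r normc (h r) ^+ 2) ^+ 2.
Proof.
rewrite card_coin !sum_option !big_bool.
set h1 := h (Some true); set h2 := h (Some false); set h3 := h None.
pose Hf (w : coin) := zfun None w * h3 + (zfun (Some true) w * h1 + zfun (Some false) w * h2).
rewrite (eq_bigr (fun w => normc (g + Hf w) ^+ 4)); last first.
  by move=> w _; rewrite sum_option big_bool.
rewrite sum_coin !big_bool /=.
(* The values of z h1 + conj z h2 at z = 1 and z = i; at -1 and -i they are the opposite ones. *)
pose u1 := h1 + h2; pose u2 := 'i%C * (h1 - h2).
have iJ : conjC ('i%C : C) = - 'i%C.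
  by apply/eqP; rewrite conjCE eq_complex /= oppr0 !eqxx.
have e1 : Hf (true, true, true) = u1 + h3 by rewrite /Hf /zfun /zroot /zsign /= !mulr1 rmorph1 /u1; ring.
have e2 : Hf (true, true, false) = u1 - h3 by rewrite /Hf /zfun /zroot /zsign /= rmorphN !mulr1 rmorph1 /u1; ring.
have e3 : Hf (true, false, true) = - (u1 - h3).
  by rewrite /Hf /zfun /zroot /zsign /= !mul1r rmorphN !rmorph1 /u1; ring.
have e4 : Hf (true, false, false) = - (u1 + h3).
  by rewrite /Hf /zfun /zroot /zsign /= !mul1r !rmorphN !rmorph1 /u1; ring.
have iJN : conjC (- 'i%C : C) = 'i%C by apply/eqP; rewrite conjCE eq_complex /= oppr0 opprK !eqxx.
have e5 : Hf (false, true, true) = u2 + h3.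
  by rewrite /Hf /zfun /zroot /zsign /= !mulr1 [conjC _]iJ rmorph1 /u2; ring.
have e6 : Hf (false, true, false) = u2 - h3.
  by rewrite /Hf /zfun /zroot /zsign /= !mulr1 [conjC _]iJ rmorphN rmorph1 /u2; ring.
have e7 : Hf (false, false, true) = - (u2 - h3).
  by rewrite /Hf /zfun /zroot /zsign /= !mulrN1 [conjC _]iJN rmorph1 /u2; ring.
have e8 : Hf (false, false, false) = - (u2 + h3).
  by rewrite /Hf /zfun /zroot /zsign /= !mulrN1 [conjC _]iJN rmorphN rmorph1 /u2; ring.
rewrite e1 e2 e3 e4 e5 e6 e7 e8.
have p1 := normc4_addB g (u1 + h3).
have p2 := normc4_addB g (u1 - h3).
have p3 := normc4_addB g (u2 + h3).
have p4 := normc4_addB g (u2 - h3).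
have q1 := normc4_addB u1 h3.
have q2 := normc4_addB u2 h3.
have s1 := normc2_addB u1 h3.
have s2 := normc2_addB u2 h3.
have s3 : normc u1 ^+ 2 + normc u2 ^+ 2 = 2 * (normc h1 ^+ 2 + normc h2 ^+ 2).
  rewrite -normc2_addB /u2 Normc.normcM (_ : normc 'i%C = 1) ?mul1r//.
  by rewrite /= expr0n expr1n add0r sqrtr1.
have f4 z : normc z ^+ 4 = (normc z ^+ 2) ^+ 2 :> R by rewrite -exprM.
rewrite !f4 in p1 p2 p3 p4 q1 q2 *.
move: p1 p2 p3 p4 q1 q2 s1 s2 s3.
have sq (z : C) : 0 <= normc z ^+ 2 by apply: sqr_ge0.
move: (sq g) (sq h1) (sq h2) (sq h3) (sq u1) (sq u2).
move: (normc (g + (u1 + h3)) ^+ 2) (normc (g - (u1 + h3)) ^+ 2) (normc (g + (u1 - h3)) ^+ 2)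
  (normc (g - (u1 - h3)) ^+ 2) (normc (g + (u2 + h3)) ^+ 2) (normc (g - (u2 + h3)) ^+ 2)
  (normc (g + (u2 - h3)) ^+ 2) (normc (g - (u2 - h3)) ^+ 2).
move: (normc (u1 + h3) ^+ 2) (normc (u1 - h3) ^+ 2) (normc (u2 + h3) ^+ 2) (normc (u2 - h3) ^+ 2).
move: (normc g ^+ 2) (normc h1 ^+ 2) (normc h2 ^+ 2) (normc h3 ^+ 2) (normc u1 ^+ 2) (normc u2 ^+ 2).
move=> G H1 H2 H3 U1 U2 A1 A2 A3 A4 x1 x2 x3 x4 x5 x6 x7 x8 G0 H10 H20 H30 U10 U20.
move=> p1 p2 p3 p4 q1 q2 s1 s2 s3.
have t1 : U1 ^+ 2 + U2 ^+ 2 <= (2 * (H1 + H2)) ^+ 2.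
  by rewrite -s3 sqrrD addrAC lerDl mulrn_wge0// mulr_ge0.
pose S := H1 + H2 + H3.
have sA : A1 + A2 + A3 + A4 = 4 * S by rewrite /S; lra.
have sA2 : A1 ^+ 2 + A2 ^+ 2 + A3 ^+ 2 + A4 ^+ 2 <= 12 * S ^+ 2.
  have e : U1 * H3 + U2 * H3 = 2 * (H1 + H2) * H3 by rewrite -mulrDl s3.
  have : A1 ^+ 2 + A2 ^+ 2 + A3 ^+ 2 + A4 ^+ 2 <=
    2 * (2 * (H1 + H2)) ^+ 2 + 12 * (2 * (H1 + H2) * H3) + 4 * H3 ^+ 2 by lra.
  move=> /le_trans; apply; rewrite -subr_ge0 /S.
  have -> : 12 * (H1 + H2 + H3) ^+ 2 - (2 * (2 * (H1 + H2)) ^+ 2 + 12 * (2 * (H1 + H2) * H3) + 4 * H3 ^+ 2)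
    = 4 * (H1 + H2) ^+ 2 + 8 * H3 ^+ 2 by ring.
  by apply: addr_ge0; apply: mulr_ge0 => //; apply: sqr_ge0.
have eG : G * A1 + G * A2 + G * A3 + G * A4 = 4 * (G * S) by rewrite -!mulrDr sA; ring.
have -> : 8 * (G + 3 * (H3 + (H1 + H2))) ^+ 2 = 8 * G ^+ 2 + 48 * (G * S) + 72 * S ^+ 2.
  by rewrite /S; ring.
have S2 : 0 <= S ^+ 2 by exact: sqr_ge0.
lra.
Qed.

End Coordinates.

(** Interpolation of L2 between L1 and L4, which turns an L4-L2 comparison into an L2-L1 comparison.
    Two Cauchy-Schwarz inequalities through the third moment avoid fractional powers. *)
Lemma holder124 (R : realType) (T : finType) (f : T -> R) : (forall x, 0 <= f x) ->
  (\sum_x f x ^+ 2) ^+ 3 <= (\sum_x f x) ^+ 2 * \sum_x f x ^+ 4.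
Proof.
move=> f0; set s1 := \sum_x f x; set s2 := \sum_x f x ^+ 2; set s4 := \sum_x f x ^+ 4.
pose s3 := \sum_x f x ^+ 3.
have p1 : 0 <= s1 by apply: sumr_ge0.
have p2 : 0 <= s2 by apply: sumr_ge0 => x _; apply: sqr_ge0.
have p3 : 0 <= s3 by apply: sumr_ge0 => x _; apply: exprn_ge0.
have p4 : 0 <= s4 by apply: sumr_ge0 => x _; apply: exprn_ge0.
have h1 : s2 ^+ 2 <= s1 * s3.
  have := CS_real (fun x => Num.sqrt (f x)) (fun x => Num.sqrt (f x) * f x).
  have -> : \sum_x Num.sqrt (f x) * (Num.sqrt (f x) * f x) = s2.
    by apply: eq_bigr => x _; rewrite mulrA -expr2 sqr_sqrtr// -expr2.
  have -> : \sum_x Num.sqrt (f x) ^+ 2 = s1 by apply: eq_bigr => x _; rewrite sqr_sqrtr.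
  have -> : \sum_x (Num.sqrt (f x) * f x) ^+ 2 = s3.
    by apply: eq_bigr => x _; rewrite exprMn sqr_sqrtr// -exprS.
  by [].
have h2 : s3 ^+ 2 <= s2 * s4.
  have := CS_real f (fun x => f x ^+ 2).
  have -> : \sum_x f x * f x ^+ 2 = s3 by apply: eq_bigr => x _; rewrite -exprS.
  have -> : \sum_x (f x ^+ 2) ^+ 2 = s4 by apply: eq_bigr => x _; rewrite -exprM.
  by [].
have [z|nz] := eqVneq s2 0; first by rewrite z expr0n /= mulr_ge0// sqr_ge0.
have sp : 0 < s2 by rewrite lt_def nz.
rewrite -(ler_pM2l sp) -exprS.
apply: (@le_trans _ _ ((s1 * s3) ^+ 2)).
  by rewrite (exprM s2 2 2) lerXn2r// nnegrE ?exprn_ge0// mulr_ge0.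
by rewrite exprMn [leRHS]mulrCA; apply: ler_wpM2l => //; apply: sqr_ge0.
Qed.

Section Sites.
Variables (R : realType) (K : nat).
Local Notation C := R[i].
Local Notation coin := (bool * bool * bool)%type.
Local Notation conf := {ffun 'I_K -> coin}.
Local Notation entry := ('I_K * 'I_K)%type.

Definition phi (kl : entry) (y : conf) : C :=
  if kl.1 == kl.2 then ((zsign R (y kl.1))%:C)%C
  else conjC (zroot R (y kl.1)) * zroot R (y kl.2).

(** Realizes [phi] by monomials of degree at most 2 in K independent coins, so that the K^2
    dependent functions [phi] inherit orthogonality and hypercontractivity from the coins. *)
Definition alpha (o : option entry) : {ffun 'I_K -> option (option bool)} :=
  match o with
  | None => [ffun=> None]
  | Some kl => [ffun i => if kl.1 == kl.2 then (if i == kl.1 then Some None else None)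
       else if i == kl.1 then Some (Some false)
       else if i == kl.2 then Some (Some true) else None]
  end.

Lemma alpha_inj : injective alpha.
Proof.
move=> o o' /ffunP h.
case: o h => [[k l]|] h; case: o' h => [[k' l']|] h //.
- have := h k; have := h l; rewrite !ffunE /=.
  case: (eqVneq k l) => [<-|kl]; case: (eqVneq k' l') => [<-|kl'];
    rewrite ?eqxx.
  + by move=> _; case: eqVneq => // ->.
  + by move=> _; case: eqVneq => // _; case: eqVneq.
  + by move=> _; case: eqVneq.
  + move=> hl; case: eqVneq => [e|_]; last by case: eqVneq.
    move=> _; move: hl; rewrite -e eq_sym (negbTE kl).
    by case: eqVneq => // ->.
- by have := h k; rewrite !ffunE /= eqxx; case: ifP.
- by have := h k'; rewrite !ffunE /= eqxx; case: ifP.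
Qed.

Lemma mono_alpha o y : mono (zfun R) (alpha o) y = eopt phi o y.
Proof.
case: o => [[k l]|] /=; last by rewrite /mono big1// => i _; rewrite ffunE.
rewrite /mono /phi /=; have [_|kl] := eqVneq k l.
  rewrite (bigD1 k)//= ffunE ifT// big1 ?mulr1// => i ik.
  by rewrite ffunE (negbTE ik).
rewrite (bigD1 k)//= (bigD1 l)/=; last by rewrite eq_sym.
rewrite !ffunE /= (negbTE kl) !eqxx [l == k]eq_sym (negbTE kl) /= big1 ?mulr1// => i /andP[ik il].
by rewrite ffunE (negbTE ik) (negbTE il).
Qed.

Lemma msupp_alpha o : (#|msupp (alpha o)| <= 2)%N.
Proof.
case: o => [[k l]|]; last first.
  by rewrite (_ : msupp _ = finset.set0) ?cards0//; apply/setP => i; rewrite !inE ffunE.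
apply: (@leq_trans #|[set k; l]%SET|); last by rewrite cards2; case: (_ != _).
apply: subset_leq_card; apply/fintype.subsetP => i; rewrite !inE ffunE /=.
by case: (k == l); case: (i == k); case: (i == l).
Qed.

Lemma card_conf : #|{: conf}| = (#|{: coin}| ^ #|'I_K|)%N.
Proof. by rewrite card_ffun. Qed.

Lemma phi_orth (o o' : option entry) :
  \sum_y eopt phi o y * conjC (eopt phi o' y) = #|{: conf}|%:R * (o == o')%:R.
Proof.
under eq_bigr do rewrite -!mono_alpha.
by rewrite (prod_orth (@zfun_orth R)) (inj_eq alpha_inj) card_conf.
Qed.

Lemma conf_gt0 : (0 < #|{: conf}|)%N.
Proof. by rewrite card_conf expn_gt0 card_coin. Qed.

(** The constant 9 is 3^2: 3 for each coin, and [alpha] uses at most two coins. *)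
Lemma phi_one_site (g : C) (h : entry -> C) :
  \sum_y normc (g + \sum_r phi r y * h r) ^+ 4 <=
  #|{: conf}|%:R * (normc g ^+ 2 + 9 * \sum_r normc (h r) ^+ 2) ^+ 2.
Proof.
pose c (o : option entry) := if o is Some r then h r else g.
have l0 : 0 <= 3 :> R by [].
have W0 : (0 < #|{: coin}|)%N by rewrite card_coin.
have := hypercontractive_inj l0 W0 (@zfun_one_site R) c alpha_inj.
rewrite -card_conf => H; apply: le_trans (le_trans H _).
  rewrite le_eqVlt; apply/orP; left; apply/eqP; apply: eq_bigr => y _; congr (normc _ ^+ 4).
  rewrite sum_option mono_alpha mulr1; congr (_ + _).
  by apply: eq_bigr => r _; rewrite mono_alpha mulrC.
rewrite ler_wpM2l// sum_option lerXn2r// ?nnegrE.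
- by rewrite addr_ge0 ?sumr_ge0// => [|r _]; apply: mulr_ge0; rewrite ?exprn_ge0 ?normc_ge0.
- rewrite addr_ge0 ?exprn_ge0 ?normc_ge0// mulr_ge0// sumr_ge0// => r _.
  by rewrite exprn_ge0 ?normc_ge0.
rewrite lerD//.
  rewrite (_ : msupp _ = finset.set0) ?cards0 ?mul1r//.
  by apply/setP => i; rewrite !inE ffunE.
rewrite mulr_sumr; apply: ler_sum => r _; rewrite ler_wpM2r ?exprn_ge0 ?normc_ge0//.
have -> : 9 = 3 ^+ 2 :> R by ring.
by rewrite ler_eXn2l ?msupp_alpha// ltr1n.
Qed.

Variable n : nat.
Local Notation word := {ffun 'I_n -> option entry}.
Local Notation sample := {ffun 'I_n -> conf}.

Lemma card_sample : #|{: sample}| = (#|{: conf}| ^ #|'I_n|)%N.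
Proof. by rewrite card_ffun. Qed.

(** Hypercontractivity bounds the normalized fourth moment by (9^D)^2 times the square of the second
    one; [holder124] then brings in the first moment, and the square root leaves 9^D. *)
Lemma phi_l2_l1 (d : word -> C) (D : nat) :
  (forall k, (D < #|msupp k|)%N -> d k = 0) ->
  #|{: sample}|%:R * Num.sqrt (\sum_k normc (d k) ^+ 2) <=
  9 ^+ D * \sum_(x : sample) normc (\sum_k d k * mono phi k x).
Proof.
move=> dD; set s := \sum_k normc (d k) ^+ 2; set N := #|_|%:R.
set F := fun x : sample => \sum_k d k * mono phi k x.
have s0 : 0 <= s by apply: sumr_ge0 => k _; apply: sqr_ge0.
have N0 : 0 < N :> R by rewrite ltr0n card_sample expn_gt0 conf_gt0.
have l2 : \sum_(x : sample) normc (F x) ^+ 2 = N * s.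
  by rewrite (orth_l2 d (prod_orth phi_orth)) -card_sample.
have l0 : 0 <= 9 :> R by [].
have l4 : \sum_(x : sample) normc (F x) ^+ 4 <= N * (9 ^+ D * s) ^+ 2.
  have := hypercontractive_inj l0 conf_gt0 phi_one_site d (@inj_id _).
  rewrite -card_sample -/N => /le_trans; apply; rewrite ler_wpM2l ?(ltW N0)//.
  have nn k : 0 <= normc (d k) ^+ 2 by apply: sqr_ge0.
  rewrite lerXn2r ?nnegrE//.
  - by apply: sumr_ge0 => k _; apply: mulr_ge0 => //; apply: exprn_ge0.
  - by apply: mulr_ge0 => //; apply: exprn_ge0.
  rewrite mulr_sumr; apply: ler_sum => k _.
  have [h|h] := ltnP D #|msupp k|; first by rewrite dD// Normc.normc0 expr0n !mulr0.
  by rewrite ler_wpM2r// ler_eXn2l// ltr1n.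
have F0 (x : sample) : 0 <= normc (F x) by apply: normc_ge0.
have S0 : 0 <= \sum_(x : sample) normc (F x) by apply: sumr_ge0.
have := holder124 F0; rewrite l2 => h3.
have h4 : N ^+ 2 * s <= (9 ^+ D) ^+ 2 * (\sum_(x : sample) normc (F x)) ^+ 2.
  have [->|sn] := eqVneq s 0; first by rewrite mulr0 mulr_ge0 ?sqr_ge0.
  have sp : 0 < N * s ^+ 2 by rewrite mulr_gt0// exprn_gt0// lt_def sn.
  rewrite -(ler_pM2r sp).
  have -> : N ^+ 2 * s * (N * s ^+ 2) = (N * s) ^+ 3 by ring.
  apply: le_trans h3 _.
  apply: le_trans (ler_wpM2l (sqr_ge0 _) l4) _.
  by rewrite le_eqVlt; apply/orP; left; apply/eqP; ring.
have lhs : N * Num.sqrt s = Num.sqrt (N ^+ 2 * s).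
  by rewrite sqrtrM ?sqr_ge0// sqrtr_sqr ger0_norm// ltW.
rewrite lhs.
have -> : 9 ^+ D * (\sum_(x : sample) normc (F x)) =
   Num.sqrt ((9 ^+ D) ^+ 2 * (\sum_(x : sample) normc (F x)) ^+ 2).
  by rewrite -exprMn sqrtr_sqr ger0_norm// mulr_ge0// exprn_ge0.
exact: ler_wsqrtr.
Qed.

End Sites.

(** * Random product states and the upper bound *)

Lemma conjC_realM (R : realType) (a : R) (z : R[i]) :
  conjC ((a%:C)%C * z) = (a%:C)%C * conjC z.
Proof. by rewrite rmorphM; congr (_ * _); apply: conjc_real. Qed.

Section States.
Variables (R : realType) (K : nat).
Local Notation C := R[i].
Hypothesis K_gt0 : (0 < K)%N.
Variable B : 'I_(K ^ 2) -> 'M[C]_K.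
Hypothesis Bb : normalized_local_basis B.
Local Notation coin := (bool * bool * bool)%type.
Local Notation conf := {ffun 'I_K -> coin}.
Local Notation entry := ('I_K * 'I_K)%type.

Let KR0 : (K%:R : R) != 0. Proof. by rewrite pnatr_eq0 -lt0n. Qed.
Let KRp : 0 < (K%:R : R). Proof. by rewrite ltr0n. Qed.

(* The random state (1/2K) z z^* + (1/2K) diag (1 + (eps_k - mean eps) / 2):
   the first part sees the off-diagonal entries, the second the diagonal. *)
Definition ustate (y : conf) (q : option 'I_K) : 'cV[C]_K :=
  match q with
  | None => \col_k ((((Num.sqrt K%:R)^-1)%:C)%C * zroot R (y k))
  | Some k => delta_mx k 0
  end.

Definition sign_mean (y : conf) : R := K%:R^-1 * \sum_k zsign R (y k).

(** Subtracting the mean of the signs makes the trace equal to 1, and the division by 2 keeps the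
    weights non-negative. *)
Definition wstate (y : conf) (q : option 'I_K) : R :=
  match q with
  | None => 2^-1
  | Some k => (2 * K%:R)^-1 * (1 + (zsign R (y k) - sign_mean y) / 2)
  end.

Definition rho y : 'M[C]_K :=
  \sum_q ((wstate y q)%:C)%C *: (ustate y q *m (ustate y q) ^t*).

Definition Xf mu y := \tr (B mu *m rho y).

Lemma zroot_norm w : normc (zroot R w) = 1.
Proof.
rewrite /zroot Normc.normcM; case: w => [[[] []] s] /=;
  by rewrite ?oppr0 ?expr0n ?sqrrN ?expr1n /= ?addr0 ?add0r ?sqrtr1 mulr1.
Qed.

Lemma zsign_norm w : `|zsign R w| = 1.
Proof. by rewrite /zsign; case: w.2; rewrite ?normrN normr1. Qed.

Lemma wstate_ge0 y q : 0 <= wstate y q.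
Proof.
case: q => [k|] /=; last by rewrite invr_ge0.
rewrite mulr_ge0 ?invr_ge0 ?mulr_ge0//.
have m1 : `|sign_mean y| <= 1.
  rewrite normrM normfV normr_nat mulrC ler_pdivrMr// mul1r.
  apply: le_trans (ler_norm_sum _ _ _) _.
  under eq_bigr do rewrite zsign_norm.
  by rewrite sumr_const card_ord.
move: m1; rewrite ler_norml => /andP[? ?].
have : - 1 <= zsign R (y k) by rewrite /zsign; case: (y k).2; lra.
lra.
Qed.

Lemma l2_ustate y q : l2_norm (ustate y q) ^+ 2 = 1.
Proof.
rewrite l2_norm_sqr; case: q => [k|] /=.
  rewrite (bigD1 k)//= mxE !eqxx Normc.normc1 expr1n big1 ?addr0// => i ik.
  by rewrite mxE (negbTE ik) Normc.normc0 expr0n.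
rewrite (eq_bigr (fun=> K%:R^-1)) => [|k _].
  by rewrite sumr_const card_ord -[LHS]mulr_natr mulVf.
rewrite mxE Normc.normcM zroot_norm mulr1 normc_real ger0_norm ?invr_ge0 ?sqrtr_ge0//.
by rewrite exprVn sqr_sqrtr// ltW.
Qed.

Lemma wstate_sum y : \sum_q wstate y q * l2_norm (ustate y q) ^+ 2 = 1.
Proof.
under eq_bigr do rewrite l2_ustate mulr1.
rewrite sum_option /= -mulr_sumr big_split /= sumr_const card_ord.
rewrite -mulr_suml big_split /= sumrN sumr_const card_ord.
rewrite /sign_mean -[(_ * _) *+ K]mulr_natl mulrA mulfV// mul1r subrr mul0r addr0.
by field.
Qed.

Lemma tr_rank1 (M : 'M[C]_K) (u : 'cV[C]_K) : \tr (M *m (u *m u ^t*)) = (u ^t* *m M *m u) 0 0.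
Proof. by rewrite mulmxA mxtrace_mulC mulmxA /mxtrace big_ord1. Qed.

Lemma XfE0 mu y : val mu = 0%N -> Xf mu y = 1.
Proof.
move=> h; rewrite /Xf (basis0 Bb h) mul1mx /rho tr_sum.
have -> : 1 = ((\sum_q wstate y q * l2_norm (ustate y q) ^+ 2)%:C)%C :> C.
  by rewrite wstate_sum.
rewrite rC_sum; apply: eq_bigr => q _.
rewrite mxtraceZ -[X in \tr X]mul1mx tr_rank1 mulmx1 l2_norm_dot.
by rewrite -rmorphM.
Qed.

Definition phi_weight (kl : entry) : R :=
  if kl.1 == kl.2 then (4 * K%:R)^-1 else (2 * K%:R)^-1.

Lemma XfE mu y : val mu != 0%N ->
  Xf mu y = \sum_kl phi R kl y * (((phi_weight kl)%:C)%C * B mu kl.1 kl.2).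
Proof.
move=> h; rewrite /Xf /rho mulmx_sumr tr_sum sum_option /= -scalemxAr mxtraceZ tr_rank1.
set c : R := (2 * K%:R)^-1 + (2 * K%:R)^-1 * (1 - sign_mean y / 2).
have e1 : ((2^-1)%:C)%C * (((ustate y None) ^t* *m B mu *m ustate y None) 0 0) =
   \sum_(kl : entry) (((2 * K%:R)^-1)%:C)%C * (conjC (zroot R (y kl.1)) * zroot R (y kl.2) * B mu kl.1 kl.2).
  rewrite -(pair_bigA _ (fun k l => (((2 * K%:R)^-1)%:C)%C * (conjC (zroot R (y k)) * zroot R (y l) * B mu k l))).
  rewrite exchange_big /= mxE mulr_sumr; apply: eq_bigr => l _.
  rewrite mxE mulr_suml mulr_sumr; apply: eq_bigr => k _.
  rewrite !mxE conjC_realM.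
  set s := Num.sqrt _.
  have -> : (2 * K%:R)^-1 = 2^-1 * (s^-1 * s^-1).
    by rewrite -invfM -expr2 sqr_sqrtr ?ler0n// invfM.
  by rewrite !rmorphM; ring.
have e2 : \sum_(k < K) \tr (B mu *m (((wstate y (Some k))%:C)%C *:
       (ustate y (Some k) *m (ustate y (Some k)) ^t*))) =
   \sum_(k < K) ((wstate y (Some k))%:C)%C * B mu k k.
  apply: eq_bigr => k _; rewrite -scalemxAr mxtraceZ tr_rank1 /=; congr (_ * _).
  rewrite mxE (bigD1 k)//= [X in _ + X]big1 ?addr0 => [|l lk]; last first.
    by rewrite [delta_mx _ _ _ _]mxE (negbTE lk) mulr0.
  rewrite [delta_mx _ _ _ _]mxE !eqxx mulr1 mxE (bigD1 k)//= big1 ?addr0 => [|l lk]; last first.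
    by rewrite !mxE (negbTE lk) rmorph0 mul0r.
  by rewrite !mxE !eqxx rmorph1 mul1r.
rewrite e1 e2.
(* [c] collects the part of the diagonal weights that is the same for all k, including the mean of
   the signs; tracelessness removes it and leaves the sign of k over 4 K, as in [phi_weight]. *)
have tr0 : \sum_k (c%:C)%C * B mu k k = 0.
  by rewrite -mulr_sumr -/(\tr (B mu)) (basis_tr0 K_gt0 Bb h) mulr0.
rewrite -[RHS]addr0 -[X in _ = _ + X]tr0.
rewrite -(pair_bigA _ (fun k l => (((2 * K%:R)^-1)%:C)%C * (conjC (zroot R (y k)) * zroot R (y l) * B mu k l))) /=.
rewrite -(pair_bigA _ (fun k l => phi R (k, l) y * (((phi_weight (k, l))%:C)%C * B mu k l))) /=.
rewrite -!big_split /=; apply: eq_bigr => k _.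
rewrite (bigD1 k)//= [in RHS](bigD1 k)//= addrAC [RHS]addrAC.
congr (_ + _); last first.
  by apply: eq_bigr => l lk; rewrite /phi /phi_weight /= eq_sym (negbTE lk); ring.
rewrite /phi /phi_weight /= eqxx.
have -> : conjC (zroot R (y k)) * zroot R (y k) = 1.
  by rewrite mulrC mulcJ zroot_norm expr1n.
rewrite mul1r -!mulrDl mulrA -mulrDl; congr (_ * _).
apply/eqP; rewrite eq_complex /=; apply/andP; split; apply/eqP; rewrite /c /=; last by ring.
by field.
Qed.

Definition Zc (mu : 'I_(K ^ 2)) (o : option entry) : C :=
  match o with
  | None => (val mu == 0%N)%:R
  | Some kl => if val mu == 0%N then 0 else ((phi_weight kl)%:C)%C * B mu kl.1 kl.2
  end.

(** The isometric version of [Zc]: its rows are orthonormal for every normalized local basis, and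
    [Zc] arises by multiplying each column by [Zscale], which depends on the entry alone. *)
Definition Uc (mu : 'I_(K ^ 2)) (o : option entry) : C :=
  match o with
  | None => (val mu == 0%N)%:R
  | Some kl => if val mu == 0%N then 0 else (((Num.sqrt K%:R)^-1)%:C)%C * B mu kl.1 kl.2
  end.

Definition Zscale (o : option entry) : R :=
  if o is Some kl then Num.sqrt K%:R * phi_weight kl else 1.

Lemma ZcE mu o : Zc mu o = ((Zscale o)%:C)%C * Uc mu o.
Proof.
case: o => [kl|] /=; last by rewrite mul1r.
case: ifP => _; first by rewrite mulr0.
rewrite mulrA -rmorphM mulrAC mulfV ?mul1r//.
by rewrite gt_eqF// sqrtr_gt0.
Qed.

Lemma Xf_expand mu y : Xf mu y = \sum_o Zc mu o * eopt (@phi R K) o y.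
Proof.
rewrite sum_option /= mulr1; have [h|h] := eqVneq (val mu) 0%N.
  by rewrite XfE0// big1 ?addr0// => kl _; rewrite mul0r.
by rewrite XfE// add0r; apply: eq_bigr => kl _; rewrite mulrC.
Qed.

Lemma Uc_orth mu nu : \sum_o Uc mu o * conjC (Uc nu o) = 1%:R * (mu == nu)%:R.
Proof.
rewrite mul1r sum_option /= rmorph_nat.
have [hm|hm] := eqVneq (val mu) 0%N; have [hn|hn] := eqVneq (val nu) 0%N.
- rewrite big1 => [|kl _]; last by rewrite mul0r.
  by rewrite addr0 mulr1 -val_eqE hm hn eqxx.
- rewrite big1 => [|kl _]; last by rewrite mul0r.
  by rewrite addr0 mulr0 -val_eqE hm eq_sym (negbTE hn).
- rewrite big1 => [|kl _]; last by rewrite rmorph0 mulr0.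
  by rewrite addr0 mul0r -val_eqE hn (negbTE hm).
rewrite mul0r add0r -(basis_orth Bb) /mxtrace mulr_sumr.
rewrite -(pair_bigA _ (fun k l => (((Num.sqrt K%:R)^-1)%:C)%C * B mu k l * conjC ((((Num.sqrt K%:R)^-1)%:C)%C * B nu k l))) /=.
apply: eq_bigr => k _; rewrite mxE mulr_sumr; apply: eq_bigr => l _.
rewrite !mxE rmorphM mulrACA; congr (_ * _).
rewrite mulcJ normc_real ger0_norm ?invr_ge0 ?sqrtr_ge0// exprVn sqr_sqrtr ?ler0n//.
by rewrite fmorphV rmorph_nat.
Qed.

Lemma Zscale_ge o : (4 * Num.sqrt K%:R)^-1 <= Zscale o.
Proof.
have s1 : 1 <= Num.sqrt K%:R :> R by rewrite -[leLHS]sqrtr1 ler_wsqrtr// ler1n.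
have s0 : 0 < Num.sqrt K%:R :> R by apply: lt_le_trans s1.
have ss : Num.sqrt K%:R * Num.sqrt K%:R = K%:R :> R by rewrite -expr2 sqr_sqrtr// ltW.
case: o => [kl|] /=; last first.
  by rewrite invf_le1 ?mulr_gt0// -[leLHS]mulr1 ler_pM//; lra.
have -> : (4 * Num.sqrt K%:R)^-1 = Num.sqrt K%:R * (4 * K%:R)^-1 :> R.
  by set s := Num.sqrt _ in ss s0 *; rewrite -ss; field; rewrite gt_eqF.
rewrite ler_wpM2l ?(ltW s0)// /phi_weight; case: ifP => // _.
by rewrite lef_pV2 ?posrE ?mulr_gt0// ler_wpM2r ?(ltW KRp)//; lra.
Qed.

(** A linear function of the random state has variance bounded below by its coefficients; 16 K is
    the square of the inverse of the smallest [Zscale]. It yields a configuration at which the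
    function is large, whatever the constant [g]. *)
Lemma one_site_l2 (g : C) (D : 'I_(K ^ 2) -> C) :
  #|{: conf}|%:R * ((16 * K%:R)^-1 * \sum_(mu | val mu != 0%N) normc (D mu) ^+ 2) <=
  \sum_y normc (g + \sum_(mu | val mu != 0%N) Xf mu y * D mu) ^+ 2.
Proof.
pose c (o : option entry) : C := (o == None)%:R * g + \sum_(mu | val mu != 0%N) D mu * Zc mu o.
have -> : \sum_y normc (g + \sum_(mu | val mu != 0%N) Xf mu y * D mu) ^+ 2 =
   \sum_y normc (\sum_o c o * eopt (@phi R K) o y) ^+ 2.
  apply: eq_bigr => y _; congr (normc _ ^+ 2).
  rewrite /c; under [RHS]eq_bigr do rewrite mulrDl mulr_suml.
  rewrite big_split /= exchange_big /=; congr (_ + _).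
    by rewrite sum_option /= mul1r mulr1 big1 ?addr0// => kl _; rewrite !mul0r.
  by apply: eq_bigr => mu _; rewrite Xf_expand mulr_suml; apply: eq_bigr => o _; ring.
rewrite (orth_l2 c (@phi_orth R K)) ler_wpM2l//.
have -> : \sum_(mu | val mu != 0%N) normc (D mu) ^+ 2 =
   \sum_o normc (\sum_mu (if val mu != 0%N then D mu else 0) * Uc mu o) ^+ 2.
  rewrite (orth_l2 _ Uc_orth) mul1r [LHS]big_mkcond; apply: eq_bigr => mu _.
  by case: ifP => // _; rewrite Normc.normc0 expr0n.
rewrite mulr_sumr !sum_option; apply: lerD.
  rewrite big1 ?Normc.normc0 ?expr0n ?mulr0 ?sqr_ge0// => mu _.
  by case: eqP => [_|/eqP/negbTE]; rewrite ?mul0r//= => ->; rewrite mulr0.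
apply: ler_sum => kl _.
have -> : c (Some kl) = ((Zscale (Some kl))%:C)%C * \sum_mu (if val mu != 0%N then D mu else 0) * Uc mu (Some kl).
  rewrite /c mul0r add0r mulr_sumr big_mkcond; apply: eq_bigr => mu _.
  by case: ifP => h; rewrite ?mul0r ?mulr0// ZcE mulrCA.
rewrite Normc.normcM exprMn ler_wpM2r ?sqr_ge0//.
have := Zscale_ge (Some kl); rewrite normc_real => hz.
have h0 : 0 <= (4 * Num.sqrt K%:R)^-1 :> R by rewrite invr_ge0 mulr_ge0 ?sqrtr_ge0.
have -> : (16 * K%:R)^-1 = (4 * Num.sqrt K%:R)^-1 ^+ 2 :> R.
  by rewrite exprVn exprMn sqr_sqrtr ?(ltW KRp)//; congr (_ * _)^-1; ring.
by rewrite ger0_norm ?(le_trans h0)// lerXn2r// nnegrE// (le_trans h0).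
Qed.

End States.

(** * Derivatives along paths of product states *)

Section UpperBound.
Variables (R : realType) (K n : nat).
Local Notation C := R[i].
Hypothesis K_gt0 : (0 < K)%N.
Variable B : 'I_(K ^ 2) -> 'M[C]_K.
Hypothesis Bb : normalized_local_basis B.
Local Notation coin := (bool * bool * bool)%type.
Local Notation conf := {ffun 'I_K -> coin}.
Local Notation entry := ('I_K * 'I_K)%type.
Local Notation multi := {ffun 'I_n -> 'I_(K ^ 2)}.
Local Notation word := {ffun 'I_n -> option entry}.
Local Notation sample := {ffun 'I_n -> conf}.
Local Notation Xf := (Xf B).

Let KRp : 0 < (K%:R : R). Proof. by rewrite ltr0n. Qed.

Definition Gf (c : multi -> C) (x : sample) : C := \sum_b c b * \prod_j Xf (b j) (x j).

Lemma Gf_l2_l1 (c : multi -> C) (D : nat) :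
  (forall b, (D < #|supp b|)%N -> c b = 0) ->
  #|{: sample}|%:R * Num.sqrt (\sum_b normc (c b) ^+ 2) <=
  (36 * Num.sqrt K%:R) ^+ D * \sum_x normc (Gf c x).
Proof.
move=> cD.
pose u (k : word) := \sum_b c b * \prod_j Uc B (b j) (k j).
pose d (k : word) := \sum_b c b * \prod_j Zc B (b j) (k j).
(* [Uc] vanishes unless None is matched with mu = 0, so the change of coordinates preserves supports
   and with them the degree. *)
have u0 (k : word) : (D < #|msupp k|)%N -> u k = 0.
  move=> hk; rewrite /u big1// => b _.
  have [e|ne] := eqVneq (supp b) (msupp k); first by rewrite cD ?mul0r// e.
  have [j hj] : exists j, (j \in supp b) != (j \in msupp k).
    apply/existsP; rewrite -negb_forall; apply: contraNN ne => /forallP h.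
    by apply/eqP/setP => j; apply/eqP/h.
  rewrite (bigD1 j)//= (_ : Uc B (b j) (k j) = 0) ?mul0r ?mulr0//.
  by move: hj; rewrite !inE; case: (k j) => [kl|] /=; case: (_ == 0%N).
have dE (k : word) : d k = ((\prod_j Zscale R (k j))%:C)%C * u k.
  rewrite /d /u mulr_sumr; apply: eq_bigr => b _.
  rewrite mulrCA; congr (_ * _); rewrite rmorph_prod -big_split /=.
  by apply: eq_bigr => j _; rewrite ZcE.
have GE x : Gf c x = \sum_k d k * mono (@phi R K) k x.
  rewrite /Gf /d; under [RHS]eq_bigr do rewrite mulr_suml.
  rewrite exchange_big /=; apply: eq_bigr => b _.
  under eq_bigr do rewrite (Xf_expand K_gt0 Bb).
  rewrite bigA_distr_bigA mulr_sumr /=; apply: eq_bigr => k _.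
  by rewrite big_split /= mulrA.
have dD (k : word) : (D < #|msupp k|)%N -> d k = 0.
  by move=> hk; rewrite dE u0 ?mulr0.
have l1 := phi_l2_l1 dD.
under [in X in _ <= _ * X]eq_bigr do rewrite GE.
set S1 := \sum_(x : sample) _ in l1 *.
have su : \sum_b normc (c b) ^+ 2 = \sum_k normc (u k) ^+ 2.
  rewrite (orth_l2 c (prod_orth (Uc_orth Bb))) exp1n mul1r.
  by [].
have s1 : 1 <= Num.sqrt K%:R :> R by rewrite -[leLHS]sqrtr1 ler_wsqrtr// ler1n.
have s0 : 0 < Num.sqrt K%:R :> R by apply: lt_le_trans s1.
set q : R := 4 * Num.sqrt K%:R.
have q1 : 1 <= q by rewrite -[leLHS]mulr1 ler_pM//; lra.
have q0 : 0 < q by apply: lt_le_trans q1.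
have sd : \sum_k normc (u k) ^+ 2 <= (q ^+ D) ^+ 2 * \sum_k normc (d k) ^+ 2.
  rewrite mulr_sumr; apply: ler_sum => k _.
  have [hk|hk] := ltnP D #|msupp k|.
    by rewrite u0// Normc.normc0 expr0n mulr_ge0 ?sqr_ge0.
  rewrite dE Normc.normcM [X in _ * X]exprMn [leRHS]mulrA -[leLHS]mul1r.
  apply: ler_wpM2r; first exact: sqr_ge0.
  rewrite -exprMn normc_real -[leLHS](expr1n _ 2) lerXn2r ?nnegrE ?mulr_ge0 ?exprn_ge0 ?(ltW q0)//.
  rewrite normr_prod.
  have h1 : q ^- #|msupp k| <= \prod_j `|Zscale R (k j)|.
    rewrite -exprVn -prodr_const big_mkcond /=; apply: ler_prod => j _.
    have q0' : 0 <= q^-1 by rewrite invr_ge0 ltW.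
    rewrite inE; case: (k j) => [kl|] /=; last by rewrite normr1 ler01 lexx.
    rewrite q0' (le_trans (Zscale_ge R K_gt0 (Some kl)))//.
    exact: ler_norm.
  apply: le_trans (ler_wpM2l (exprn_ge0 D (ltW q0)) h1).
  rewrite ler_pdivlMr ?exprn_gt0// mul1r ler_weXn2l//.
rewrite su.
apply: (@le_trans _ _ (#|{: sample}|%:R * (q ^+ D * Num.sqrt (\sum_k normc (d k) ^+ 2)))).
  rewrite ler_wpM2l// -[q ^+ D]ger0_norm ?exprn_ge0 ?(ltW q0)// -sqrtr_sqr -sqrtrM ?sqr_ge0//.
  exact: ler_wsqrtr.
rewrite mulrCA.
have -> : (36 * Num.sqrt K%:R) ^+ D * S1 = q ^+ D * (9 ^+ D * S1).
  by rewrite mulrA -exprMn; congr (_ ^+ _ * _); rewrite /q; ring.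
by rewrite ler_wpM2l ?exprn_ge0 ?(ltW q0).
Qed.

Variable a : multi -> C.
Variable d : nat.
Hypothesis d_gt0 : (0 < d)%N.
Hypothesis ad : forall b, (d < #|supp b|)%N -> a b = 0.
Let A : tensor_mx R K n := \sum_b a b *: tensor (fun j => B (b j)).

(* Fourier coefficients of the partial derivative of [a] in the direction of B_mu at site j. *)
Definition dcoef (j : 'I_n) (mu : 'I_(K ^ 2)) (b : multi) : C :=
  if val (b j) == 0%N then a (upd b j mu) else 0.

Let K2 : (0 < K ^ 2)%N. Proof. by rewrite expn_gt0 K_gt0. Qed.
Let mu0 : 'I_(K ^ 2) := Ordinal K2.

Lemma val_mu0 mu : (val mu == 0%N) = (mu == mu0).
Proof. by rewrite -val_eqE. Qed.

Lemma dcoef_supp j mu b : val mu != 0%N -> (d.-1 < #|supp b|)%N -> dcoef j mu b = 0.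
Proof.
move=> hmu hb; rewrite /dcoef; case: ifP => // bj; apply: ad.
have -> : supp (upd b j mu) = j |: supp b.
  apply/setP => i; rewrite !inE; have [->|ij] := eqVneq i j; first by rewrite upd_same.
  by rewrite upd_other.
by rewrite cardsU1 inE bj /= add1n; case: (d) d_gt0 hb.
Qed.

Lemma dcoef_l2 j mu : 
  \sum_b normc (dcoef j mu b) ^+ 2 = \sum_(b : multi | b j == mu) normc (a b) ^+ 2.
Proof.
rewrite [RHS](reindex_onto (fun b => upd b j mu) (fun b => upd b j mu0)) /=; last first.
  by move=> b /eqP <-; rewrite upd_upd upd_id.
rewrite [LHS](bigID (fun b : multi => b j == mu0)) /= [X in _ + X]big1 ?addr0 => [|b bj]; last first.
  by rewrite /dcoef val_mu0 (negbTE bj) Normc.normc0 expr0n.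
apply: eq_big => [b|b bj]; last by rewrite /dcoef val_mu0 bj.
rewrite upd_same eqxx upd_upd /=.
by apply/eqP/eqP => [<-|<-]; rewrite ?upd_id ?upd_same.
Qed.

Lemma Gf_dcoef j mu x : Gf (dcoef j mu) x =
  \sum_(b : multi | b j == mu0) a (upd b j mu) * \prod_(i | i != j) Xf (b i) (x i).
Proof.
rewrite /Gf [LHS](bigID (fun b : multi => b j == mu0)) /= [X in _ + X]big1 ?addr0 => [|b bj]; last first.
  by rewrite /dcoef val_mu0 (negbTE bj) mul0r.
apply: eq_bigr => b bj; rewrite /dcoef val_mu0 bj; congr (_ * _).
by rewrite (bigD1 j)//= (XfE0 K_gt0 Bb) ?mul1r// (eqP bj).
Qed.

Lemma tr_mix (M r1 r2 : 'M[C]_K) (t : C) :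
  \tr (M *m ((1 - t) *: r1 + t *: r2)) = \tr (M *m r1) + t * (\tr (M *m r2) - \tr (M *m r1)).
Proof. by rewrite mulmxDr -!scalemxAr mxtraceD !mxtraceZ; ring. Qed.

(** At every site the mixture of the states of [x] and [y] is again a state; the pairs of a flag and
    an index of [ustate] enumerate its pure components. *)
Lemma state_path_le (x y : sample) (t : R) : 0 <= t <= 1 ->
  normc (\sum_b a b * \prod_j (Xf (b j) (x j) + (t%:C)%C * (Xf (b j) (y j) - Xf (b j) (x j))))
  <= op_norm A.
Proof.
case/andP=> t0 t1.
pose w (j : 'I_n) (q : bool * option 'I_K) : R :=
  (if q.1 then t else 1 - t) * wstate R (if q.1 then y j else x j) q.2.
pose u (j : 'I_n) (q : bool * option 'I_K) : 'cV[C]_K :=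
  ustate R (if q.1 then y j else x j) q.2.
have w0 j q : 0 <= w j q.
  by rewrite /w mulr_ge0 ?wstate_ge0//; case: q.1; rewrite ?subr_ge0.
have w1 j : \sum_q w j q * l2_norm (u j q) ^+ 2 = 1.
  rewrite -(pair_bigA _ (fun s q => w j (s, q) * l2_norm (u j (s, q)) ^+ 2)) /= big_bool /w /u /=.
  under eq_bigr do rewrite -mulrA; rewrite -mulr_sumr wstate_sum// mulr1.
  under eq_bigr do rewrite -mulrA; rewrite -mulr_sumr wstate_sum// mulr1.
  by rewrite addrC subrK.
have := tr_mul_state A w0 w1; congr (normc _ <= _).
rewrite mulmx_suml tr_sum; apply: eq_bigr => b _.
rewrite -scalemxAl mxtraceZ tensor_mul tr_tensor; congr (_ * _).
apply: eq_bigr => j _.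
have -> : \sum_q ((w j q)%:C)%C *: (u j q *m (u j q) ^t*) =
   ((1 - t)%:C)%C *: rho R (x j) + (t%:C)%C *: rho R (y j).
  rewrite -(pair_bigA _ (fun s q => ((w j (s, q))%:C)%C *: (u j (s, q) *m (u j (s, q)) ^t*))) /=.
  rewrite big_bool /= addrC /rho !scaler_sumr.
  by congr (_ + _); apply: eq_bigr => q _; rewrite scalerA -rmorphM.
rewrite rmorphB rmorph1.
exact: tr_mix.
Qed.

(** Expanding over the set J of sites where [be] is taken gives powers of degree |J|. Sets with more
    than d elements meet a zero of [be], and among the others the weights select the singletons. *)
Lemma prod_linear_coef1 (al be : 'I_n -> C) (lam : 'I_d.+1 -> R) :
  (#|[set j | be j != 0%R]%SET| <= d)%N ->
  (forall s, (s <= d)%N -> \sum_q lam q * (q%:R / d%:R) ^+ s = (1 == s)%N%:R) ->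
  \sum_q ((lam q)%:C)%C * \prod_j (al j + (((q : 'I_d.+1)%:R / d%:R)%:C)%C * be j) =
  \sum_j be j * \prod_(i | i != j) al i.
Proof.
move=> hbe hlam.
pose T (J : {set 'I_n}) := \prod_(j in J) be j * \prod_(j in ~: J) al j.
have e q : \prod_j (al j + (((q : 'I_d.+1)%:R / d%:R)%:C)%C * be j) =
    \sum_(J : {set 'I_n}) ((((q : 'I_d.+1)%:R / d%:R) ^+ #|J|)%:C)%C * T J.
  under eq_bigr do rewrite addrC.
  rewrite bigA_distr; apply: eq_bigr => J _; rewrite /T mulrA.
  rewrite [LHS](bigID (fun j => j \in J)) /=; congr (_ * _).
    rewrite (eq_bigr (fun j => (((q%:R / d%:R)%:C)%C : C) * be j)) => [|j ->//].
    by rewrite big_split /= prodr_const rmorphXn.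
  by apply: eq_big => [j|j /negbTE ->//]; rewrite inE.
under eq_bigr do rewrite e mulr_sumr.
rewrite exchange_big /=.
under eq_bigr do under eq_bigr do rewrite mulrA -rmorphM.
under eq_bigr do rewrite -mulr_suml -rC_sum.
have key (J : {set 'I_n}) : ((\sum_(q < d.+1) lam q * (q%:R / d%:R) ^+ #|J|)%:C)%C * T J =
    if #|J| == 1%N then T J else 0.
  have [hJ|hJ] := leqP #|J| d.
    by rewrite hlam// eq_sym; case: eqP => _; rewrite ?rmorph1 ?mul1r// rmorph0 mul0r.
  have T0 : T J = 0.
    have : ~~ (J \subset [set j | be j != 0%R]%SET).
      by apply/negP => /subset_leq_card; rewrite leqNgt (leq_ltn_trans hbe hJ).
    case/subsetPn => j jJ; rewrite inE negbK => /eqP bj.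
    by rewrite /T (bigD1 j jJ) /= bj !mul0r.
  by rewrite T0 mulr0; case: ifP.
under eq_bigr do rewrite key.
rewrite -big_mkcond /=.
rewrite (eq_bigl (fun J => J \in [set [set j]%SET | j in predT]%SET)) => [|J]; last first.
  by apply/cards1P/imsetP => [[j ->]|[j _ ->]]; exists j.
rewrite big_imset /= => [|i j _ _]; last exact: set1_inj.
apply: eq_bigr => j _; rewrite /T big_set1; congr (_ * _).
by apply: eq_bigl => i; rewrite !inE.
Qed.

Lemma derivative_le (x y : sample) :
  normc (\sum_j \sum_(mu | val mu != 0%N)
     (Xf mu (y j) - Xf mu (x j)) * Gf (dcoef j mu) x) <=
  (d * d.+1)%:R * 2 ^+ d * op_norm A.
Proof.
have [lam [h1 _ h3]] := lagrange_weights R d_gt0.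
have -> : \sum_j \sum_(mu | val mu != 0%N)
     (Xf mu (y j) - Xf mu (x j)) * Gf (dcoef j mu) x =
   \sum_(q < d.+1) ((lam 1%N q)%:C)%C * \sum_b a b *
     \prod_j (Xf (b j) (x j) + ((q%:R / d%:R)%:C)%C * (Xf (b j) (y j) - Xf (b j) (x j))).
  under [RHS]eq_bigr do rewrite mulr_sumr.
  rewrite [RHS]exchange_big /=.
  under [RHS]eq_bigr do under eq_bigr do rewrite mulrCA.
  under [RHS]eq_bigr do rewrite -mulr_sumr.
  have e b : a b * (\sum_(q < d.+1) ((lam 1%N q)%:C)%C *
     \prod_j (Xf (b j) (x j) + ((q%:R / d%:R)%:C)%C * (Xf (b j) (y j) - Xf (b j) (x j)))) =
     \sum_j a b * ((Xf (b j) (y j) - Xf (b j) (x j)) * \prod_(i | i != j) Xf (b i) (x i)).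
    have [hb|hb] := ltnP d #|supp b|.
      by rewrite ad// mul0r big1// => j _; rewrite mul0r.
    rewrite (@prod_linear_coef1 (fun j => Xf (b j) (x j))
      (fun j => Xf (b j) (y j) - Xf (b j) (x j)) (lam 1%N)) ?mulr_sumr//; last first.
      by move=> s sd; apply: h1.
    apply: leq_trans hb; apply: subset_leq_card; apply/fintype.subsetP => j; rewrite !inE.
    by apply: contraNneq => bj; rewrite !(XfE0 K_gt0 Bb)// subrr.
  under [RHS]eq_bigr do rewrite e.
  rewrite [RHS]exchange_big /=; apply: eq_bigr => j _.
  (* The indices are sorted by their letter at j. The letter 0 contributes nothing, its test
     function being constantly 1; every other letter gives a partial derivative. *)
  rewrite [RHS](sum_split_at j mu0) [RHS](bigID (fun mu => val mu != 0%N)) /=.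
  rewrite [X in _ = _ + X]big1 ?addr0 => [|mu hmu]; last first.
    rewrite big1// => b _; rewrite upd_same.
    by move: hmu; rewrite negbK => /eqP hmu; rewrite !(XfE0 K_gt0 Bb)// subrr mul0r mulr0.
  apply: eq_bigr => mu hmu; rewrite Gf_dcoef mulr_sumr; apply: eq_bigr => b bj.
  rewrite upd_same mulrCA; congr (_ * (_ * _)).
  by apply: eq_bigr => i ij; rewrite upd_other.
apply: le_trans (normc_sum _ _ _) _.
apply: (@le_trans _ _ (\sum_(q < d.+1) `|lam 1%N q| * op_norm A)).
  apply: ler_sum => q _; rewrite Normc.normcM normc_real ler_wpM2l//.
  apply: state_path_le.
  by rewrite divr_ge0//= ler_pdivrMr ?ltr0n// mul1r ler_nat -ltnS.
by rewrite -mulr_suml ler_wpM2r ?op_norm_ge0.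
Qed.

End UpperBound.

(** Replacing [Y j] by [x0 j] deletes the j-th term, so one may keep only the terms whose real part
    is positive. Doing the same for the negative real part and for both signs of the imaginary part
    gives the factor 4. *)
Lemma sum_choice (R : realType) (n : nat) (T : Type) (f : 'I_n -> T -> R[i]) (x0 : 'I_n -> T) (M : R) :
  (forall j, f j (x0 j) = 0) ->
  (forall Y : 'I_n -> T, normc (\sum_j f j (Y j)) <= M) ->
  forall Y : 'I_n -> T, \sum_j normc (f j (Y j)) <= 4 * M.
Proof.
move=> f0 hf Y.
have part (p : R[i] -> R) : p 0 = 0 -> (forall z, p z <= normc z) ->
    (forall (F : 'I_n -> R[i]), p (\sum_j F j) = \sum_j p (F j)) ->
    \sum_j Num.max (p (f j (Y j))) 0 <= M.
  move=> p0 p1 p2.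
  pose Y' j := if 0 <= p (f j (Y j)) then Y j else x0 j.
  have -> : \sum_j Num.max (p (f j (Y j))) 0 = \sum_j p (f j (Y' j)).
    apply: eq_bigr => j _; rewrite /Y'; case: (lerP 0 (p (f j (Y j)))) => h //.
    by rewrite f0 p0.
  by rewrite -p2; apply: le_trans (p1 _) (hf Y').
have Im_sum (F : 'I_n -> R[i]) : Im (\sum_j F j) = \sum_j Im (F j).
  by elim/big_rec2: _ => [//|i z [u v] _ /= ->]; case: (F i).
have ImN (z : R[i]) : `|Im z| <= normc z.
  case: z => u v /=; rewrite -sqrtr_sqr ler_wsqrtr// lerDr; exact: sqr_ge0.
have ReN (z : R[i]) : `|Re z| <= normc z.
  case: z => u v /=; rewrite -sqrtr_sqr ler_wsqrtr// lerDl; exact: sqr_ge0.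
have h1 : \sum_j Num.max (Re (f j (Y j))) 0 <= M.
  by apply: (part (@complex.Re R)) => // [z|F]; [exact: le_Re_normc|exact: Re_sum].
have h2 : \sum_j Num.max (- Re (f j (Y j))) 0 <= M.
  apply: (part (fun z => - Re z)) => [|z|F]; first by rewrite oppr0.
    by apply: le_trans (ReN z); rewrite -normrN ler_norm.
  by rewrite Re_sum sumrN.
have h3 : \sum_j Num.max (Im (f j (Y j))) 0 <= M.
  by apply: (part (@complex.Im R)) => // z; apply: le_trans (ImN z); exact: ler_norm.
have h4 : \sum_j Num.max (- Im (f j (Y j))) 0 <= M.
  apply: (part (fun z => - Im z)) => [|z|F]; first by rewrite oppr0.
    by apply: le_trans (ImN z); rewrite -normrN ler_norm.
  by rewrite Im_sum sumrN.
apply: (@le_trans _ _ (\sum_j (Num.max (Re (f j (Y j))) 0 + Num.max (- Re (f j (Y j))) 0 +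
   (Num.max (Im (f j (Y j))) 0 + Num.max (- Im (f j (Y j))) 0)))); last first.
  by rewrite !big_split /=; lra.
apply: ler_sum => j _; case: (f j (Y j)) => u v /=.
have e (x : R) : Num.max x 0 + Num.max (- x) 0 = `|x|.
  case/orP: (le_total 0 x) => h.
    by rewrite (max_l h) (@max_r _ _ (- x)) ?oppr_le0// addr0 ger0_norm.
  by rewrite (max_r h) (@max_l _ _ (- x)) ?oppr_ge0// add0r ler0_norm.
rewrite !e -(sqrtr_sqr u) -(sqrtr_sqr v).
have s0 : 0 <= Num.sqrt (u ^+ 2) + Num.sqrt (v ^+ 2) by rewrite addr_ge0 ?sqrtr_ge0.
rewrite -[leRHS]ger0_norm// -[leRHS]sqrtr_sqr ler_wsqrtr//.
rewrite sqrrD !sqr_sqrtr ?sqr_ge0// addrAC lerDl mulrn_wge0// mulr_ge0 ?sqrtr_ge0//.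
Qed.

Lemma exists_max (R : realType) (T : finType) (x0 : T) (F : T -> R) :
  exists y, forall y', F y' <= F y.
Proof.
have [y _ h] := @Order.TotalTheory.arg_maxP _ _ T x0 predT F isT.
by exists y => y'; apply: h.
Qed.

Section UpperBound2.
Variables (R : realType) (K n : nat).
Local Notation C := R[i].
Hypothesis K_gt0 : (0 < K)%N.
Variable B : 'I_(K ^ 2) -> 'M[C]_K.
Hypothesis Bb : normalized_local_basis B.
Local Notation coin := (bool * bool * bool)%type.
Local Notation conf := {ffun 'I_K -> coin}.
Local Notation multi := {ffun 'I_n -> 'I_(K ^ 2)}.
Local Notation sample := {ffun 'I_n -> conf}.
Variable a : multi -> C.
Variable d : nat.
Hypothesis d_gt0 : (0 < d)%N.
Hypothesis ad : forall b, (d < #|supp b|)%N -> a b = 0.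
Let A : tensor_mx R K n := \sum_b a b *: tensor (fun j => B (b j)).
Let M1 := (d * d.+1)%:R * 2 ^+ d * op_norm A.

(** At each site the best configuration makes the linear function at least (4 sqrt K)^-1 times the
    l2 norm of the derivatives, and passing to their l1 norm over at most K^2 indices costs K. The
    last factor 4 is that of [sum_choice]. *)
Lemma sum_derivatives_le (x : sample) :
  \sum_j \sum_(mu | val mu != 0%N) normc (Gf B (dcoef a j mu) x) <=
  16 * K%:R * Num.sqrt K%:R * M1.
Proof.
pose D j mu := Gf B (dcoef a j mu) x.
pose f j (y : conf) := \sum_(mu | val mu != 0%N) (Xf B mu y - Xf B mu (x j)) * D j mu.
have f0 j : f j (x j) = 0 by rewrite /f big1// => mu _; rewrite subrr mul0r.
have hf (Y : 'I_n -> conf) : normc (\sum_j f j (Y j)) <= M1.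
  have -> : \sum_j f j (Y j) = \sum_j \sum_(mu | val mu != 0%N)
     (Xf B mu ([ffun j => Y j] j) - Xf B mu (x j)) * Gf B (dcoef a j mu) x.
    by apply: eq_bigr => j _; rewrite ffunE.
  exact: derivative_le.
have K0 : 0 < K%:R :> R by rewrite ltr0n.
have s0 : 0 <= Num.sqrt K%:R :> R by exact: sqrtr_ge0.
have key j : exists y, \sum_(mu | val mu != 0%N) normc (D j mu) <=
    4 * K%:R * Num.sqrt K%:R * normc (f j y).
  have [y ymax] := exists_max (x j) (fun y => normc (f j y)).
  exists y.
  have := one_site_l2 K_gt0 Bb (- \sum_(mu | val mu != 0%N) Xf B mu (x j) * D j mu) (D j).
  have -> : \sum_y0 normc (- (\sum_(mu | val mu != 0%N) Xf B mu (x j) * D j mu) +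
      \sum_(mu | val mu != 0%N) Xf B mu y0 * D j mu) ^+ 2 = \sum_y0 normc (f j y0) ^+ 2.
    apply: eq_bigr => y0 _; congr (normc _ ^+ 2); rewrite addrC -sumrB /f.
    by apply: eq_bigr => mu _; rewrite mulrBl.
  move=> h.
  have h2 : #|{: conf}|%:R * ((16 * K%:R)^-1 * \sum_(mu | val mu != 0%N) normc (D j mu) ^+ 2)
     <= #|{: conf}|%:R * normc (f j y) ^+ 2.
    apply: le_trans h _; rewrite mulr_natl -sumr_const; apply: ler_sum => y0 _.
    by rewrite lerXn2r ?nnegrE ?normc_ge0.
  have cp : 0 < #|{: conf}|%:R :> R by rewrite ltr0n conf_gt0.
  rewrite (ler_pM2l cp) ler_pdivrMl ?mulr_gt0// in h2.
  have h3 : (\sum_(mu | val mu != 0%N) normc (D j mu)) ^+ 2 <=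
      K%:R ^+ 2 * \sum_(mu | val mu != 0%N) normc (D j mu) ^+ 2.
    have := CS_real (fun mu : 'I_(K ^ 2) => (val mu != 0%N)%:R : R)
       (fun mu => if val mu != 0%N then normc (D j mu) else 0).
    have -> : \sum_(mu : 'I_(K ^ 2)) (val mu != 0%N)%:R * (if val mu != 0%N then normc (D j mu) else 0)
       = \sum_(mu | val mu != 0%N) normc (D j mu).
      by rewrite [RHS]big_mkcond; apply: eq_bigr => mu _; case: ifP; rewrite ?mul1r ?mul0r.
    have -> : \sum_(mu : 'I_(K ^ 2)) (if val mu != 0%N then normc (D j mu) else 0) ^+ 2
       = \sum_(mu | val mu != 0%N) normc (D j mu) ^+ 2.
      by rewrite [RHS]big_mkcond; apply: eq_bigr => mu _; case: ifP; rewrite ?expr0n.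
    move=> /le_trans; apply; apply: ler_wpM2r.
      by apply: sumr_ge0 => mu _; apply: sqr_ge0.
    apply: (@le_trans _ _ (\sum_(mu : 'I_(K ^ 2)) 1)); last first.
      by rewrite sumr_const card_ord natrX.
    apply: ler_sum => mu _.
    by case: (val mu == 0%N); rewrite /= ?expr0n ?expr1n.
  have h4 : (\sum_(mu | val mu != 0%N) normc (D j mu)) ^+ 2 <=
      (4 * K%:R * Num.sqrt K%:R * normc (f j y)) ^+ 2.
    apply: le_trans h3 _.
    have -> : (4 * K%:R * Num.sqrt K%:R * normc (f j y)) ^+ 2 =
       K%:R ^+ 2 * (16 * K%:R * normc (f j y) ^+ 2).
      by rewrite !exprMn sqr_sqrtr ?(ltW K0)//; ring.
    by apply: ler_wpM2l => //; apply: sqr_ge0.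
  have n1 : 0 <= \sum_(mu | val mu != 0%N) normc (D j mu).
    by apply: sumr_ge0 => mu _; apply: normc_ge0.
  have n2 : 0 <= 4 * K%:R * Num.sqrt K%:R * normc (f j y).
    by rewrite !mulr_ge0// normc_ge0.
  by rewrite -(ger0_norm n1) -(ger0_norm n2) -!sqrtr_sqr ler_wsqrtr.
have [Y hY] := choice key.
apply: (@le_trans _ _ (\sum_j 4 * K%:R * Num.sqrt K%:R * normc (f j (Y j)))).
  by apply: ler_sum => j _; apply: hY.
rewrite -mulr_sumr.
have := sum_choice f0 hf Y => hS.
apply: le_trans (ler_wpM2l _ hS) _; first by rewrite !mulr_ge0.
by rewrite le_eqVlt; apply/orP; left; apply/eqP; ring.
Qed.

Lemma influence_sum_le :
  \sum_j \sum_(mu | val mu != 0%N)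
     Num.sqrt (\sum_(b : multi | b j == mu) normc (a b) ^+ 2) <=
  (36 * Num.sqrt K%:R) ^+ d.-1 * (16 * K%:R * Num.sqrt K%:R * M1).
Proof.
have Np : 0 < #|{: sample}|%:R :> R by rewrite ltr0n card_sample expn_gt0 conf_gt0.
rewrite -(ler_pM2l Np) mulr_sumr.
apply: (@le_trans _ _ (\sum_j \sum_(mu | val mu != 0%N)
   (36 * Num.sqrt K%:R) ^+ d.-1 * \sum_x normc (Gf B (dcoef a j mu) x))).
  apply: ler_sum => j _; rewrite mulr_sumr; apply: ler_sum => mu hmu.
  rewrite -(dcoef_l2 K_gt0 a); apply: Gf_l2_l1 => // b hb.
  exact: (dcoef_supp d_gt0 ad).
under eq_bigr do rewrite -mulr_sumr.
rewrite -mulr_sumr mulrCA; apply: ler_wpM2l.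
  by rewrite exprn_ge0// mulr_ge0// sqrtr_ge0.
have -> : \sum_j \sum_(mu | val mu != 0%N) \sum_x normc (Gf B (dcoef a j mu) x) =
   \sum_x \sum_j \sum_(mu | val mu != 0%N) normc (Gf B (dcoef a j mu) x).
  rewrite [RHS]exchange_big /=; apply: eq_bigr => j _.
  by rewrite exchange_big.
by rewrite [leRHS]mulr_natl -sumr_const; apply: ler_sum => x _; apply: sum_derivatives_le.
Qed.

Lemma blei_part (r : nat) : (0 < r <= d)%N ->
  \sum_(b | #|supp b| == r) normc (a b) `^ BH_exp R d <=
  ((1 + expR 1) * ((36 * Num.sqrt K%:R) ^+ d.-1 * (16 * K%:R * Num.sqrt K%:R * M1))) `^ BH_exp R d.
Proof.
case/andP=> r0 rd.
have p1 := BH_exp_ge1 R r0; have p0 : 0 < BH_exp R r := lt_le_trans ltr01 p1.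
have e1 : 1 <= 1 + expR 1 :> R by rewrite lerDl expR_ge0.
set S := (36 * _) ^+ _ * _.
pose S' := \sum_j \sum_(mu | val mu != 0%N)
     Num.sqrt (\sum_(b : multi | (#|supp b| == r) && (b j == mu)) normc (a b) ^+ 2).
have S'0 : 0 <= S' by apply: sumr_ge0 => j _; apply: sumr_ge0 => mu _; apply: sqrtr_ge0.
have SS : S' <= S.
  apply: le_trans influence_sum_le; apply: ler_sum => j _; apply: ler_sum => mu _.
  rewrite ler_wsqrtr// [leRHS](bigID (fun b : multi => #|supp b| == r)) /=.
  rewrite [X in _ <= X + _](eq_bigl (fun b : multi => (#|supp b| == r) && (b j == mu))) => [|b].
    by rewrite lerDl sumr_ge0// => b _; apply: sqr_ge0.
  by rewrite andbC.
apply: (sum_powR_mono p0 (BH_exp_mono R rd)).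
- by rewrite mulr_ge0 ?(le_trans ler01 e1)// (le_trans S'0).
- by move=> b; apply: normc_ge0.
apply: le_trans (blei r0 (fun b => normc_ge0 (a b))) _.
have e0 : 0 <= 1 + expR 1 :> R := le_trans ler01 e1.
have S0 : 0 <= S := le_trans S'0 SS.
rewrite -/S' powRM//.
exact: ler_pM e0 (powR_ge0 _ _) (le1r_powR e1 p1) (ler_powR2 (ltW p0) S'0 SS).
Qed.

End UpperBound2.

(* 36 sqrt K = 9 * 4 sqrt K: 9 is the hypercontractive loss at each remaining
   site, (4 sqrt K)^-1 the least singular value of the encoding by random states. *)
Definition upper_const (R : realType) (K d : nat) : R :=
  1 + d%:R * ((1 + expR 1) * ((36 * Num.sqrt K%:R) ^+ d.-1 *
    (16 * K%:R * Num.sqrt K%:R * ((d * d.+1)%:R * 2 ^+ d)))).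

Lemma upper_bound (R : realType) (K d n : nat) (B : 'I_(K ^ 2) -> 'M[R[i]]_K)
    (A : tensor_mx R K n) : (0 < K)%N -> (0 < d)%N ->
  normalized_local_basis B -> H_le d A ->
  lp_norm (BH_exp R d) (fourier_coef B A) <= upper_const R K d * op_norm A.
Proof.
move=> K0 d0 Bb HA; have [exA suppA] := H_le_fourier K0 Bb HA.
set a := fourier_coef B A.
have p1 := BH_exp_ge1 R d0; have p0 : 0 < BH_exp R d := lt_le_trans ltr01 p1.
pose S := (1 + expR 1) * ((36 * Num.sqrt K%:R) ^+ d.-1 *
    (16 * K%:R * Num.sqrt K%:R * ((d * d.+1)%:R * 2 ^+ d * op_norm A))) : R.
have S0 : 0 <= S.
  apply: mulr_ge0; first by rewrite addr_ge0 ?expR_ge0.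
  apply: mulr_ge0; first by rewrite exprn_ge0// mulr_ge0 ?sqrtr_ge0.
  apply: mulr_ge0; first by rewrite !mulr_ge0 ?sqrtr_ge0.
  by apply: mulr_ge0 (op_norm_ge0 _); rewrite mulr_ge0 ?exprn_ge0.
have -> : upper_const R K d * op_norm A = \sum_(r < d.+1) (if val r == 0%N then op_norm A else S).
  rewrite big_ord_recl /= (eq_bigr (fun=> S)) ?sumr_const ?card_ord; last by move=> i _.
  by rewrite -(mulr_natl S) /upper_const /S mulrDl mul1r !mulrA.
apply: (@lp_of_parts _ _ _ d _ (fun r => if r == 0%N then op_norm A else S)) => //.
  by move=> r; case: ifP => // _; apply: op_norm_ge0.
move=> r rd; case: eqP => [->|/eqP r0]; first exact: part0_le.
have := @blei_part R K n K0 B Bb a d d0 suppA r.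
by rewrite lt0n r0 rd -exA => /(_ isT).
Qed.

(** * Concentration for convex functions *)

Definition xcons (q N : nat) (w : 'I_q) (x : {ffun 'I_N -> 'I_q}) : {ffun 'I_N.+1 -> 'I_q} :=
  [ffun j => oapp x w (unlift ord0 j)].

Lemma sum_ffun_cons (V : nmodType) (q N : nat) (F : {ffun 'I_N.+1 -> 'I_q} -> V) :
  \sum_x F x =
  \sum_w \sum_(x : {ffun 'I_N -> 'I_q}) F (xcons w x).
Proof.
rewrite pair_bigA /=.
rewrite (reindex (fun p : 'I_q * {ffun 'I_N -> 'I_q} =>
   xcons p.1 p.2)) //=.
exists (fun x => (x ord0, [ffun j => x (lift ord0 j)])) => [[w x]|x] _ /=.
  by congr (_, _); [|apply/ffunP => j]; rewrite !ffunE ?unlift_none ?liftK.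
apply/ffunP => j; rewrite ffunE; case: unliftP => [i|] -> /=; first by rewrite ffunE.
by [].
Qed.

Section PropertyTau.
Variables (R : realType) (q : nat) (v : 'I_q -> R[i]).
Local Notation C := R[i].
Hypothesis q0 : (0 < q)%N.
Hypothesis hv : forall k l, normc (v k - v l) <= 2.

Let le_of_sub (a b c : R) : 0 <= c -> b - a = c -> a <= b.
Proof. by move=> c0 h; rewrite -subr_ge0 h. Qed.

(** The one-coordinate inequality of the induction for property (tau). The term t^2 / 16 is the cost
    4 t^2 / 64 of moving a point by t times the diameter 2, and t = 8 d minimizes the exponent as
    long as it is at most 1. *)
Lemma tau_pointwise (d : R) : 0 <= d ->
  exists2 t, 0 <= t <= 1 & expR ((1 - t) * d + t ^+ 2 / 16) + expR (- d) <= 2.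
Proof.
move=> d0.
have le_inv (x : R) : x < 1 -> expR x <= (1 - x)^-1.
  move=> x1; rewrite -[x in expR x]opprK expRN lef_pV2 ?posrE ?expR_gt0 ?subr_gt0//.
  exact: expR_ge1Dx.
have [d8|d8] := ltP d (8^-1).
  exists (8 * d); first by apply/andP; split; lra.
  have -> : (1 - 8 * d) * d + (8 * d) ^+ 2 / 16 = d - 4 * d ^+ 2 by field.
  apply: le_trans (lerD (le_inv _ _) (le_inv _ _)) _; [nra|lra|].
  rewrite opprK -lerBrDr.
  have h1 : 0 < 1 - (d - 4 * d ^+ 2) by nra.
  have h2 : 0 < 1 + d by lra.
  have -> : 2 - (1 + d)^-1 = (1 + 2 * d) / (1 + d) by field; lra.
  rewrite -[leLHS]mul1r ler_pdivrMr// mulrAC ler_pdivlMr// mul1r.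
  apply: (@le_of_sub _ _ (2 * d ^+ 2 + 8 * d ^+ 3)); last by ring.
  by rewrite addr_ge0// mulr_ge0 ?exprn_ge0.
exists 1; first by rewrite ler01 lexx.
rewrite subrr mul0r add0r expr1n.
have h1 : expR (1 / 16 : R) <= (1 - 1/16)^-1 by apply: le_inv; lra.
have h2 : expR (- d) <= (1 - - d)^-1 by apply: le_inv; lra.
have h3 : (1 - - d)^-1 <= 8 / 9.
  by rewrite invf_ple ?posrE; lra.
have h4 : (1 - 1/16 : R)^-1 = 16 / 15 by field.
by rewrite h4 in h1; lra.
Qed.

(** Hoelder's inequality with exponents 1 / (1 - t) and 1 / t. Centring [a] at [A] and [b] at [B]
    reduces it to the convexity of exp, with t = 0 and t = 1 included. *)
Lemma sum_expR_convex (I : finType) (a b : I -> R) (A B Q t : R) :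
  0 <= t <= 1 -> \sum_i expR (a i) <= Q * expR A -> \sum_i expR (b i) <= Q * expR B ->
  \sum_i expR ((1 - t) * a i + t * b i) <= Q * expR ((1 - t) * A + t * B).
Proof.
move=> /andP[t0 t1] hA hB.
have key i : expR ((1 - t) * a i + t * b i) <= expR ((1 - t) * A + t * B) *
    ((1 - t) * (expR (a i) / expR A) + t * (expR (b i) / expR B)).
  rewrite -!expRN -!expRD.
  have -> : (1 - t) * a i + t * b i =
    (1 - t) * A + t * B + ((1 - t) * (a i - A) + t * (b i - B)) by ring.
  rewrite [leLHS]expRD ler_wpM2l ?expR_ge0//.
  have := convex_expR (Itv01 t0 t1) (b i - B) (a i - A).
  rewrite !convRE /= /unstable.onem [X in _ <= X]addrC.
  by rewrite [X in expR X <= _]addrC.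
apply: le_trans (ler_sum _ (fun i _ => key i)) _.
rewrite -mulr_sumr mulrC big_split /= -!mulr_sumr -!mulr_suml.
rewrite ler_wpM2r ?expR_ge0//.
have h1 : (\sum_i expR (a i)) / expR A <= Q by rewrite ler_pdivrMr ?expR_gt0.
have h2 : (\sum_i expR (b i)) / expR B <= Q by rewrite ler_pdivrMr ?expR_gt0.
have -> : Q = (1 - t) * Q + t * Q by ring.
by apply: lerD; apply: ler_wpM2l => //; rewrite subr_ge0.
Qed.

Definition convex_fun (I : Type) (f : (I -> C) -> R) :=
  forall (t : R) y z, 0 <= t <= 1 ->
    f (fun j => ((1 - t)%:C)%C * y j + (t%:C)%C * z j) <= (1 - t) * f y + t * f z.

Definition cost (N : nat) (x : {ffun 'I_N -> 'I_q}) (y : 'I_N -> C) : R :=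
  (\sum_j normc (v (x j) - y j) ^+ 2) / 64.

Lemma cost_ge0 N (x : {ffun 'I_N -> 'I_q}) y : 0 <= cost x y.
Proof. by apply: mulr_ge0 => //; rewrite sumr_ge0// => j _; rewrite exprn_ge0// normc_ge0. Qed.

Definition ccons (N : nat) (w : C) (y : 'I_N -> C) : 'I_N.+1 -> C :=
  fun j => oapp y w (unlift ord0 j).

Lemma normc_sqr_convex (t : R) (y z : C) : 0 <= t <= 1 ->
  normc (((1 - t)%:C)%C * y + (t%:C)%C * z) ^+ 2 <=
  (1 - t) * normc y ^+ 2 + t * normc z ^+ 2.
Proof.
move=> /andP[t0 t1].
have h : normc (((1 - t)%:C)%C * y + (t%:C)%C * z) <= (1 - t) * normc y + t * normc z.
  apply: le_trans (normcD_le _ _) _.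
  by rewrite !Normc.normcM !normc_real ger0_norm ?subr_ge0// ger0_norm.
apply: le_trans (_ : ((1 - t) * normc y + t * normc z) ^+ 2 <= _).
  by rewrite lerXn2r ?nnegrE ?normc_ge0// addr_ge0 ?mulr_ge0 ?normc_ge0 ?subr_ge0.
apply: (@le_of_sub _ _ (t * (1 - t) * (normc y - normc z) ^+ 2)); last by ring.
by apply: mulr_ge0 (sqr_ge0 _); apply: mulr_ge0 => //; rewrite subr_ge0.
Qed.

Lemma cost_cons N (w h : 'I_q) (x : {ffun 'I_N -> 'I_q}) (y z : 'I_N -> C) (t : R) :
  0 <= t <= 1 ->
  cost (xcons w x)
    (fun j => ((1 - t)%:C)%C * ccons (v w) y j + (t%:C)%C * ccons (v h) z j) <=
  t ^+ 2 / 16 + (1 - t) * cost x y + t * cost x z.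
Proof.
move=> ht; rewrite /cost big_ord_recl /ccons [xcons _ _ ord0]ffunE unlift_none /=.
have e1 : v w - (((1 - t)%:C)%C * v w + (t%:C)%C * v h) = (t%:C)%C * (v w - v h).
  by rewrite rmorphB rmorph1; ring.
have b1 : normc (v w - (((1 - t)%:C)%C * v w + (t%:C)%C * v h)) ^+ 2 <= t ^+ 2 * 4.
  rewrite e1 Normc.normcM normc_real exprMn real_normK ?num_real//.
  apply: ler_wpM2l; first exact: sqr_ge0.
  have -> : 4 = 2 ^+ 2 :> R by rewrite -natrX.
  by rewrite lerXn2r ?nnegrE ?normc_ge0 ?hv.
have b2 : \sum_(i < N) normc (v (xcons w x (lift ord0 i)) -
    (((1 - t)%:C)%C * oapp y (v w) (unlift ord0 (lift ord0 i)) +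
     (t%:C)%C * oapp z (v h) (unlift ord0 (lift ord0 i)))) ^+ 2 <=
   (1 - t) * (\sum_j normc (v (x j) - y j) ^+ 2) +
   t * (\sum_j normc (v (x j) - z j) ^+ 2).
  rewrite !mulr_sumr -big_split /=; apply: ler_sum => i _.
  rewrite ffunE liftK /=; apply: le_trans (normc_sqr_convex _ _ ht).
  rewrite le_eqVlt; apply/orP; left; apply/eqP; congr (normc _ ^+ 2).
  by rewrite rmorphB rmorph1; ring.
by move: b1 b2; lra.
Qed.

(* Maurey's property (tau) for convex functions; [g] is any minorant of the
   infimal convolution of [f] with the cost.  In the induction the point
   used for the first coordinate [w] is a convex combination of [v w] and
   of [v h], where [h] maximizes the partial sums of [exp (- f)]. *)
Lemma convex_property_tau N (f : ('I_N -> C) -> R) (g : {ffun 'I_N -> 'I_q} -> R) :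
  (forall y, 0 <= f y) -> convex_fun f -> (forall x y, g x <= f y + cost x y) ->
  (\sum_x expR (g x)) * (\sum_(x : {ffun 'I_N -> 'I_q}) expR (- f (fun j => v (x j)))) <= (q ^ N)%:R ^+ 2.
Proof.
elim: N f g => [|N IH] f g f0 fc hg.
  have x0 : {ffun 'I_0 -> 'I_q} by apply: finfun; case.
  have u (x : {ffun 'I_0 -> 'I_q}) : x = x0 by apply/ffunP; case.
  have s (F : {ffun 'I_0 -> 'I_q} -> R) : \sum_x F x = F x0.
    by rewrite (bigD1 x0)//= big1 ?addr0// => x; rewrite (u x) eqxx.
  rewrite !s expn0 expr1n -expRD -expR0 ler_expR.
  have := hg x0 (fun j => v (x0 j)); rewrite /cost big_ord0 mul0r addr0.
  by rewrite -subr_le0.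
pose Q : R := (q ^ N)%:R.
have Q0 : 0 < Q by rewrite ltr0n expn_gt0 q0.
pose fw w (y : 'I_N -> C) := f (ccons (v w) y).
pose S (w : 'I_q) := \sum_(x : {ffun 'I_N -> 'I_q}) expR (- fw w (fun j => v (x j))).
have S0 w : 0 < S w.
  have x0 : {ffun 'I_N -> 'I_q} by apply: finfun => _; exact: Ordinal q0.
  rewrite /S (bigD1 x0)//= ltr_pwDl ?expR_gt0// sumr_ge0// => x _; exact: expR_ge0.
(* The free energy of the slice [w]: the induction hypothesis becomes a bound of the sum of exp (gw
   w) by Q exp (F w), against S w = Q exp (- F w). *)
pose F w := - ln (S w / Q).
have FE w : S w = Q * expR (- F w).
  by rewrite opprK lnK ?posrE ?divr_gt0// mulrC divfK// gt_eqF.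
pose gw w (x : {ffun 'I_N -> 'I_q}) := inf [set fw w y + cost x y | y in setT].
have hlb w x : has_lbound [set fw w y + cost x y | y in setT].
  by exists 0 => _ [y _ <-]; rewrite addr_ge0 ?f0 ?cost_ge0.
have IHw w : \sum_x expR (gw w x) <= Q * expR (F w).
  have := IH (fw w) (gw w) (fun y => f0 _).
  rewrite -/(S w) FE.
  have cw : convex_fun (fw w).
    move=> t y z ht; apply: le_trans (fc t _ _ ht).
    rewrite /fw le_eqVlt; apply/orP; left; apply/eqP; congr f.
    apply/funext => j; rewrite /ccons; case: (unlift ord0 j) => //=.
    by rewrite rmorphB rmorph1; ring.
  move=> /(_ cw (fun x y => ge_inf (hlb w x) (ex_intro2 _ _ y I erefl))).
  rewrite -/Q expr2 mulrCA ler_pM2l// expRN ler_pdivrMr ?expR_gt0//.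
have [h _ hF] := arg_minP F (erefl true : xpredT (Ordinal q0)).
have key w t : 0 <= t <= 1 ->
    \sum_(x : {ffun 'I_N -> 'I_q}) expR (g (xcons w x)) <=
    Q * expR (F h + ((1 - t) * (F w - F h) + t ^+ 2 / 16)).
  move=> ht; have := sum_expR_convex ht (IHw w) (IHw h).
  have pw (x : {ffun 'I_N -> 'I_q}) : g (xcons w x) <=
      t ^+ 2 / 16 + ((1 - t) * gw w x + t * gw h x).
    have [t0 t1] := andP ht.
    have st0 : 0 <= 1 - t by rewrite subr_ge0.
    have A y z : g (xcons w x) <=
       t ^+ 2 / 16 + ((1 - t) * (fw w y + cost x y) + t * (fw h z + cost x z)).
      apply: le_trans (hg _ _) _.
      apply: le_trans (lerD (fc t (ccons (v w) y) (ccons (v h) z) ht) (cost_cons _ _ _ _ _ ht)) _.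
      by rewrite le_eqVlt; apply/orP; left; apply/eqP; rewrite /fw; ring.
    have infZ (c : R) w' (D : R) : 0 <= c ->
        (forall y, D <= c * (fw w' y + cost x y)) -> D <= c * gw w' x.
      move=> c0 hD; have [c00|cn] := eqVneq c 0.
        by have := hD (fun=> 0); rewrite c00 !mul0r.
      have cp : 0 < c by rewrite lt_def cn.
      rewrite mulrC -ler_pdivrMr//; apply: lb_le_inf.
        by exists (fw w' (fun=> 0) + cost x (fun=> 0)), (fun=> 0).
      by move=> _ [y _ <-]; rewrite ler_pdivrMr// mulrC.
    (* The infima over z and over y are taken one after the other; [infZ] also covers the endpoints
       t = 0 and t = 1, where a factor vanishes. *)
    have B1 y : g (xcons w x) - t ^+ 2 / 16 - (1 - t) * (fw w y + cost x y) <= t * gw h x.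
      by apply: (infZ t h _ t0) => z; have := A y z; lra.
    have B2 : g (xcons w x) - t ^+ 2 / 16 - t * gw h x <= (1 - t) * gw w x.
      by apply: (infZ (1 - t) w _ st0) => y; have := B1 y; lra.
    by move: B2; lra.
  move=> le1; apply: le_trans (_ : expR (t ^+ 2 / 16) *
     (\sum_x expR ((1 - t) * gw w x + t * gw h x)) <= _).
    by rewrite mulr_sumr; apply: ler_sum => x _; rewrite -expRD ler_expR.
  apply: le_trans (ler_wpM2l (expR_ge0 _) le1) _.
  rewrite mulrCA -expRD le_eqVlt; apply/orP; left; apply/eqP; congr (_ * expR _); ring.
rewrite !sum_ffun_cons.
have e2 : \sum_w \sum_(x : {ffun 'I_N -> 'I_q})
    expR (- f (fun j => v (xcons w x j))) =
    \sum_w Q * expR (- F h) * expR (- (F w - F h)).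
  apply: eq_bigr => w _.
  have -> : Q * expR (- F h) * expR (- (F w - F h)) = Q * expR (- F w).
    by rewrite -mulrA -expRD; congr (_ * expR _); ring.
  rewrite -FE; apply: eq_bigr => x _; congr (expR (- f _)); apply/funext => j.
  by rewrite /ccons ffunE; case: (unlift ord0 j).
have e1 : \sum_w \sum_(x : {ffun 'I_N -> 'I_q})
    expR (g (xcons w x)) <=
    \sum_w Q * expR (F h) * (2 - expR (- (F w - F h))).
  apply: ler_sum => w _.
  have dw0 : 0 <= F w - F h by rewrite subr_ge0 hF.
  have [t ht tw] := tau_pointwise dw0.
  apply: le_trans (key w t ht) _; rewrite expRD mulrA.
  apply: ler_wpM2l; first by rewrite mulr_ge0 ?expR_ge0 ?(ltW Q0).
  by rewrite lerBrDr.
rewrite e2.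
apply: le_trans (ler_wpM2r _ e1) _.
  by apply: sumr_ge0 => w _; rewrite !mulr_ge0 ?expR_ge0 ?(ltW Q0).
rewrite -!mulr_sumr sumrB sumr_const card_ord.
(* In units of Q exp (F h) and Q exp (- F h), the two sums are at most 2 q - s and equal to s; their
   product is at most q^2. *)
set s := \sum_i expR _.
rewrite -[2 *+ q]mulr_natr.
have -> : Q * expR (F h) * (2 * q%:R - s) * (Q * expR (- F h) * s) =
   Q ^+ 2 * ((2 * q%:R - s) * s) * (expR (F h) * expR (- F h)) by ring.
rewrite -expRD subrr expR0 mulr1 expnS natrM exprMn mulrC -/Q.
apply: ler_wpM2r; first exact: sqr_ge0.
by apply: (@le_of_sub _ _ ((q%:R - s) ^+ 2)); [exact: sqr_ge0|ring].
Qed.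

(** Property (tau) and Jensen bound the exponential moment at s by exp (s M + 16 s^2 L^2), M being
    the mean. At s = 2 p / m with m = M + sqrt p L the two terms are at most 2 p and 64 p; the first
    cancels against the exp (- 2 p) from x <= m exp (x / m - 1), and 64 p = 32 (2 p) explains
    [expR 32]. *)
Lemma moment_concentration N (f : ('I_N -> C) -> R) (L : R) (p : nat) :
  (0 < p)%N -> 0 <= L -> (forall y, 0 <= f y) -> convex_fun f ->
  (forall (x : {ffun 'I_N -> 'I_q}) y, f (fun j => v (x j)) <=
     f y + L * Num.sqrt (\sum_j normc (v (x j) - y j) ^+ 2)) ->
  \sum_(x : {ffun 'I_N -> 'I_q}) f (fun j => v (x j)) ^+ (2 * p) <=
  (q ^ N)%:R * (expR 32 *
    ((\sum_(x : {ffun 'I_N -> 'I_q}) f (fun j => v (x j))) / (q ^ N)%:R +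
     Num.sqrt p%:R * L)) ^+ (2 * p).
Proof.
move=> p0 L0 f0 fc fL; set Q : R := (q ^ N)%:R.
have Q0 : 0 < Q by rewrite ltr0n expn_gt0 q0.
pose fx (x : {ffun 'I_N -> 'I_q}) := f (fun j => v (x j)).
rewrite -/(fx _); set M := (\sum_x fx x) / Q.
have sM : \sum_x fx x = Q * M by rewrite mulrC divfK ?lt0r_neq0.
have fx0 x : 0 <= fx x by exact: f0.
have M0 : 0 <= M by rewrite divr_ge0 ?sumr_ge0 ?(ltW Q0)// => x _; exact: f0.
set m := M + Num.sqrt p%:R * L.
have sp0 : 0 <= Num.sqrt p%:R * L by rewrite mulr_ge0 ?sqrtr_ge0.
have m0 : 0 <= m by rewrite addr_ge0.
have [mz|mn] := eqVneq m 0.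
  have Mz : M = 0 by apply/eqP; rewrite eq_le M0 andbT -mz lerDl.
  rewrite big1 => [|x _]; first by rewrite !mulr_ge0 ?exprn_ge0 ?mulr_ge0 ?expR_ge0 ?(ltW Q0).
  have /eqP := sM; rewrite Mz mulr0 psumr_eq0// => /allP/(_ x); rewrite mem_index_enum.
  by move=> /(_ isT)/eqP; rewrite -/(fx x) => ->; rewrite expr0n muln_eq0 /= eqn0Ngt p0.
have mp : 0 < m by rewrite lt_def mn.
set s := (2 * p)%:R / m; have s0 : 0 <= s by rewrite divr_ge0.
have sm : s * m = (2 * p)%:R by rewrite divfK.
have t2 : \sum_x expR (s * fx x) <= Q * expR (s * M + 16 * (s * L) ^+ 2).
  (* A minorant of the infimal convolution: with r the distance of the two points, s L r <= r^2 / 64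
     + 16 (s L)^2. *)
  pose g (x : {ffun 'I_N -> 'I_q}) := s * fx x - 16 * (s * L) ^+ 2.
  have tau : (\sum_x expR (g x)) * (\sum_x expR (- (s * fx x))) <= Q ^+ 2.
    apply: (@convex_property_tau N (fun y => s * f y)) => [y|t y z ht|x y].
    - by rewrite mulr_ge0.
    - apply: le_trans (_ : s * ((1 - t) * f y + t * f z) <= _).
        by rewrite ler_wpM2l// fc.
      by rewrite le_eqVlt; apply/orP; left; apply/eqP; ring.
    rewrite /g lerBlDr; apply: le_trans (ler_wpM2l s0 (fL x y)) _.
    rewrite /cost; set S := \sum_j _.
    have S0 : 0 <= S by rewrite sumr_ge0// => j _; rewrite exprn_ge0// normc_ge0.
    rewrite -{2}(sqr_sqrtr S0); set t := Num.sqrt S.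
    apply: (@le_of_sub _ _ ((t / 8 - 4 * (s * L)) ^+ 2)); first exact: sqr_ge0.
    by field.
  have jensen : Q * expR (- (s * M)) <= \sum_x expR (- (s * fx x)).
    have h x : expR (- (s * M)) * (1 + (s * M - s * fx x)) <= expR (- (s * fx x)).
      rewrite -[X in _ <= expR X](addKr (s * M)) expRD.
      by rewrite ler_wpM2l ?expR_ge0//; apply: expR_ge1Dx.
    apply: le_trans (ler_sum _ (fun x _ => h x)).
    rewrite -mulr_sumr big_split sumrB /= !sumr_const -mulr_sumr card_ffun !card_ord.
    rewrite sM -[(s * M) *+ _]mulr_natl -/Q; move: (expR _) => e.
    by rewrite le_eqVlt; apply/orP; left; apply/eqP; ring.
  have tau2 : \sum_x expR (g x) <= Q * expR (s * M).
    have e0 : 0 < Q * expR (- (s * M)) by rewrite mulr_gt0 ?expR_gt0.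
    rewrite -(ler_pM2r e0).
    have -> : Q * expR (s * M) * (Q * expR (- (s * M))) = Q ^+ 2.
      by rewrite mulrACA -expRD subrr expR0 mulr1 expr2.
    apply: le_trans tau; apply: ler_wpM2l => //.
    by apply: sumr_ge0 => x _; exact: expR_ge0.
  rewrite expRD mulrA; apply: le_trans (ler_wpM2r (expR_ge0 _) tau2).
  rewrite mulr_suml le_eqVlt; apply/orP; left; apply/eqP; apply: eq_bigr => x _.
  by rewrite -expRD subrK.
have t3 x : fx x ^+ (2 * p) <= m ^+ (2 * p) * expR (- (2 * p)%:R) * expR (s * fx x).
  have h : fx x <= m * expR (fx x / m - 1).
    rewrite mulrC -ler_pdivrMr//; apply: le_trans (expR_ge1Dx _).
    by rewrite addrCA subrr addr0.
  apply: le_trans (_ : (m * expR (fx x / m - 1)) ^+ (2 * p) <= _).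
    by rewrite lerXn2r ?nnegrE ?mulr_ge0 ?expR_ge0.
  rewrite exprMn -mulrA -expRM_natl -expRD le_eqVlt; apply/orP; left; apply/eqP.
  by congr (_ * expR _); rewrite /s; field.
apply: le_trans (ler_sum _ (fun x _ => t3 x)) _; rewrite -mulr_sumr.
apply: le_trans (ler_wpM2l _ t2) _; first by rewrite mulr_ge0 ?expR_ge0 ?exprn_ge0.
have e1 : s * M <= (2 * p)%:R by rewrite -sm ler_wpM2l// lerDl.
have e2 : 16 * (s * L) ^+ 2 <= 64 * p%:R.
  have : p%:R * L ^+ 2 <= m ^+ 2.
    rewrite -[p%:R]sqr_sqrtr// -exprMn lerXn2r ?nnegrE// lerDr; exact: M0.
  have sE : s = 2 * p%:R / m by rewrite /s natrM.
  move=> h; rewrite sE mulrAC exprMn exprVn mulrA ler_pdivrMr ?exprn_gt0//.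
  have pr : 0 <= p%:R :> R by [].
  have := ler_wpM2l (mulr_ge0 (ler0n R 64) pr) h.
  by apply: le_trans; rewrite le_eqVlt; apply/orP; left; apply/eqP; ring.
apply: le_trans (_ : Q * (expR (- (2 * p)%:R + (s * M + 16 * (s * L) ^+ 2)) *
    m ^+ (2 * p)) <= _).
  by rewrite [leLHS]mulrCA -[m ^+ _ * _ * _]mulrA -expRD [m ^+ _ * _]mulrC.
apply: ler_wpM2l; first exact: ltW.
rewrite [leRHS]exprMn; apply: ler_wpM2r; first exact: exprn_ge0.
rewrite -expRM_natl ler_expR; move: e1 e2; rewrite !natrM; lra.
Qed.

Lemma sum_ffun_enum (V : nmodType) (E : finType) (F : {ffun E -> 'I_q} -> V) :
  \sum_z F z = \sum_(x : {ffun 'I_#|E| -> 'I_q}) F [ffun c => x (enum_rank c)].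
Proof.
rewrite (reindex (fun x : {ffun 'I_#|E| -> 'I_q} => [ffun c => x (enum_rank c)] : {ffun E -> 'I_q})) //=.
exists (fun z : {ffun E -> 'I_q} => [ffun i => z (enum_val i)]) => z _; apply/ffunP => i.
  by rewrite !ffunE enum_valK.
by rewrite !ffunE enum_rankK.
Qed.

Lemma moment_concentration_fin (E : finType) (f : (E -> C) -> R) (L : R) (p : nat) :
  (0 < p)%N -> 0 <= L -> (forall y, 0 <= f y) -> convex_fun f ->
  (forall y y', f y <= f y' + L * Num.sqrt (\sum_c normc (y c - y' c) ^+ 2)) ->
  \sum_(z : {ffun E -> 'I_q}) f (fun c => v (z c)) ^+ (2 * p) <=
  (q ^ #|E|)%:R * (expR 32 *
    ((\sum_(z : {ffun E -> 'I_q}) f (fun c => v (z c))) / (q ^ #|E|)%:R +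
     Num.sqrt p%:R * L)) ^+ (2 * p).
Proof.
move=> p0 L0 f0 fc fL; pose g (y : 'I_#|E| -> C) := f (fun c => y (enum_rank c)).
have gE (F : R -> R) : \sum_(z : {ffun E -> 'I_q}) F (f (fun c => v (z c))) =
    \sum_(x : {ffun 'I_#|E| -> 'I_q}) F (g (fun j => v (x j))).
  rewrite sum_ffun_enum; apply: eq_bigr => x _; congr (F (f _)).
  by apply/funext => c; rewrite ffunE.
rewrite (gE (fun t => t ^+ (2 * p))) (gE id).
apply: moment_concentration => // [y|t y z ht|x y]; [exact: f0|exact: fc|].
apply: le_trans (fL _ (fun c => y (enum_rank c))) _.
rewrite /g le_eqVlt; apply/orP; left; apply/eqP; congr (_ + _ * Num.sqrt _).
by rewrite [RHS](reindex (@enum_rank E)) //=; apply/onW_bij/enum_rank_bij.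
Qed.

End PropertyTau.

(** * Trace moments of random matrices *)

Section RootsOfUnity.
Variable R : realType.
Local Notation C := R[i].

(** A finite replacement for a Steinhaus variable: monomials with exponents below q have the same
    averages, so every expectation is a finite sum. *)
Lemma roots_of_unity (q : nat) : (0 < q)%N -> exists v : 'I_q -> C,
  (forall k, normc (v k) = 1) /\
  forall a b, (a < q)%N -> (b < q)%N ->
    \sum_k v k ^+ a * conjC (v k) ^+ b = if a == b then q%:R else 0.
Proof.
move=> q0; have [w hw] : exists w : C, q.-primitive_root w.
  pose P : {poly C} := 'X^q - 1; have [r Dp] := closed_field_poly_normal P.
  rewrite (monicP _) ?monicXnsubC // scale1r in Dp.
  have rn1 : all q.-unity_root r by apply/allP=> z; rewrite -root_prod_XsubC -Dp.
  have sz_r : (q < (size r).+1)%N.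
    by rewrite -(size_prod_XsubC r id) -Dp size_XnsubC.
  have [|z] := hasP (has_prim_root q0 rn1 _ sz_r); last by exists z.
  by rewrite -separable_prod_XsubC -Dp separable_Xn_sub_1 // pnatr_eq0 -lt0n.
have w1 : normc w = 1.
  apply/eqP; rewrite -(@pexpr_eq1 _ _ q)// ?normc_ge0// -normcX (prim_expr_order hw).
  by apply/eqP; rewrite -[RHS]normr1; exact: (normc_real (1 : R)).
exists (fun k => w ^+ k); split=> [k|]; first by rewrite normcX w1 expr1n.
have wJ : w * conjC w = 1 by rewrite mulcJ w1 expr1n.
have w0 : w != 0.
  by apply/eqP => wz; move: w1; rewrite wz Normc.normc0 => /eqP; rewrite eq_sym oner_eq0.
have key a b : (b <= a)%N -> (a < q)%N ->
    \sum_(k < q) w ^+ k ^+ a * conjC (w ^+ k) ^+ b = if a == b then q%:R else 0.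
  move=> ba aq.
  have -> : \sum_(k < q) w ^+ k ^+ a * conjC (w ^+ k) ^+ b = \sum_(k < q) w ^+ (a - b) ^+ k.
    apply: eq_bigr => k _; rewrite -{1}(subnK ba) exprD -mulrA -exprMn.
    by rewrite rmorphXn /= -exprMn wJ !expr1n mulr1 -!exprM mulnC.
  have [->|ab] := eqVneq a b.
    by rewrite subnn; under eq_bigr do rewrite expr1n; rewrite sumr_const card_ord.
  have wab : w ^+ (a - b) - 1 != 0.
    rewrite subr_eq0 -(prim_order_dvd hw); apply/negP => /dvdn_leq; rewrite subn_gt0.
    rewrite ltn_neqAle eq_sym ab ba => /(_ isT); rewrite leqNgt.
    by rewrite (leq_ltn_trans (leq_subr _ _) aq).
  apply: (mulfI wab); rewrite -subrX1 mulr0 -exprM mulnC exprM (prim_expr_order hw).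
  by rewrite expr1n subrr.
move=> a b aq bq; have [ba|ab] := leqP b a; first exact: key.
rewrite (eq_bigr (fun k : 'I_q => conjC (w ^+ k ^+ b * conjC (w ^+ k) ^+ a))) => [|k _].
  rewrite -rmorph_sum key// 1?ltnW// eq_sym; case: eqP => _; first by rewrite rmorph_nat.
  by rewrite rmorph0.
by rewrite rmorphM /= !rmorphXn /= conjCK mulrC.
Qed.

End RootsOfUnity.

Section SteinhausMoments.
Variables (R : realType) (q : nat) (v : 'I_q -> R[i]).
Local Notation C := R[i].
Hypothesis vJ : forall a b, (a < q)%N -> (b < q)%N ->
    \sum_k v k ^+ a * conjC (v k) ^+ b = if a == b then q%:R else 0.

Definition rearr (E : eqType) (p : nat) (e f : {ffun 'I_p -> E}) (s : 'S_p) : bool :=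
  [forall i, f i == e (s i)].

Lemma mult_rearr (E : finType) (p : nat) (e f : {ffun 'I_p -> E}) :
  [forall c, #|[pred i | f i == c]| == #|[pred i | e i == c]|] = [exists s, rearr e f s].
Proof.
apply/forallP/existsP => [h|[s /forallP hs] c]; last first.
  rewrite -!sum1_card [X in _ == X](reindex_inj (@perm_inj _ s)) /=.
  by apply/eqP/eq_bigl => i; rewrite !inE (eqP (hs i)).
have pe : perm_eq [tuple f i | i < p] [tuple e i | i < p].
  apply/allP => c _ /=; rewrite !count_map; apply/eqP.
  have aux (g : {ffun 'I_p -> E}) :
      count (preim g (pred1 c)) (enum 'I_p) = #|[pred i | g i == c]|.
    by rewrite cardE enumT -size_filter; congr size; apply: eq_filter.
  by have /eqP := h c; rewrite -!aux !enumT.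
have /tuple_permP[s hs] := pe; exists s; apply/forallP => i.
have := congr1 (fun t => tnth t i) (val_inj hs : [tuple f i | i < p] = _).
by rewrite !tnth_mktuple => ->.
Qed.

(** Each letter contributes the average of a power of v times a power of its conjugate, with its
    multiplicities in [f] and [e] as exponents. It vanishes unless they agree; both are at most p <
    q. *)
Lemma steinhaus_avg (E : finType) (p : nat) (e f : {ffun 'I_p -> E}) : (p < q)%N ->
  \sum_(z : {ffun E -> 'I_q}) \prod_i (conjC (v (z (e i))) * v (z (f i))) =
  (q ^ #|E|)%:R * [exists s, rearr e f s]%:R.
Proof.
move=> pq.
have grp (G : E -> C) (g : {ffun 'I_p -> E}) :
    \prod_i G (g i) = \prod_c G c ^+ #|[pred i | g i == c]|.
  rewrite (partition_big g predT)//=; apply: eq_bigr => c _.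
  rewrite (eq_bigr (fun=> G c)); last by move=> i /eqP ->.
  by rewrite prodr_const.
have -> : \sum_(z : {ffun E -> 'I_q}) \prod_i (conjC (v (z (e i))) * v (z (f i))) =
  \prod_c \sum_k (v k ^+ #|[pred i | f i == c]| * conjC (v k) ^+ #|[pred i | e i == c]|).
  rewrite bigA_distr_bigA; apply: eq_bigr => z _ /=.
  rewrite big_split /= (grp (fun c => conjC (v (z c)))) (grp (fun c => v (z c))).
  by rewrite -big_split; apply: eq_bigr => c _; rewrite mulrC.
have lt_card (g : {ffun 'I_p -> E}) c : (#|[pred i | g i == c]| < q)%N.
  by apply: leq_ltn_trans (max_card _) _; rewrite card_ord.
under eq_bigr do rewrite vJ//.
rewrite -mult_rearr; case: forallP => [h|h].
  by rewrite mulr1 natrX -prodr_const; apply: eq_bigr => c _; rewrite h.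
rewrite mulr0; have /existsP[c hc] : [exists c, #|[pred i | f i == c]| != #|[pred i | e i == c]|].
  by rewrite -negb_forall; apply/negP => /forallP.
by rewrite (bigD1 c)//= (negbTE hc) mul0r.
Qed.

Variables (N : nat) (E : finType) (M : E -> 'M[C]_N).

Definition word_tr (p : nat) (e f : {ffun 'I_p -> E}) : C :=
  \tr (\prod_(i < p) ((M (e i)) ^t* *m M (f i))).

Lemma steinhaus_moment (p : nat) : (p < q)%N ->
  \sum_(z : {ffun E -> 'I_q}) \tr (((\sum_c v (z c) *: M c) ^t* *m
     (\sum_c v (z c) *: M c)) ^+ p) =
  (q ^ #|E|)%:R * \sum_(e : {ffun 'I_p -> E}) \sum_(f : {ffun 'I_p -> E})
     [exists s, rearr e f s]%:R * word_tr e f.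
Proof.
move=> pq.
have step (z : {ffun E -> 'I_q}) : \tr (((\sum_c v (z c) *: M c) ^t* *m
     (\sum_c v (z c) *: M c)) ^+ p) =
   \sum_(e : {ffun 'I_p -> E}) \sum_(f : {ffun 'I_p -> E})
     (\prod_i (conjC (v (z (e i))) * v (z (f i)))) * word_tr e f.
  have -> : (\sum_c v (z c) *: M c) ^t* *m (\sum_c v (z c) *: M c) =
      \sum_(c : E * E) (conjC (v (z c.1)) * v (z c.2)) *: ((M c.1) ^t* *m M c.2).
    have -> : (\sum_c v (z c) *: M c) ^t* = \sum_c conjC (v (z c)) *: (M c) ^t*.
      apply/matrixP => x y; rewrite !mxE !summxE rmorph_sum; apply: eq_bigr => c _.
      by rewrite !mxE rmorphM.
    rewrite mulmx_suml -(pair_bigA _ (fun c c' =>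
      (conjC (v (z c)) * v (z c')) *: ((M c) ^t* *m M c'))) /=.
    apply: eq_bigr => c _; rewrite mulmx_sumr; apply: eq_bigr => c' _.
    by rewrite -scalemxAl -scalemxAr scalerA.
  set X := \sum_(c : E * E) _.
  have -> : X ^+ p = \sum_(d : {ffun 'I_p -> E} * {ffun 'I_p -> E})
      (\prod_i (conjC (v (z (d.1 i))) * v (z (d.2 i)))) *:
      \prod_(i < p) ((M (d.1 i)) ^t* *m M (d.2 i)).
    rewrite -{1}(card_ord p) -prodr_const bigA_distr_bigA /=.
    rewrite (reindex (fun d : {ffun 'I_p -> E} * {ffun 'I_p -> E} =>
      [ffun i => (d.1 i, d.2 i)])) /=; last first.
      exists (fun c : {ffun 'I_p -> E * E} => ([ffun i => (c i).1], [ffun i => (c i).2])) => [[d1 d2]|c] _.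
        by congr (_, _); apply/ffunP => i; rewrite !ffunE.
      by apply/ffunP => i; rewrite !ffunE; case: (c i).
    apply: eq_bigr => -[d1 d2] _ /=.
    elim/big_rec3: _ => [|i x y _ _ ->]; first by rewrite scale1r.
    rewrite ffunE /=; change ((conjC (v (z (d1 i))) * v (z (d2 i))) *:
      ((M (d1 i)) ^t* *m M (d2 i)) *m (y *: x) = (conjC (v (z (d1 i))) * v (z (d2 i)) * y) *:
      (((M (d1 i)) ^t* *m M (d2 i)) *m x)).
    by rewrite -scalemxAl -scalemxAr scalerA.
  by rewrite tr_sum [RHS]pair_bigA; apply: eq_bigr => d _; rewrite mxtraceZ.
under eq_bigr do rewrite step.
rewrite exchange_big mulr_sumr; apply: eq_bigr => e _.
rewrite exchange_big mulr_sumr; apply: eq_bigr => f _.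
by rewrite -mulr_suml steinhaus_avg// mulrA.
Qed.

End SteinhausMoments.

Lemma sum_ffun_pair (V : nmodType) (I A B : finType) (G : {ffun I -> A * B} -> V) :
  \sum_c G c = \sum_(a : {ffun I -> A}) \sum_(b : {ffun I -> B}) G [ffun i => (a i, b i)].
Proof.
rewrite pair_bigA (reindex (fun d : {ffun I -> A} * {ffun I -> B} =>
  [ffun i => (d.1 i, d.2 i)])) //=.
exists (fun c : {ffun I -> A * B} => ([ffun i => (c i).1], [ffun i => (c i).2])) => [[d1 d2]|c] _.
  by congr (_, _); apply/ffunP => i; rewrite !ffunE.
by apply/ffunP => i; rewrite !ffunE; case: (c i).
Qed.

Section PairSum.
Variables (R : realType) (q : nat) (v : 'I_q -> R[i]).
Local Notation C := R[i].
Hypothesis vJ : forall a b, (a < q)%N -> (b < q)%N ->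
    \sum_k v k ^+ a * conjC (v k) ^+ b = if a == b then q%:R else 0.
Variables (N : nat) (L : finType) (M : L -> 'M[C]_N).

(* The p-th moment of the Gaussian analogue of the random matrix, by Wick's formula. *)
Definition pair_sum (p : nat) : C :=
  \sum_(s : 'S_p) \sum_(e : {ffun 'I_p -> L}) word_tr M e [ffun i => e (s i)].

Hypothesis word_ge0 : forall p (e f : {ffun 'I_p -> L}), 0 <= word_tr M e f.

Variable T : nat.
Local Notation E := ('I_T * L)%type.
Local Notation MT := (fun c : E => M c.2).
Local Notation sd c := [ffun i => (c i).2].

Let word_copies p (c d : {ffun 'I_p -> E}) : word_tr MT c d = word_tr M (sd c) (sd d).
Proof. by congr (\tr _); apply: eq_bigr => i _; rewrite !ffunE. Qed.

Let rearrE p (c d : {ffun 'I_p -> E}) s : rearr c d s = (d == [ffun i => c (s i)]).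
Proof.
apply/forallP/eqP => [h|-> i]; last by rewrite ffunE.
by apply/ffunP => i; rewrite ffunE (eqP (h i)).
Qed.

Let sum_rearr p (P : pred {ffun 'I_p -> E}) :
  \sum_(c | P c) \sum_d (\sum_(s : 'S_p) (rearr c d s)%:R) * word_tr MT c d =
  \sum_(s : 'S_p) \sum_(c | P c) word_tr M (sd c) [ffun i => (sd c) (s i)].
Proof.
rewrite exchange_big [RHS]exchange_big /= exchange_big; apply: eq_bigr => c _.
under eq_bigr do rewrite mulr_suml.
rewrite exchange_big; apply: eq_bigr => s _ /=.
rewrite (bigD1 [ffun i => c (s i)])//= big1 => [|d dne].
  rewrite rearrE eqxx mul1r addr0 word_copies; congr word_tr.
  by apply/ffunP => i; rewrite !ffunE.
by rewrite rearrE (negbTE dne) mul0r.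
Qed.

(** The indicator that some permutation rearranges [c] into [d] is at most the number of such
    permutations. The copies then decouple from the letters and give T^p. *)
Lemma moment_le_pair_sum (p : nat) : (p < q)%N ->
  \sum_(z : {ffun E -> 'I_q}) \tr (((\sum_c v (z c) *: MT c) ^t* *m
     (\sum_c v (z c) *: MT c)) ^+ p) <=
  (q ^ #|{: E}|)%:R * ((T ^ p)%:R * pair_sum p).
Proof.
move=> pq; rewrite steinhaus_moment//; apply: ler_wpM2l => //.
apply: le_trans (_ : \sum_c \sum_d (\sum_(s : 'S_p) (rearr c d s)%:R) * word_tr MT c d <= _).
  apply: ler_sum => c _; apply: ler_sum => d _.
  rewrite ler_wpM2r ?word_copies//; case: existsP => [[s hs]|_]; last by rewrite sumr_ge0.
  by rewrite (bigD1 s)//= hs lerDl sumr_ge0.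
rewrite (sum_rearr predT) /pair_sum mulr_sumr le_eqVlt; apply/orP; left; apply/eqP.
apply: eq_bigr => s _; rewrite sum_ffun_pair.
rewrite (eq_bigr (fun=> \sum_(e : {ffun 'I_p -> L}) word_tr M e [ffun i => e (s i)])).
  by rewrite sumr_const card_ffun !card_ord mulr_natl.
move=> a _; apply: eq_bigr => e _; congr word_tr; apply/ffunP => i; rewrite !ffunE//.
Qed.

(** Words whose copies are pairwise distinct admit at most one rearranging permutation, so on them
    indicator and count agree; there are T^_p choices of such copies, and the other words contribute
    non-negative terms. *)
Lemma pair_sum_le_moment (p : nat) : (p < q)%N ->
  (q ^ #|{: E}|)%:R * ((T ^_ p)%:R * pair_sum p) <=
  \sum_(z : {ffun E -> 'I_q}) \tr (((\sum_c v (z c) *: MT c) ^t* *m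
     (\sum_c v (z c) *: MT c)) ^+ p).
Proof.
move=> pq; rewrite steinhaus_moment//; apply: ler_wpM2l => //.
pose inj1 (c : {ffun 'I_p -> E}) := injectiveb [ffun i => (c i).1].
apply: le_trans (_ : \sum_(c | inj1 c) \sum_d (\sum_(s : 'S_p) (rearr c d s)%:R) * word_tr MT c d <= _).
  rewrite sum_rearr /pair_sum mulr_sumr le_eqVlt; apply/orP; left; apply/eqP.
  apply: eq_bigr => s _; rewrite [RHS]big_mkcond sum_ffun_pair /=.
  rewrite (eq_bigr (fun a : {ffun 'I_p -> 'I_T} => if injectiveb a then
     \sum_(e : {ffun 'I_p -> L}) word_tr M e [ffun i => e (s i)] else 0)).
    rewrite -big_mkcond sumr_const mulr_natl; congr (_ *+ _).
    by have := card_inj_ffuns 'I_p 'I_T; rewrite !card_ord => <-; apply: eq_card => a; rewrite inE.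
  move=> a _; have ea (e : {ffun 'I_p -> L}) : inj1 [ffun i => (a i, e i)] = injectiveb a.
    rewrite /inj1; have -> // : [ffun i => ([ffun j => (a j, e j)] i).1] = a.
    by apply/ffunP => i; rewrite !ffunE.
  rewrite (eq_bigr (fun e : {ffun 'I_p -> L} => if injectiveb a then
     word_tr M e [ffun i => e (s i)] else 0)) => [|e _]; first by case: ifP => // _; rewrite big1.
  rewrite ea; case: ifP => // _; congr word_tr; apply/ffunP => i; rewrite !ffunE//.
rewrite [leRHS](bigID inj1) /= -[leLHS]addr0; apply: lerD; last first.
  by apply: sumr_ge0 => c _; apply: sumr_ge0 => d _; rewrite mulr_ge0 ?word_copies.
apply: ler_sum => c /injectiveP ci; apply: ler_sum => d _.
rewrite ler_wpM2r ?word_copies//; case: existsP => [[s hs]|ns]; last first.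
  by rewrite big1// => s _; case: (boolP (rearr c d s)) => // h; case: ns; exists s.
rewrite (bigD1 s)//= hs big1 ?addr0// => s' ss'.
case: (boolP (rearr c d s')) => // hs'; case/eqP: ss'; apply/permP => i.
by apply: ci; rewrite !ffunE -(eqP (forallP hs' i)) (eqP (forallP hs i)).
Qed.

End PairSum.

(** * Partial maps and the counting of walks *)

Section PartialMaps.
Variables (R : realType) (X : finType).
Local Notation C := R[i].

(** Tensors of one matrix unit and their adjoints act as partial maps on words. Such matrices are
    closed under products, and a trace counts fixed points, that is, closed walks. *)
Definition pmap_mx (g : X -> option X) : 'M[C]_#|X| :=
  \matrix_(x, y) (g (enum_val x) == Some (enum_val y))%:R.

Lemma pmap_mxM g h : pmap_mx g *m pmap_mx h = pmap_mx (fun x => obind h (g x)).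
Proof.
apply/matrixP => x y; rewrite !mxE; case gx: (g (enum_val x)) => [t|] /=.
  rewrite (bigD1 (enum_rank t))//= !mxE gx enum_rankK eqxx mul1r big1 ?addr0// => z zt.
  rewrite !mxE gx; case: eqP => [[tz]|]; last by rewrite mul0r.
  by case/eqP: zt; rewrite tz enum_valK.
by rewrite big1// => z _; rewrite !mxE gx mul0r.
Qed.

Lemma pmap_mx1 : pmap_mx (@Some X) = 1%:M.
Proof.
apply/matrixP => x y; rewrite !mxE; congr (_%:R); congr nat_of_bool.
by apply/eqP/eqP => [[/enum_val_inj]|->].
Qed.

Lemma tr_pmap_mx g : \tr (pmap_mx g) = #|[set x | g x == Some x]|%:R.
Proof.
rewrite -sum1_card natr_sum big_mkcond /=.
have <- := sum_enum_val (fun x => if x \in [set x | g x == Some x] then 1%:R else 0 : C).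
by apply: eq_bigr => x _; rewrite mxE inE; case: eqP.
Qed.

End PartialMaps.

Definition offdiag (K : nat) := {kl : 'I_K * 'I_K | kl.1 != kl.2}.

Section Walks.
Variables (K m : nat).
Local Notation word := {ffun 'I_m -> 'I_K}.
Local Notation L := ('I_m * offdiag K)%type.

(* A step reads [E_kl] at a site, or its adjoint [E_lk] when the flag is set. *)
Definition step (b : L) (dag : bool) (x : word) : option word :=
  let: (i, kl) := b in
  let: (k, l) := if dag then ((val kl).2, (val kl).1) else val kl in
  if x i == k then Some (upd x i l) else None.

Fixpoint walk (p : nat) (e : {ffun 'I_p -> L}) (r : seq ('I_p * bool)) (x : word) : option word :=
  if r is (i, b) :: r' then obind (walk e r') (step (e i) b x) else Some x.

Fixpoint first_flag (p : nat) (r : seq ('I_p * bool)) (i : 'I_p) : bool :=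
  if r is (j, b) :: r' then (if j == i then b else first_flag r' i) else false.

(* Given the start of a walk, each letter is determined, when it is first read,
   by its site and by the value written there. *)
Definition code (p : nat) (o : 'I_p -> bool) (e : {ffun 'I_p -> L}) : {ffun 'I_p -> 'I_m * 'I_K} :=
  [ffun i => ((e i).1, if o i then (val (e i).2).1 else (val (e i).2).2)].

(** [D] holds the letters identified earlier on the walk. The current word supplies the value that a
    new letter must read, and the code its site and the value written, so the letter and the next
    word are determined. *)
Lemma walk_inj (p : nat) (o : 'I_p -> bool) (e e' : {ffun 'I_p -> L}) r (D : pred 'I_p) x :
  {in D, e =1 e'} -> (forall i, i \notin D -> i \in map fst r -> o i = first_flag r i) ->
  code o e = code o e' -> walk e r x != None -> walk e' r x != None ->
  forall i, (i \in D) || (i \in map fst r) -> e i = e' i.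
Proof.
move=> eD oD ce; elim: r D x eD oD => [|[j b] r IH] D x eD oD /=.
  by move=> _ _ i; rewrite in_nil orbF => /eD.
case ej: (step (e j) b x) => [y|]// wy; case ej': (step (e' j) b x) => [y'|]// wy'.
have {}ee : e j = e' j.
  have [/eD//|jD] := boolP (j \in D).
  have oj : o j = b by rewrite oD// /= ?inE ?eqxx.
  have := congr1 (fun g : {ffun 'I_p -> 'I_m * 'I_K} => g j) ce; rewrite !ffunE oj.
  case: (e j) ej => [s kl]; case: (e' j) ej' => [s' kl'] /= h' h [ss].
  rewrite -ss in h' *; have ekl : val kl = val kl' -> (s, kl) = (s, kl') by move/val_inj ->.
  case: b h h' {oD oj wy wy'} => /=; case: kl ekl => -[k l] hkl /=; case: kl' => -[k' l'] hkl' /= ekl.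
    by case: eqP => // xl _; case: eqP => // xl' _ kk; apply: ekl; rewrite /= kk -xl -xl'.
  by case: eqP => // xl _; case: eqP => // xl' _ kk; apply: ekl; rewrite /= kk -xl -xl'.
have yy : y = y' by move: ej ej'; rewrite ee => -> [].
rewrite -yy in wy'.
move=> i; rewrite inE orbA => hi.
apply: (IH [pred i | (i \in D) || (i == j)] y) => //.
  by move=> i0; rewrite inE => /orP[/eD//|/eqP->].
move=> i0; rewrite inE negb_or => /andP[h1 h2] h3.
by rewrite oD//= ?inE ?h3 ?orbT// eq_sym (negbTE h2).
Qed.

Lemma card_walks (p : nat) (r : seq ('I_p * bool)) : (forall i, i \in map fst r) ->
  (#|[set d : {ffun 'I_p -> L} * word | walk d.1 r d.2 != None]| <= K ^ m * (m * K) ^ p)%N.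
Proof.
move=> hr; pose c (d : {ffun 'I_p -> L} * word) := (d.2, code (first_flag r) d.1).
have <- : #|{: word * {ffun 'I_p -> 'I_m * 'I_K}}| = (K ^ m * (m * K) ^ p)%N.
  by rewrite card_prod !card_ffun card_prod !card_ord.
rewrite -(card_in_imset (f := c)) ?max_card// => -[e x] [e' x']; rewrite !inE /= => h h'.
case=> xx cc; rewrite -xx in h' *; congr (_, _); apply/ffunP => i.
apply: (@walk_inj p (first_flag r) e e' r pred0 x) => //.
by rewrite hr orbT.
Qed.

Variable R : realType.
Local Notation C := R[i].

Definition letter_mx (o : option ('I_K * 'I_K)) : 'M[C]_K :=
  if o is Some kl then delta_mx kl.1 kl.2 else 1%:M.

Definition block_lab (b : L) (j : 'I_m) : option ('I_K * 'I_K) :=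
  if j == b.1 then Some (val b.2) else None.

Definition block_unit (b : L) : tensor_mx R K m := tensor (fun j => letter_mx (block_lab b j)).

Lemma block_mxE b : block_unit b = pmap_mx R (step b false).
Proof.
case: b => i [[k l] kl]; apply/matrixP => x y; rewrite !mxE /=.
set X := enum_val x; set Y := enum_val y.
rewrite (bigD1 i)//= /block_lab eqxx /= mxE.
case: (X i =P k) => [_|_] /=; last by rewrite mul0r.
have [e|ne] := eqVneq (upd X i l) Y.
  rewrite -e upd_same !eqxx mul1r big1 // => j ji; rewrite (negbTE ji) mxE upd_other//.
  by rewrite eqxx.
rewrite [RHS](_ : _ = 0); last by case: eqP => // -[] /eqP; rewrite (negbTE ne).
case: (Y i =P l) => [Yl|]; last by rewrite mul0r.
rewrite mul1r; have [j hj] : exists j, upd X i l j != Y j.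
  apply/existsP; rewrite -negb_forall; apply: contraNN ne => /forallP h.
  by apply/eqP/ffunP => j; apply/eqP.
have ji : j != i by apply: contraNneq hj => ->; rewrite upd_same Yl.
by rewrite (bigD1 j)//= (negbTE ji) mxE -(upd_other X l ji) (negbTE hj) mul0r.
Qed.

Lemma block_mxJE b : (block_unit b) ^t* = pmap_mx R (step b true).
Proof.
rewrite block_mxE; case: b => i [[k l] kl]; apply/matrixP => x y; rewrite !mxE /=.
set X := enum_val x; set Y := enum_val y.
rewrite rmorph_nat; congr (_%:R); congr nat_of_bool.
have aux (A B : word) a b : ((if A i == a then Some (upd A i b) else None) == Some B) ->
   ((if B i == b then Some (upd B i a) else None) == Some A).
  case: (A i =P a) => // <- /eqP[<-]; rewrite upd_same eqxx upd_upd upd_id; exact: eqxx.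
by apply/idP/idP; apply: aux.
Qed.

(** Closed walks are counted among all walks that never die. This may lose the factor K^m for the
    starting word, but the bound does not depend on [s], which lets a block be factored out of the
    sum over permutations. *)
Lemma block_word_tr_sum (p : nat) (s : 'S_p) :
  \sum_(e : {ffun 'I_p -> L}) word_tr block_unit e [ffun i => e (s i)] <=
  (K ^ m * (m * K) ^ p)%:R.
Proof.
pose r : seq ('I_p * bool) := flatten [seq [:: (i, true); (s i, false)] | i <- index_enum 'I_p].
have walkE (e : {ffun 'I_p -> L}) :
    \prod_i ((block_unit (e i)) ^t* *m block_unit ([ffun i => e (s i)] i)) = pmap_mx R (walk e r).
  rewrite /r; elim: (index_enum _) => [|i t IH] /=.
    by rewrite big_nil -[LHS]/(1%:M) -pmap_mx1.
  rewrite big_cons IH ffunE block_mxJE block_mxE -[LHS]/(_ *m _) !pmap_mxM; congr pmap_mx.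
  by apply/funext => x; case: (step _ true x).
apply: le_trans (_ : (\sum_(e : {ffun 'I_p -> L}) #|[set x | walk e r x != None]|)%:R <= _).
  rewrite natr_sum; apply: ler_sum => e _; rewrite /word_tr walkE tr_pmap_mx ler_nat.
  by apply: subset_leq_card; apply/fintype.subsetP => x; rewrite !inE => /eqP ->.
rewrite ler_nat; apply: leq_trans (card_walks (r := r) _); last first.
  move=> i; apply/mapP; exists (i, true) => //; apply/flattenP.
  exists [:: (i, true); (s i, false)]; last by rewrite inE eqxx.
  by apply/mapP; exists i; rewrite ?mem_index_enum.
rewrite -[X in (_ <= X)%N]sum1_card (eq_bigr (fun e => \sum_(x | walk e r x != None) 1)%N).
  by rewrite pair_big_dep /=; apply: eq_leq; apply: eq_bigl => d; rewrite inE.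
by move=> e _; rewrite sum1_card; apply: eq_card => x; rewrite inE.
Qed.

End Walks.

Section TraceMoments.
Variable R : realType.
Local Notation C := R[i].

Lemma op_normD N (A B : 'M[C]_N) : op_norm (A + B) <= op_norm A + op_norm B.
Proof.
apply: op_norm_le_bilin => [|u v]; first by rewrite addr_ge0 ?op_norm_ge0.
rewrite mulmxDr mulmxDl mxE mulrDl; apply: le_trans (normcD_le _ _) _.
by rewrite lerD ?bilin_le_op.
Qed.

Lemma op_normZ_le N (a : C) (A : 'M[C]_N) : op_norm (a *: A) <= normc a * op_norm A.
Proof.
apply: op_norm_le_bilin => [|u v]; first by rewrite mulr_ge0 ?normc_ge0 ?op_norm_ge0.
by rewrite -scalemxAr -scalemxAl mxE Normc.normcM -mulrA ler_wpM2l ?normc_ge0 ?bilin_le_op.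
Qed.

Lemma op_norm_sqr_le N (A : 'M[C]_N) : op_norm A ^+ 2 <= op_norm (A ^t* *m A).
Proof.
have s0 := sqrtr_ge0 (op_norm (A ^t* *m A)).
rewrite -[leRHS]sqr_sqrtr ?op_norm_ge0// lerXn2r ?nnegrE ?op_norm_ge0//.
apply: op_norm_le => // v; rewrite -(@ler_pXn2r _ 2) ?nnegrE ?mulr_ge0 ?l2_norm_ge0//.
rewrite exprMn [Num.sqrt (op_norm _) ^+ 2]sqr_sqrtr ?op_norm_ge0//.
have e : (((l2_norm (A *m v)) ^+ 2)%:C)%C = (v ^t* *m (A ^t* *m A) *m v) 0 0.
  by rewrite -l2_norm_dot trC_mul !mulmxA.
have := bilin_le_op (A ^t* *m A) v v; rewrite -e normc_real ger0_norm ?sqr_ge0//.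
Qed.

Lemma op_norm_sqr_le_tr N (A : 'M[C]_N) : op_norm A ^+ 2 <= Re (\tr (A ^t* *m A)).
Proof.
have -> : Re (\tr (A ^t* *m A)) = \sum_i \sum_j normc (A j i) ^+ 2.
  rewrite Re_sum; apply: eq_bigr => i _; rewrite mxE Re_sum; apply: eq_bigr => j _.
  by rewrite !mxE mulrC mulcJ.
set S := \sum_i _; have S0 : 0 <= S.
  by apply: sumr_ge0 => i _; apply: sumr_ge0 => j _; apply: exprn_ge0; exact: normc_ge0.
rewrite -[S]sqr_sqrtr// lerXn2r ?nnegrE ?op_norm_ge0 ?sqrtr_ge0//.
apply: op_norm_le => [|v]; first exact: sqrtr_ge0.
rewrite -(@ler_pXn2r _ 2) ?nnegrE ?mulr_ge0 ?sqrtr_ge0 ?l2_norm_ge0//.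
rewrite exprMn [Num.sqrt S ^+ 2]sqr_sqrtr// !l2_norm_sqr /S exchange_big mulr_suml; apply: ler_sum => i _.
by rewrite mxE; apply: CS_normc_sqr.
Qed.

(** Repeated squaring of the self-adjoint matrix replaces a spectral decomposition, at the price of
    exponents that are powers of two. The last squaring compares with the Hilbert-Schmidt norm. *)
Lemma op_norm_pow_le_tr N (A : 'M[C]_N) k :
  op_norm A ^+ (2 * 2 ^ k) <= Re (\tr ((A ^t* *m A) ^+ (2 ^ k))).
Proof.
case: k => [|k]; first by rewrite expr1 op_norm_sqr_le_tr.
pose H := A ^t* *m A.
have HJ : H ^t* = H by rewrite /H trC_mul trCK.
have HkJ n : (H ^+ n) ^t* = H ^+ n.
  elim: n => [|n IH]; first by rewrite expr0; apply/matrixP => x y; rewrite !mxE eq_sym rmorph_nat.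
  by rewrite {1}exprSr -[_ * _]/(_ *m _) trC_mul IH HJ exprS.
have sq n : op_norm (H ^+ n) ^+ 2 <= op_norm (H ^+ (n * 2)).
  by apply: le_trans (op_norm_sqr_le _) _; rewrite HkJ -[_ *m _]/(_ * _) -exprD muln2 addnn.
have it j : op_norm A ^+ (2 * 2 ^ j) <= op_norm (H ^+ (2 ^ j)).
  elim: j => [|j IH]; first by rewrite expr1 op_norm_sqr_le.
  rewrite expnSr mulnA exprM; apply: le_trans (sq _).
  by rewrite lerXn2r ?nnegrE ?exprn_ge0 ?op_norm_ge0.
rewrite expnSr mulnA exprM; apply: le_trans (_ : op_norm (H ^+ (2 ^ k)) ^+ 2 <= _).
  by rewrite lerXn2r ?nnegrE ?exprn_ge0 ?op_norm_ge0.
apply: le_trans (op_norm_sqr_le_tr _) _; rewrite HkJ -[_ *m _]/(_ * _) -exprD.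
by rewrite muln2 addnn.
Qed.

Lemma normc_entry_le N (A : 'M[C]_N) i j : normc (A i j) <= op_norm A.
Proof.
pose dl (k : 'I_N) : 'cV[C]_N := delta_mx k 0.
have l1 k : l2_norm (dl k) = 1.
  apply/eqP; rewrite -(@pexpr_eq1 _ _ 2) ?l2_norm_ge0// l2_norm_sqr (bigD1 k)//=.
  rewrite mxE !eqxx Normc.normc1 expr1n big1 ?addr0// => l lk.
  by rewrite mxE (negbTE lk) Normc.normc0 expr0n.
have := bilin_le_op A (dl i) (dl j); rewrite !l1 mulr1 mulr1.
have -> : (dl i) ^t* = delta_mx 0 i.
  by apply/matrixP => x y; rewrite !mxE rmorph_nat andbC.
by rewrite -rowE -colE !mxE.
Qed.

Lemma tr_pow_le N (A : 'M[C]_N) p :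
  Re (\tr ((A ^t* *m A) ^+ p)) <= N%:R * op_norm A ^+ (2 * p).
Proof.
rewrite Re_sum -[N in N%:R]card_ord -sum1_card natr_sum mulr_suml; apply: ler_sum => i _.
rewrite mul1r; apply: le_trans (le_Re_normc _) _; apply: le_trans (normc_entry_le _ _ _) _.
apply: le_trans (op_normX _ _) _; rewrite exprM lerXn2r ?nnegrE ?exprn_ge0 ?op_norm_ge0//.
apply: le_trans (op_normM _ _) _; rewrite expr2 ler_wpM2r ?op_norm_ge0//; exact: op_normJ.
Qed.

End TraceMoments.

Section RandomMatrix.
Variables (R : realType) (q : nat) (v : 'I_q -> R[i]).
Local Notation C := R[i].
Hypothesis q0 : (0 < q)%N.
Hypothesis v1 : forall k, normc (v k) = 1.
Variables (N : nat) (E : finType) (M : E -> 'M[C]_N).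

Definition rand_norm (z : {ffun E -> 'I_q}) : R := op_norm (\sum_c v (z c) *: M c).

(** [L] squared bounds the weak variance. By duality and Cauchy-Schwarz the norm is [L]-Lipschitz in
    the vector of coefficients, and it is convex in it. *)
Lemma rand_norm_concentration (L : R) (p : nat) : (0 < p)%N -> 0 <= L ->
  (forall x y : 'cV[C]_N, \sum_c normc ((x ^t* *m M c *m y) 0 0) ^+ 2 <=
     (L * (l2_norm x * l2_norm y)) ^+ 2) ->
  \sum_z rand_norm z ^+ (2 * p) <=
  (q ^ #|E|)%:R * (expR 32 *
    ((\sum_z rand_norm z) / (q ^ #|E|)%:R + Num.sqrt p%:R * L)) ^+ (2 * p).
Proof.
move=> p0 L0 hL.
apply: (@moment_concentration_fin R q v q0 _ E (fun y => op_norm (\sum_c y c *: M c))) => //.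
- by move=> k l; apply: le_trans (normcD_le _ _) _; rewrite -[- v l]add0r normcB subr0 !v1.
- by move=> y; apply: op_norm_ge0.
- move=> t y z /andP[t0 t1].
  rewrite (eq_bigr (fun c => ((1 - t)%:C)%C *: (y c *: M c) + (t%:C)%C *: (z c *: M c))).
    rewrite big_split /= -!scaler_sumr; apply: le_trans (op_normD _ _) _; apply: lerD.
      by apply: le_trans (op_normZ_le _ _) _; rewrite normc_real ger0_norm// subr_ge0.
    by apply: le_trans (op_normZ_le _ _) _; rewrite normc_real ger0_norm.
  by move=> c _; rewrite scalerDl !scalerA.
move=> y y'.
have -> : \sum_c y c *: M c = \sum_c y' c *: M c + \sum_c (y c - y' c) *: M c.
  by rewrite -big_split /=; apply: eq_bigr => c _; rewrite -scalerDl addrC subrK.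
apply: le_trans (op_normD _ _) _; rewrite lerD2l; apply: op_norm_le_bilin => [|a b].
  by rewrite mulr_ge0 ?sqrtr_ge0.
rewrite mulmx_sumr mulmx_suml summxE.
rewrite (eq_bigr (fun c => (y c - y' c) * (a ^t* *m M c *m b) 0 0)); last first.
  by move=> c _; rewrite -scalemxAr -scalemxAl mxE.
apply: le_trans (CS_normc _ _) _; rewrite mulrC mulrAC; apply: ler_wpM2r (sqrtr_ge0 _) _ _ _.
have LL : 0 <= L * (l2_norm a * l2_norm b) by rewrite !mulr_ge0 ?l2_norm_ge0.
by rewrite -[leRHS]ger0_norm// -sqrtr_sqr ler_wsqrtr.
Qed.

Lemma rand_norm_avg_le (a : R) (n : nat) : 0 < a -> (0 < n)%N ->
  \sum_z rand_norm z ^+ n <= (q ^ #|E|)%:R * a ^+ n ->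
  \sum_z rand_norm z <= (q ^ #|E|)%:R * a.
Proof.
move=> a0 n0 h; set Q := (q ^ #|E|)%:R; have Q0 : 0 < Q by rewrite ltr0n expn_gt0 q0.
(* The tangent line of t^n at 1, averaged, takes the place of Jensen's inequality. *)
have bern (t : R) : 0 <= t -> 1 + n%:R * (t - 1) <= t ^+ n.
  move=> t0; elim: n {n0 h} => [|n IH]; first by rewrite mul0r addr0.
  rewrite exprS; apply: le_trans (_ : t * (1 + n%:R * (t - 1)) <= _); last by rewrite ler_wpM2l.
  rewrite -subr_ge0 -natr1 [leRHS](_ : _ = n%:R * (t - 1) ^+ 2); last by ring.
  by rewrite mulr_ge0// sqr_ge0.
have : \sum_z (1 + n%:R * (rand_norm z / a - 1)) <= Q.
  apply: le_trans (_ : \sum_z (rand_norm z / a) ^+ n <= _).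
    by apply: ler_sum => z _; apply: bern; rewrite divr_ge0 ?op_norm_ge0 ?(ltW a0).
  under eq_bigr do rewrite expr_div_n.
  by rewrite -mulr_suml ler_pdivrMr ?exprn_gt0.
rewrite big_split /= sumr_const card_ffun card_ord -mulr_sumr -lerBrDl subrr.
rewrite pmulr_rle0 ?ltr0n// sumrB -mulr_suml sumr_const card_ffun card_ord subr_le0.
by rewrite ler_pdivrMr// => /le_trans; apply; rewrite mulrC.
Qed.

End RandomMatrix.

(** * Random tensors of matrix units with small norm *)

(* A family of elementary tensors of matrix units: [lab e j] is the unit
   placed by the letter [e] at the site [j], [None] standing for the identity. *)
Record system (K : nat) := System {
  sites : nat;
  letters : finType;
  lab : letters -> 'I_sites -> option ('I_K * 'I_K) }.

Definition sys_mx (R : realType) (K : nat) (S : system K) (e : letters S) :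
    tensor_mx R K (sites S) :=
  tensor (fun j => letter_mx R (lab e j)).

Definition sys0 (K : nat) : system K := @System K 0 unit (fun _ _ => None).

Definition sys_ext (K : nat) (S : system K) (m : nat) : system K :=
  @System K (sites S + m) (letters S * ('I_m * offdiag K))%type
    (fun e j => match fintype.split j with inl a => lab e.1 a | inr b => block_lab e.2 b end).

Section SystemTraces.
Variables (R : realType) (K : nat).
Local Notation C := R[i].

Lemma word_tr_tensor n (L : finType) (F : L -> 'I_n -> 'M[C]_K) p (e f : {ffun 'I_p -> L}) :
  word_tr (fun a => tensor (F a)) e f =
  \prod_j word_tr (fun a => F a j) e f.
Proof.
rewrite /word_tr -tr_tensor; congr (\tr _).
elim: (index_enum 'I_p) => [|i r IH].
  by rewrite big_nil -[LHS]/(1%:M) -tensor1; apply: eq_tensor => j; rewrite big_nil.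
rewrite big_cons IH tensor_adj tensor_mul -[LHS]/(_ *m _) tensor_mul.
by apply: eq_tensor => j; rewrite big_cons.
Qed.

Lemma letter_mx_ge0 (o : option ('I_K * 'I_K)) k l : 0 <= letter_mx R o k l.
Proof. by case: o => [kl|] /=; rewrite mxE. Qed.

Lemma sys_word_ge0 (S : system K) p (e f : {ffun 'I_p -> letters S}) :
  0 <= word_tr (@sys_mx R K S) e f.
Proof.
rewrite word_tr_tensor; apply: prodr_ge0 => j _; apply: sumr_ge0 => k _; move: k {2}k.
elim: (index_enum 'I_p) => [|i r IH] k l; first by rewrite big_nil mxE.
rewrite big_cons mxE; apply: sumr_ge0 => k' _; apply: mulr_ge0 (IH _ _).
rewrite mxE; apply: sumr_ge0 => l' _; apply: mulr_ge0 (letter_mx_ge0 _ _ _).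
by rewrite !mxE conjC_ge0 letter_mx_ge0.
Qed.

Lemma word_tr_ext (S : system K) m p (e f : {ffun 'I_p -> letters S})
    (b c : {ffun 'I_p -> 'I_m * offdiag K}) :
  word_tr (@sys_mx R K (sys_ext S m)) [ffun i => (e i, b i)] [ffun i => (f i, c i)] =
  word_tr (@sys_mx R K S) e f * word_tr (@block_unit K m R) b c.
Proof.
rewrite !word_tr_tensor big_split_ord /=; congr (_ * _); apply: eq_bigr => j _.
  congr (\tr _); apply: eq_bigr => i _.
  by rewrite !ffunE (unsplitK (inl j : 'I_(sites S) + 'I_m)).
congr (\tr _); apply: eq_bigr => i _.
by rewrite !ffunE (unsplitK (inr j : 'I_(sites S) + 'I_m)).
Qed.

(** For each permutation the word traces of the two tensor factors separate. Only the trace of the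
    new block is estimated, so the sum over permutations survives intact for [S]. *)
Lemma pair_sum_ext (S : system K) m p :
  pair_sum (@sys_mx R K (sys_ext S m)) p <=
  (K ^ m * (m * K) ^ p)%:R * pair_sum (@sys_mx R K S) p.
Proof.
rewrite /pair_sum mulr_sumr; apply: ler_sum => s _.
rewrite sum_ffun_pair.
apply: le_trans (_ : \sum_e \sum_(b : {ffun 'I_p -> 'I_m * offdiag K})
   word_tr (@sys_mx R K S) e [ffun i => e (s i)] *
   word_tr (@block_unit K m R) b [ffun i => b (s i)] <= _).
  rewrite le_eqVlt; apply/orP; left; apply/eqP; apply: eq_bigr => e _.
  apply: eq_bigr => b _; rewrite -word_tr_ext; congr word_tr.
  by apply/ffunP => i; rewrite !ffunE.
rewrite -big_distrlr /= mulrC ler_wpM2r//.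
  by apply: sumr_ge0 => e _; apply: sys_word_ge0.
exact: block_word_tr_sum.
Qed.

Lemma pair_sum_sys0 : pair_sum (@sys_mx R K (sys0 K)) 1 = 1.
Proof.
rewrite /pair_sum (eq_bigr (fun=> 1)) => [|s _].
  by rewrite sumr_const card_Sn.
rewrite (eq_bigr (fun=> 1)) => [|e _]; last by rewrite word_tr_tensor big_ord0.
by rewrite sumr_const card_ffun card_unit card_ord.
Qed.

End SystemTraces.

(** * Weak variance of families of matrix units *)

Section WeakVariance.
Variables (R : realType) (K : nat) (S : system K).
Local Notation C := R[i].
Local Notation word := {ffun 'I_(sites S) -> 'I_K}.

Definition row_ok (e : letters S) (x : word) :=
  [forall j, if lab e j is Some kl then x j == kl.1 else true].
Definition col_ok (e : letters S) (y : word) :=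
  [forall j, if lab e j is Some kl then y j == kl.2 else true].

Lemma sum_forall (P : 'I_(sites S) -> bool) :
  \prod_j (P j)%:R = [forall j, P j]%:R :> R.
Proof.
case: forallP => [h|h]; first by rewrite big1// => j _; rewrite h.
have /existsP[j hj] : [exists j, ~~ P j] by rewrite -negb_forall; apply/negP => /forallP.
by rewrite (bigD1 j)//= (negbTE hj) mul0r.
Qed.

Let T (e : letters S) (x y : word) : R :=
  \prod_j (if lab e j is Some kl then (x j == kl.1) && (y j == kl.2) else x j == y j)%:R.

Let sys_mxE e i j : sys_mx R e i j = ((T e (enum_val i) (enum_val j))%:C)%C.
Proof.
rewrite mxE rmorph_prod; apply: eq_bigr => k _.
by case: (lab e k) => [[a b]|] /=; rewrite mxE rmorph_nat.
Qed.

Let T_ge0 e x y : 0 <= T e x y.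
Proof. by apply: prodr_ge0 => j _. Qed.

Let sum_row e x : \sum_y T e x y = (row_ok e x)%:R.
Proof.
rewrite /T -(bigA_distr_bigA (fun j (l : 'I_K) =>
  (if lab e j is Some kl then (x j == kl.1) && (l == kl.2) else x j == l)%:R)) /=.
rewrite -sum_forall; apply: eq_bigr => j _; case: (lab e j) => [[a b]|] /=.
  rewrite (bigD1 b)//= eqxx andbT big1 ?addr0// => l /negbTE ->; by rewrite andbF.
by rewrite (bigD1 (x j))//= eqxx big1 ?addr0// => l; rewrite eq_sym => /negbTE ->.
Qed.

Let sum_col e y : \sum_x T e x y = (col_ok e y)%:R.
Proof.
rewrite /T -(bigA_distr_bigA (fun j (k : 'I_K) =>
  (if lab e j is Some kl then (k == kl.1) && (y j == kl.2) else k == y j)%:R)) /=.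
rewrite -sum_forall; apply: eq_bigr => j _; case: (lab e j) => [[a b]|] /=.
  rewrite (bigD1 a)//= eqxx big1 ?addr0// => l /negbTE ->; by rewrite andFb.
by rewrite (bigD1 (y j))//= eqxx big1 ?addr0// => l /negbTE ->.
Qed.

(** Each letter is a 0-1 matrix with at most one 1 in every row and column, so Cauchy-Schwarz bounds
    its form by the mass of [u] on the compatible rows times that of [w] on the compatible columns.
    Summing over the letters counts those compatible with a given row and column. *)
Lemma weak_variance (s : nat) :
  (forall x y : word, #|[set e | row_ok e x && col_ok e y]| <= s)%N ->
  forall u w : 'cV[C]_#|{: word}|,
  \sum_e normc ((u ^t* *m sys_mx R e *m w) 0 0) ^+ 2 <=
  s%:R * (l2_norm u * l2_norm w) ^+ 2.
Proof.
move=> hs u w; pose U (x : word) := normc (u (enum_rank x) 0).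
pose W (x : word) := normc (w (enum_rank x) 0).
have U0 x : 0 <= U x by exact: normc_ge0.
have W0 x : 0 <= W x by exact: normc_ge0.
have b1 e : normc ((u ^t* *m sys_mx R e *m w) 0 0) <= \sum_x \sum_y T e x y * (U x * W y).
  rewrite -mulmxA mxE; apply: le_trans (normc_sum _ _ _) _.
  rewrite -(sum_enum_val (fun x => \sum_y T e x y * (U x * W y))).
  apply: ler_sum => i _; rewrite mxE Normc.normcM !mxE normc_conj.
  rewrite /U enum_valK -(sum_enum_val (fun y => T e (enum_val i) y * (_ * W y))).
  apply: le_trans (ler_wpM2l (normc_ge0 _) (normc_sum _ _ _)) _.
  rewrite mulr_sumr; apply: ler_sum => j _.
  by rewrite sys_mxE Normc.normcM normc_real ger0_norm// /W enum_valK mulrCA.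
have b2 e : (\sum_x \sum_y T e x y * (U x * W y)) ^+ 2 <=
    (\sum_x U x ^+ 2 * (row_ok e x)%:R) * (\sum_y W y ^+ 2 * (col_ok e y)%:R).
  rewrite pair_bigA /=.
  rewrite (eq_bigr (fun p : word * word => (Num.sqrt (T e p.1 p.2) * U p.1) *
      (Num.sqrt (T e p.1 p.2) * W p.2))) => [|p _]; last first.
    by rewrite mulrACA -expr2 sqr_sqrtr.
  apply: le_trans (CS_real _ _) _; rewrite le_eqVlt; apply/orP; left; apply/eqP.
  congr (_ * _).
    rewrite -(pair_bigA _ (fun x y => (Num.sqrt (T e x y) * U x) ^+ 2)) /=.
    apply: eq_bigr => x _; rewrite -sum_row mulr_sumr; apply: eq_bigr => y _.
    by rewrite exprMn sqr_sqrtr// mulrC.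
  rewrite -(pair_bigA _ (fun x y => (Num.sqrt (T e x y) * W y) ^+ 2)) /= exchange_big.
  apply: eq_bigr => y _; rewrite -sum_col mulr_sumr; apply: eq_bigr => x _.
  by rewrite exprMn sqr_sqrtr// mulrC.
apply: le_trans (_ : \sum_e (\sum_x U x ^+ 2 * (row_ok e x)%:R) *
    (\sum_y W y ^+ 2 * (col_ok e y)%:R) <= _).
  apply: ler_sum => e _; apply: le_trans (b2 e).
  by rewrite lerXn2r ?nnegrE ?normc_ge0// (le_trans (normc_ge0 _) (b1 e)).
have nE (z : 'cV[C]_#|{: word}|) :
    l2_norm z ^+ 2 = \sum_(x : word) normc (z (enum_rank x) 0) ^+ 2.
  rewrite l2_norm_sqr -(sum_enum_val (fun x : word => normc (z (enum_rank x) 0) ^+ 2)).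
  by apply: eq_bigr => i _; rewrite enum_valK.
rewrite exprMn !nE big_distrlr mulr_sumr /=.
rewrite (eq_bigr (fun e => \sum_x \sum_y U x ^+ 2 * W y ^+ 2 * (row_ok e x && col_ok e y)%:R)).
  rewrite exchange_big; apply: ler_sum => x _; rewrite exchange_big mulr_sumr /=.
  apply: ler_sum => y _; rewrite -mulr_sumr mulrC -/(U x) -/(W y).
  apply: ler_wpM2r; first by rewrite mulr_ge0 ?sqr_ge0.
  rewrite -natr_sum ler_nat; apply: leq_trans (hs x y).
  by rewrite -sum1_card [leqRHS]big_mkcond leq_sum// => e _; rewrite inE; case: (row_ok e x && col_ok e y).
move=> e _; rewrite big_distrlr; apply: eq_bigr => x _; apply: eq_bigr => y _ /=.
by rewrite mulrACA -natrM mulnb.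
Qed.

End WeakVariance.

(** Once the site in the new block is chosen, the matrix unit there is read off from the values of
    [x] and [y], so only m choices are added. *)
Lemma row_col_ext (K : nat) (S : system K) (m s : nat) :
  (forall x y, #|[set e : letters S | row_ok e x && col_ok e y]| <= s)%N ->
  forall x y, (#|[set e : letters (sys_ext S m) | row_ok e x && col_ok e y]| <= s * m)%N.
Proof.
move=> hs x y.
pose x' := [ffun j => x (lshift m j)]; pose y' := [ffun j => y (lshift m j)].
pose A := [set e : letters S | row_ok e x' && col_ok e y']%SET.
pose g (e : letters (sys_ext S m)) := (e.1, e.2.1).
have labR (e : letters (sys_ext S m)) : lab e (rshift (sites S) e.2.1) = Some (val e.2.2).
  by rewrite /= (unsplitK (inr _ : 'I_(sites S) + 'I_m)) /block_lab eqxx.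
rewrite -(card_in_imset (f := g)); last first.
  move=> e e'; rewrite !inE => /andP[/forallP r /forallP c] /andP[/forallP r' /forallP c'].
  move: (r (rshift _ e.2.1)) (c (rshift _ e.2.1)) (r' (rshift _ e'.2.1)) (c' (rshift _ e'.2.1)).
  rewrite !labR; case: e e' {r c r' c'} => [a [i kl]] [a' [i' kl']] /=.
  move=> /eqP r /eqP c /eqP r' /eqP c' [-> ii]; congr (_, (_, _)) => //.
  by apply: val_inj; rewrite [val kl]surjective_pairing -r -c ii r' c' -surjective_pairing.
apply: leq_trans (_ : #|finset.setX A [set: 'I_m]%SET| <= _)%N; last first.
  by rewrite cardsX cardsT card_ord leq_mul2r hs orbT.
apply: subset_leq_card; apply/fintype.subsetP => _ /imsetP[e + ->].
rewrite !inE andbT => /andP[/forallP r /forallP c].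
by apply/andP; split; apply/forallP => j; [have := r (lshift m j)|have := c (lshift m j)];
  rewrite /= (unsplitK (inl j : 'I_(sites S) + 'I_m)) ffunE.
Qed.

(* The blocks have 1, 1, h, h^2, ... sites ([0.-1 = 0] gives the first two). *)
Fixpoint tower (K h d : nat) : system K :=
  if d is d'.+1 then sys_ext (tower K h d') (h ^ d'.-1) else sys0 K.

(** The product of the numbers of sites of the blocks. It bounds the weak variance of one copy, and
    it is the factor that survives in [tower_lower]. *)
Definition tower_var (h d : nat) : nat := \prod_(i < d) h ^ i.-1.

Lemma tower_row_col K h d x y :
  (#|[set e : letters (tower K h d) | row_ok e x && col_ok e y]| <= tower_var h d)%N.
Proof.
elim: d x y => [|d IH] x y.
  by rewrite /tower_var big_ord0; apply: leq_trans (max_card _) _; rewrite card_unit.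
by rewrite /tower_var big_ord_recr; apply: row_col_ext.
Qed.

Lemma sites_tower K h d : (1 < h)%N -> (0 < d)%N -> (sites (tower K h d) <= h ^ d.-1)%N.
Proof.
move=> h1; case: d => // d _; elim: d => [|d IH] //=.
apply: leq_trans (leq_add IH (leqnn _)) _.
by rewrite addnn -muln2 expnSr leq_mul2l h1 orbT.
Qed.

Lemma ffact_half T p : (2 * p <= T)%N -> (T ^ p <= 2 ^ p * T ^_ p)%N.
Proof.
move=> hT; have : (p <= p)%N by [].
elim: {1 3 4 5}p => [|r IH] rp; first by rewrite ffactn0.
rewrite expnSr expnS ffactnSr.
have := leq_mul (IH (ltnW rp)) (_ : T <= 2 * (T - r))%N.
by rewrite mulnACA [(2 ^ r * 2)%N]mulnC; apply; lia.
Qed.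

Section TowerMoments.
Variables (R : realType) (K h b : nat).
Local Notation C := R[i].
Hypothesis h1 : (1 < h)%N.
Hypothesis hb : h = (2 ^ b)%N.
Hypothesis hK : (2 * h <= K)%N.
Hypothesis Kh : (K <= 4 ^ h)%N.

(** The loss per block, 4 * 2 * 4 * 4 * exp 64: the factors come from K^m, the falling factorial,
    the dimension, and the square of 2 exp 32 in the concentration step. *)
Definition tower_const : R := 128 * expR 64.

Definition tower_mean (d : nat) : R := (tower_var h d * K ^ d)%:R.

Let hleK : (h <= K)%N.
Proof. by apply: leq_trans hK; rewrite leq_pmull. Qed.

Let K0 : (0 < K)%N.
Proof. by apply: leq_trans hleK; exact: ltnW. Qed.

Lemma tower_var_gt0 d : (0 < tower_var h d)%N.
Proof. by rewrite prodn_gt0// => i; rewrite expn_gt0 (ltnW h1). Qed.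

Lemma tower_mean_gt0 d : 0 < tower_mean d.
Proof. by rewrite ltr0n muln_gt0 tower_var_gt0 expn_gt0 K0. Qed.

Let ReM (n : nat) (z : C) : Re (n%:R * z) = n%:R * Re z.
Proof.
rewrite [n%:R * z]mulr_natl [RHS]mulr_natl; elim: n => [|n IH]; first by rewrite !mulr0n.
by rewrite !mulrS -IH; case: z {IH} (z *+ n) => [a a'] [c c'].
Qed.

Let le_Re (z w : C) : z <= w -> Re z <= Re w.
Proof. by case: z w => [a a'] [c c']; rewrite lecE => /andP[_]. Qed.

Local Notation MT T d := (fun c : 'I_T * letters (tower K h d) => sys_mx R c.2).

Definition good_roots q (v : 'I_q -> C) := (forall k, normc (v k) = 1) /\
  forall a b, (a < q)%N -> (b < q)%N ->
    \sum_k v k ^+ a * conjC (v k) ^+ b = if a == b then q%:R else 0.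

(* The order h^(d-1) of the moment is at least of the order of the log-dimension at
   level d, so the moment controls the operator norm; yet it is small enough for
   trading the last block of level d + 1 for scalar copies of level d. *)
Definition tower_bound (d : nat) := forall T q (v : 'I_q -> C), (0 < T)%N ->
  (h ^ d.-1 < q)%N -> good_roots v ->
  \sum_z rand_norm v (MT T d) z ^+ (2 * h ^ d.-1) <=
  (q ^ #|{: 'I_T * letters (tower K h d)}|)%:R *
  (tower_const ^+ d * K%:R * T%:R * tower_mean d) ^+ (h ^ d.-1).

Lemma moment_le_prev (d T q : nat) (v : 'I_q -> C) :
  (h ^ d < q)%N -> good_roots v ->
  \sum_z rand_norm v (MT T d.+1) z ^+ (2 * h ^ d) <=
  (q ^ #|{: 'I_T * letters (tower K h d.+1)}|)%:R *
  (K%:R ^+ (h ^ d.-1) * (T * (h ^ d.-1 * K))%:R ^+ (h ^ d) *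
   Re (pair_sum (@sys_mx R K (tower K h d)) (h ^ d))).
Proof.
move=> pq [v1 vJ]; set p := (h ^ d)%N.
apply: le_trans (_ : Re (\sum_(z : {ffun _ -> 'I_q}) \tr (((\sum_c v (z c) *: MT T d.+1 c) ^t* *m
     (\sum_c v (z c) *: MT T d.+1 c)) ^+ p)) <= _).
  rewrite Re_sum; apply: ler_sum => z _; have hpk : p = (2 ^ (b * d))%N by rewrite /p hb expnM.
  by rewrite hpk; exact: op_norm_pow_le_tr.
have h1' := moment_le_pair_sum vJ (@sys_word_ge0 R K (tower K h d.+1)) T pq.
apply: le_trans (le_Re h1') _; rewrite !ReM ler_wpM2l// natrX natrM exprMn.
rewrite [X in _ <= X * _]mulrCA -[leRHS]mulrA ler_wpM2l ?exprn_ge0//.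
apply: le_trans (le_Re (pair_sum_ext R (tower K h d) (h ^ d.-1) p)) _.
by rewrite ReM natrM !natrX.
Qed.

Lemma tower_bound1 : tower_bound 1.
Proof.
move=> T q v T0 pq gv; have := @moment_le_prev 0 T q v pq gv.
rewrite [1.-1]/= [0.-1]/= !expn0 => /le_trans; apply; rewrite ler_wpM2l//.
change (K%:R * (T * (1 * K))%:R * Re (pair_sum (@sys_mx R K (sys0 K)) 1) <=
  tower_const * K%:R * T%:R * tower_mean 1).
rewrite pair_sum_sys0 mulr1 /tower_mean /tower_var big_ord1 expn0 !mul1n natrM.
have c1 : 1 <= tower_const.
  by rewrite /tower_const; have := expR_ge1Dx (64 : R); lra.
by rewrite -[leLHS]mul1r !mulrA ler_wpM2r// ler_wpM2r// ler_wpM2r//.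
Qed.

(** Removing the last block leaves T'^p times a pairing sum, with T' = T m K. Since T' >= 2 p, this
    is within 2^p of the part of a moment of T' copies of level d in which all copies are distinct.
    The induction hypothesis at order m bounds the mean norm of these copies, and concentration
    lifts this to order p = h m. *)
Lemma tower_boundS (d : nat) : (0 < d)%N -> tower_bound d -> tower_bound d.+1.
Proof.
move=> d0 IH T q v T0 pq gv; rewrite [d.+1.-1]/= in pq *.
have [v1 vJ] := gv; set p := (h ^ d)%N; set m := (h ^ d.-1)%N.
have h0 : (0 < h)%N by exact: ltnW.
have hp : p = (h * m)%N by rewrite /p /m -expnS prednK.
have m0 : (0 < m)%N by rewrite expn_gt0 h0.
have p0 : (0 < p)%N by rewrite expn_gt0 h0.
have mp : (m <= p)%N by rewrite hp leq_pmull.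
apply: le_trans (moment_le_prev T pq gv) _; rewrite ler_wpM2l//.
rewrite -/p -/m; set T' := (T * (m * K))%N.
have T'0 : (0 < T')%N by rewrite !muln_gt0 T0 m0 K0.
set PS := Re _.
pose D : R := #|{: {ffun 'I_(sites (tower K h d)) -> 'I_K}}|%:R.
pose X : R := tower_const ^+ d * K%:R * T'%:R * tower_mean d.
have c1 : 1 <= tower_const by rewrite /tower_const; have := expR_ge1Dx (64 : R); lra.
have Y0 : 0 < T'%:R * tower_mean d by apply: mulr_gt0; [rewrite ltr0n|exact: tower_mean_gt0].
have YX : T'%:R * tower_mean d <= X.
  rewrite /X -[X in _ <= X]mulrA -[leLHS]mul1r ler_wpM2r ?(ltW Y0)// mulr_ege1 ?exprn_ege1//.
  by rewrite ler1n.
have X0 : 0 < X by exact: lt_le_trans YX.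
have X4 : 0 <= 4 * expR 64 * X.
  by apply: mulr_ge0 (ltW X0); rewrite mulr_ge0 ?expR_ge0.
have q0 : (0 < q)%N by exact: leq_ltn_trans pq.
have q'0 : 0 < (q ^ #|{: 'I_T' * letters (tower K h d)}|)%:R :> R by rewrite ltr0n expn_gt0 q0.
pose A := (\sum_z rand_norm v (MT T' d) z) /
    (q ^ #|{: 'I_T' * letters (tower K h d)}|)%:R.
have A0 : 0 <= A.
  by apply: divr_ge0 => //; apply: sumr_ge0 => z _; exact: op_norm_ge0.
have avg : A <= Num.sqrt X.
  rewrite ler_pdivrMr// mulrC.
  apply: (@rand_norm_avg_le R q v q0 _ _ _ _ (2 * m)); rewrite ?sqrtr_gt0 ?muln_gt0 ?m0//.
  by rewrite exprM sqr_sqrtr ?(ltW X0)//; apply: IH => //; exact: leq_ltn_trans pq.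
have conc : \sum_z rand_norm v (MT T' d) z ^+ (2 * p) <=
    (q ^ #|{: 'I_T' * letters (tower K h d)}|)%:R * (4 * expR 64 * X) ^+ p.
  pose L : R := Num.sqrt (T' * tower_var h d)%:R.
  have hL (x y : 'cV[C]_#|{: {ffun 'I_(sites (tower K h d)) -> 'I_K}}|) :
      \sum_(c : 'I_T' * letters (tower K h d))
        normc ((x ^t* *m MT T' d c *m y) 0 0) ^+ 2 <= (L * (l2_norm x * l2_norm y)) ^+ 2.
    rewrite -(pair_bigA _ (fun _ e => normc ((x ^t* *m sys_mx R e *m y) 0 0) ^+ 2)) /=.
    rewrite sumr_const card_ord exprMn sqr_sqrtr// natrM -mulrA -[leLHS]mulr_natl.
    by rewrite ler_wpM2l// weak_variance//; exact: tower_row_col.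
  apply: le_trans (rand_norm_concentration q0 v1 p0 (sqrtr_ge0 _) hL) _; rewrite -/A -/L.
  rewrite ler_wpM2l ?(ltW q'0)// exprM lerXn2r ?nnegrE ?exprn_ge0//.
    by rewrite mulr_ge0 ?expR_ge0// addr_ge0// mulr_ge0 ?sqrtr_ge0.
  (* Here p = h^d <= K^d is used: the fluctuation at order p does not exceed the bound already known
     for the mean. *)
  have pL : Num.sqrt p%:R * L <= Num.sqrt X.
    rewrite -sqrtrM// ler_wsqrtr//; apply: le_trans YX.
    rewrite /tower_mean -!natrM ler_nat mulnCA leq_mul2l; apply/orP; right.
    by rewrite mulnC leq_mul2l leq_exp2r// hleK orbT.
  apply: le_trans (_ : (expR 32 * (Num.sqrt X + Num.sqrt X)) ^+ 2 <= _).
    have B0 : 0 <= expR 32 * (A + Num.sqrt p%:R * L).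
      by apply: mulr_ge0 (expR_ge0 _) _; rewrite addr_ge0// mulr_ge0 ?sqrtr_ge0.
    have B1 : 0 <= expR 32 * (Num.sqrt X + Num.sqrt X).
      by apply: mulr_ge0 (expR_ge0 _) _; rewrite addr_ge0 ?sqrtr_ge0.
    rewrite lerXn2r ?nnegrE//.
    by rewrite ler_wpM2l ?expR_ge0// lerD.
  have -> : expR 64 = expR 32 ^+ 2 :> R by rewrite expr2 -expRD; congr expR; ring.
  rewrite -[X in _ <= _ * X](sqr_sqrtr (ltW X0)) le_eqVlt; apply/orP; left; apply/eqP; ring.
have prev : (T' ^_ p)%:R * PS <= D * (4 * expR 64 * X) ^+ p.
  have := le_Re (pair_sum_le_moment vJ (@sys_word_ge0 R K (tower K h d)) T' pq).
  rewrite !ReM -/PS Re_sum => le1.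
  rewrite -(ler_pM2l q'0); apply: le_trans le1 _; rewrite mulrCA.
  apply: le_trans (ler_wpM2l (ler0n _ _) conc); rewrite mulr_sumr.
  by apply: ler_sum => z _; apply: tr_pow_le.
have PS0 : 0 <= PS.
  have /le_Re// : 0 <= pair_sum (@sys_mx R K (tower K h d)) p.
  by apply: sumr_ge0 => s _; apply: sumr_ge0 => e _; exact: sys_word_ge0.
(* Level d has at most m sites, so its dimension is at most K^m <= (4^h)^m = 4^p. *)
have D4 : D <= 4 ^+ p.
  rewrite /D card_ffun !card_ord -natrX ler_nat.
  apply: leq_trans (leq_pexp2l K0 (sites_tower K h1 d0)) _.
  by rewrite -/m hp expnM leq_exp2r.
have Km4 : K%:R ^+ m <= 4 ^+ p :> R by rewrite -!natrX ler_nat hp expnM leq_exp2r.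
have hT' : (2 * p <= T')%N.
  rewrite /T' hp mulnA [(2 * h * m)%N]mulnC; apply: leq_trans (leq_pmull _ T0).
  by rewrite leq_mul2l hK orbT.
apply: le_trans (_ : 4 ^+ p * (2 ^+ p * (4 ^+ p * (4 * expR 64 * X) ^+ p)) <= _).
  rewrite -mulrA; apply: ler_pM => //; rewrite ?exprn_ge0// ?mulr_ge0 ?exprn_ge0//.
  apply: le_trans (_ : (2 ^ p * T' ^_ p)%:R * PS <= _).
    by rewrite ler_wpM2r// -natrX ler_nat ffact_half.
  rewrite natrM natrX -mulrA ler_wpM2l ?exprn_ge0//; apply: le_trans prev _.
  by rewrite ler_wpM2r ?exprn_ge0.
rewrite -!exprMn le_eqVlt; apply/orP; left; apply/eqP; congr (_ ^+ _).
rewrite /X /T' /tower_mean /tower_var big_ord_recr /= -/m !natrM !exprSr !expnSr !natrM.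
rewrite {3}/tower_const; ring.
Qed.

Lemma tower_boundP d : (0 < d)%N -> tower_bound d.
Proof.
case: d => // d _; elim: d => [|d IH]; [exact: tower_bound1|exact: tower_boundS].
Qed.

End TowerMoments.

(** * Lower bounds for the constants *)

Section FourierBasis.
Variables (R : realType) (K : nat).
Local Notation C := R[i].
Hypothesis K0 : (0 < K)%N.

Lemma orthonormal_basis (B : 'I_(K ^ 2) -> 'M[C]_K) :
  (forall mu nu, K%:R^-1 * \tr (B mu *m (B nu) ^t*) = (mu == nu)%:R) ->
  basis_of fullv (codom B).
Proof.
move=> hB; have sz : size (codom B) = (K ^ 2)%N by rewrite size_codom card_ord.
rewrite basisEfree subvf dimvf /= sz /dim /= mulnn leqnn andbT.
have -> : codom B = [tuple B i | i < K ^ 2] by rewrite codomE.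
apply/freeP => k hk i.
have hk' : \sum_j k j *: B j = 0.
  by rewrite -[RHS]hk; apply: eq_bigr => j _; rewrite -tnth_nth tnth_mktuple.
have : K%:R^-1 * \tr ((\sum_j k j *: B j) *m (B i) ^t*) = 0.
  by rewrite hk' mul0mx mxtrace0 mulr0.
rewrite mulmx_suml tr_sum mulr_sumr (bigD1 i)//=.
rewrite -scalemxAl mxtraceZ mulrCA hB eqxx mulr1 big1 ?addr0// => j ji.
by rewrite -scalemxAl mxtraceZ mulrCA hB (negbTE ji) mulr0.
Qed.

Lemma pair_index_lt (p : 'I_K * 'I_K) : (p.1 * K + p.2 < K ^ 2)%N.
Proof.
rewrite -mulnn; apply: leq_trans (_ : p.1.+1 * K <= _)%N; last by rewrite leq_mul2r ltn_ord orbT.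
by rewrite mulSn addnC ltn_add2r.
Qed.

Definition pair_index (p : 'I_K * 'I_K) : 'I_(K ^ 2) := Ordinal (pair_index_lt p).

Lemma index_fst_lt (mu : 'I_(K ^ 2)) : (mu %/ K < K)%N.
Proof. by rewrite ltn_divLR// mulnn. Qed.

Lemma index_snd_lt (mu : 'I_(K ^ 2)) : (mu %% K < K)%N.
Proof. by rewrite ltn_pmod. Qed.

Definition index_pair (mu : 'I_(K ^ 2)) : 'I_K * 'I_K :=
  (Ordinal (index_fst_lt mu), Ordinal (index_snd_lt mu)).

Lemma pair_indexK : cancel pair_index index_pair.
Proof.
move=> [a b]; congr (_, _); apply: val_inj => /=.
  by rewrite divnMDl// divn_small// addn0.
by rewrite modnMDl modn_small.
Qed.

Lemma index_pairK : cancel index_pair pair_index.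
Proof. by move=> mu; apply: val_inj => /=; rewrite -divn_eq. Qed.

(** The off-diagonal units stay in the basis, so that the tensors of the lower bound are multiples
    of basis elements. The diagonal matrices are spanned by the characters of a cyclic group, of
    which the trivial one, at index 0, is the identity. *)
Lemma fourier_basis : exists2 B : 'I_(K ^ 2) -> 'M[C]_K, normalized_local_basis B &
  forall kl : offdiag K, B (pair_index (val kl)) =
    ((Num.sqrt K%:R)%:C)%C *: delta_mx (val kl).1 (val kl).2.
Proof.
have [v [_ vJ]] := roots_of_unity R K0.
pose s : C := ((Num.sqrt K%:R)%:C)%C.
pose D (p : 'I_K * 'I_K) : 'M[C]_K := if p.1 == p.2
  then \matrix_(k, l) ((k == l)%:R * v k ^+ p.1) else s *: delta_mx p.1 p.2.
exists (fun mu => D (index_pair mu)); last first.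
  by move=> [[k l] kl]; rewrite pair_indexK /D /= (negbTE kl).
have KC : (K%:R : C) != 0 by rewrite pnatr_eq0 -lt0n.
have ss : s * conjC s = K%:R.
  by rewrite mulcJ normc_real ger0_norm ?sqrtr_ge0// sqr_sqrtr// rmorph_nat.
have trE (M P : 'M[C]_K) : \tr (M *m P ^t*) = \sum_k \sum_l M k l * conjC (P k l).
  by apply: eq_bigr => k _; rewrite mxE; apply: eq_bigr => l _; rewrite !mxE.
have diagE (P : 'M[C]_K) a : \tr ((\matrix_(k, l) ((k == l)%:R * v k ^+ a)) *m P ^t*) =
    \sum_k v k ^+ a * conjC (P k k).
  rewrite trE; apply: eq_bigr => k _; rewrite (bigD1 k)//= mxE eqxx mul1r.
  by rewrite big1 ?addr0// => l lk; rewrite mxE eq_sym (negbTE lk) !mul0r.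
have offE (P : 'M[C]_K) a b : \tr ((s *: delta_mx a b) *m P ^t*) = s * conjC (P a b).
  rewrite trE (bigD1 a)//= (bigD1 b)//= !mxE !eqxx mulr1 big1 ?addr0 => [|l lb].
    rewrite big1 ?addr0// => k ka; rewrite big1// => l _.
    by rewrite !mxE (negbTE ka) /= mulr0 mul0r.
  by rewrite !mxE (negbTE lb) andbF mulr0 mul0r.
have orth p p' : K%:R^-1 * \tr (D p *m (D p') ^t*) = (p == p')%:R.
  case: p p' => [a b] [a' b']; rewrite /D /=.
  have [<-|ab] := eqVneq a b.
    rewrite diagE; have [<-|ab'] := eqVneq a' b'.
      rewrite (eq_bigr (fun k => v k ^+ a * conjC (v k) ^+ a')) => [|k _].
        rewrite vJ// xpair_eqE andbb -val_eqE /=; case: eqP => _; last by rewrite mulr0.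
        by rewrite mulVf.
      by rewrite mxE eqxx mul1r rmorphXn.
    rewrite big1 ?mulr0 => [|k _].
      rewrite xpair_eqE; case: eqP => //= ->; by rewrite (negbTE ab').
    rewrite !mxE; case: eqP => [->|_] /=; last by rewrite mulr0 rmorph0 mulr0.
    by rewrite (negbTE ab') mulr0 rmorph0 mulr0.
  rewrite offE; have [<-|ab'] := eqVneq a' b'.
    rewrite mxE (negbTE ab) mul0r rmorph0 !mulr0 xpair_eqE.
    by case: eqP => //= <-; rewrite eq_sym (negbTE ab).
  rewrite !mxE rmorphM rmorph_nat [s * _]mulrA [s * _]ss mulrA mulVf// mul1r.
  by rewrite xpair_eqE.
split.
- move=> mu mu0; have -> : index_pair mu = (Ordinal K0, Ordinal K0).
    by congr (_, _); apply: val_inj => /=; rewrite mu0 ?div0n ?mod0n.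
  by rewrite /D eqxx; apply/matrixP => k l; rewrite !mxE expr0 mulr1.
- by move=> mu nu; rewrite orth (inj_eq (can_inj index_pairK)).
apply: orthonormal_basis => mu nu.
by rewrite orth (inj_eq (can_inj index_pairK)).
Qed.

End FourierBasis.

Section FlatMatrices.
Variables (R : realType) (K : nat).
Local Notation C := R[i].
Hypothesis K0 : (0 < K)%N.
Variable B : 'I_(K ^ 2) -> 'M[C]_K.
Hypothesis Bb : normalized_local_basis B.
Hypothesis Boff : forall kl : offdiag K, B (pair_index (val kl)) =
  ((Num.sqrt K%:R)%:C)%C *: delta_mx (val kl).1 (val kl).2.

(** Under these conditions distinct letters are multiples, by the same scalar, of distinct basis
    tensors with support of size d; unimodular combinations then have flat Fourier coefficients. *)
Definition flat_system (S : system K) (d : nat) : Prop :=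
  [/\ forall (e : letters S) j kl, lab e j = Some kl -> kl.1 != kl.2,
      forall e e' : letters S, lab e =1 lab e' -> e = e'
    & forall e : letters S, #|[set j | lab e j != None]| = d].

Variables (S : system K) (d : nat).
Hypothesis Sflat : flat_system S d.
Local Notation n := (sites S).
Local Notation multi := {ffun 'I_n -> 'I_(K ^ 2)}.

Let K2 : (0 < K ^ 2)%N. Proof. by rewrite expn_gt0 K0. Qed.

Definition letter_index (e : letters S) : multi :=
  [ffun j => if lab e j is Some kl then pair_index kl else Ordinal K2].

Let s : R := (Num.sqrt K%:R)^-1.

Let s0 : 0 < s. Proof. by rewrite invr_gt0 sqrtr_gt0 ltr0n. Qed.

Let pair_index_neq0 (kl : 'I_K * 'I_K) : kl.1 != kl.2 -> val (pair_index kl) != 0%N.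
Proof.
apply: contraNneq => /= /eqP; rewrite addn_eq0 muln_eq0 (gtn_eqF K0) orbF => /andP[/eqP a /eqP b].
by apply/eqP/val_inj; rewrite /= a b.
Qed.

Lemma sys_mx_basis (e : letters S) :
  sys_mx R e = ((s ^+ d)%:C)%C *: tensor (fun j => B (letter_index e j)).
Proof.
have [off _ deg] := Sflat.
have -> : ((s ^+ d)%:C)%C = \prod_j (if lab e j is Some _ then (s%:C)%C else 1) :> C.
  rewrite (bigID (fun j => lab e j != None)) /= [X in _ * X]big1 ?mulr1; last first.
    by move=> j; case: (lab e j).
  rewrite (eq_bigr (fun=> (s%:C)%C)); last by move=> j; case: (lab e j).
  rewrite prodr_const rmorphXn -(deg e); congr (_ ^+ _).
  by apply: eq_card => j; rewrite inE.
rewrite -tensorZ; apply: eq_tensor => j; rewrite ffunE; case lj: (lab e j) => [kl|] /=.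
  rewrite (Boff (Sub kl (off _ _ _ lj))) scalerA -rmorphM /s mulVf ?scale1r//.
  by rewrite gt_eqF// sqrtr_gt0 ltr0n.
by rewrite scale1r; case: Bb => -> .
Qed.

Lemma letter_index_inj : injective letter_index.
Proof.
have [off inj _] := Sflat => e e' ee; apply: inj => j.
have := congr1 (fun g : multi => g j) ee; rewrite !ffunE.
case lj: (lab e j) => [kl|]; case lj': (lab e' j) => [kl'|]//.
- by move/(can_inj (pair_indexK K0)) => ->.
- move/(congr1 val) => /eqP; rewrite [_ == _](negbTE (pair_index_neq0 (off _ _ _ lj)))//.
move/(congr1 val)/esym/eqP; rewrite [_ == _](negbTE (pair_index_neq0 (off _ _ _ lj')))//.
Qed.

Lemma supp_letter_index (e : letters S) : #|supp (letter_index e)| = d.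
Proof.
have [off _ deg] := Sflat; rewrite -(deg e); apply: eq_card => j; rewrite !inE ffunE.
by case lj: (lab e j) => [kl|] //=; apply: (pair_index_neq0 (off _ _ _ lj)).
Qed.

Definition flat_mx (w : letters S -> C) : tensor_mx R K n := \sum_e w e *: sys_mx R e.

Lemma fourier_flat w b : fourier_coef B (flat_mx w) b =
  \sum_e w e * ((s ^+ d)%:C)%C * (letter_index e == b)%:R.
Proof.
rewrite fourier_coef_sum; apply: eq_bigr => e _.
by rewrite fourier_coefZ sys_mx_basis fourier_coefZ fourier_coef_basis// mulrA.
Qed.

Lemma flat_mx_H w : H_hom d (flat_mx w).
Proof.
have -> : flat_mx w = hom_part B (fun b => \sum_e w e * ((s ^+ d)%:C)%C * (letter_index e == b)%:R) d.
  rewrite /hom_part; under [RHS]eq_bigr do rewrite scaler_suml.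
  rewrite exchange_big; apply: eq_bigr => e _ /=.
  rewrite (bigD1 (letter_index e)) ?supp_letter_index ?eqxx//= mulr1 big1 ?addr0.
    by rewrite sys_mx_basis scalerA.
  by move=> b /andP[_ /negbTE]; rewrite eq_sym => ->; rewrite mulr0 scale0r.
exact: hom_part_H.
Qed.

Lemma BH_expX (x : R) : (0 < d)%N -> 0 <= x -> (x `^ BH_exp R d) ^+ d.+1 = x ^+ (2 * d).
Proof.
move=> d0 x0; rewrite -powR_mulrn ?powR_ge0// -powRrM /BH_exp divfK ?pnatr_eq0//.
by rewrite powR_mulrn.
Qed.

(** The power 2 d = (d + 1) [BH_exp R d] clears the real exponents on both sides. *)
Lemma lp_flat w : (0 < d)%N -> (forall e, normc (w e) = 1) ->
  lp_norm (BH_exp R d) (fourier_coef B (flat_mx w)) ^+ (2 * d) =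
  #|letters S|%:R ^+ d.+1 * K%:R ^- (d * d).
Proof.
move=> d0 w1; have p0 := lt_le_trans ltr01 (BH_exp_ge1 R d0).
rewrite -BH_expX// ?lp_norm_ge0// lp_normX ?lt0r_neq0//.
have -> : \sum_b normc (fourier_coef B (flat_mx w) b) `^ BH_exp R d =
    #|letters S|%:R * (s ^+ d) `^ BH_exp R d.
  rewrite (bigID (fun b => b \in codom letter_index)) /= [X in _ + X]big1 ?addr0.
    rewrite (eq_bigl (fun b => b \in [set letter_index e | e in [set: letters S]]%SET)).
      rewrite big_imset /=; last by move=> e e' _ _; apply: letter_index_inj.
      rewrite (eq_bigr (fun=> (s ^+ d) `^ BH_exp R d)) => [|e _].
        by rewrite sumr_const cardsT mulr_natl.
      rewrite fourier_flat (bigD1 e)//= eqxx mulr1 big1 ?addr0 => [|e' ee].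
        by rewrite Normc.normcM w1 mul1r normc_real ger0_norm ?exprn_ge0 ?ltW.
      by rewrite (inj_eq letter_index_inj) (negbTE ee) mulr0.
    move=> b; apply/codomP/imsetP => [[e ->]|[e _ ->]]; last by exists e.
    by exists e; rewrite ?inE.
  move=> b hb; rewrite fourier_flat big1 ?Normc.normc0 ?powR0 ?lt0r_neq0//.
  move=> e _; case: eqP => [eb|]; last by rewrite mulr0.
  by move: hb; rewrite -eb codom_f.
rewrite exprMn BH_expX ?exprn_ge0 ?ltW//; congr (_ * _).
rewrite -exprM mulnCA mulnC exprM -exprM mulnC exprM.
by rewrite exprVn sqr_sqrtr// exprVn.
Qed.

Lemma op_letter_le1 (e : letters S) : op_norm (sys_mx R e) <= 1.
Proof.
apply: op_norm_le_bilin => // u v; rewrite mul1r.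
rewrite -(@ler_pXn2r _ 2) ?nnegrE ?normc_ge0 ?mulr_ge0 ?l2_norm_ge0//.
pose S1 : system K := @System K n unit (fun _ => lab e).
have := @weak_variance R K S1 1 _ u v; rewrite (bigD1 tt)//= big1 ?addr0; last by case.
rewrite mul1r; apply => x y; apply: leq_trans (max_card _) _; by rewrite card_unit.
Qed.

End FlatMatrices.

Lemma card_offdiag (K : nat) : #|{: offdiag K}| = (K * K.-1)%N.
Proof.
rewrite card_sig; have := cardC [pred kl : 'I_K * 'I_K | kl.1 == kl.2].
have -> : #|[pred kl : 'I_K * 'I_K | kl.1 == kl.2]| = K.
  have dinj : injective (fun k : 'I_K => (k, k)) by move=> a b [].
  rewrite -[RHS]card_ord -(fintype.card_image dinj 'I_K).
  apply: eq_card => -[a b]; rewrite !inE /=; apply/eqP/fintype.imageP => [->|[c _ [-> ->]]//].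
  by exists b.
rewrite card_prod card_ord => h; have -> : (K * K.-1 = K * K - K)%N.
  by rewrite -[X in (_ - X)%N]muln1 -mulnBr subn1.
by rewrite -h addKn; apply: eq_card => x; rewrite !inE.
Qed.

Section TowerFlat.
Variables (K h : nat).

Lemma flat_sys_ext (S : system K) d m : flat_system S d -> flat_system (sys_ext S m) d.+1.
Proof.
move=> [off inj deg].
have labL (e : letters (sys_ext S m)) j : lab e (lshift m j) = lab e.1 j.
  by rewrite /= (unsplitK (inl j : 'I_(sites S) + 'I_m)).
have labR (e : letters (sys_ext S m)) j : lab e (rshift (sites S) j) = block_lab e.2 j.
  by rewrite /= (unsplitK (inr j : 'I_(sites S) + 'I_m)).
split.
- move=> e j kl; case: (split_ordP j) => a ->.
    by rewrite labL; apply: off.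
  by rewrite labR /block_lab; case: eqP => // _ [<-]; exact: (valP e.2.2).
- move=> e e' ee; have e1 : e.1 = e'.1.
    by apply: inj => j; rewrite -!labL ee.
  have := ee (rshift _ e.2.1); rewrite !labR /block_lab eqxx.
  case: e e' e1 {ee} => [a [i kl]] [a' [i' kl']] /= ->.
  by case: eqP => // -> [/val_inj ->].
move=> e; rewrite -(deg e.1) -[RHS]addn1 -[LHS]sum1_card big_split_ord; congr (_ + _)%N.
  by rewrite -sum1_card; apply: eq_bigl => j; rewrite !inE labL.
rewrite (eq_bigl (pred1 e.2.1)) ?big_pred1_eq// => j.
by rewrite !inE labR /block_lab /=; case: (j == _).
Qed.

Lemma flat_tower d : flat_system (tower K h d) d.
Proof.
elim: d => [|d IH]; last exact: flat_sys_ext.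
split=> [[]//|[] []//|[]]; by rewrite eq_card0// => -[].
Qed.

Lemma card_letters_tower d :
  #|letters (tower K h d)| = (tower_var h d * (K * K.-1) ^ d)%N.
Proof.
elim: d => [|d IH]; first by rewrite card_unit /tower_var big_ord0.
rewrite /= !card_prod card_ord card_offdiag IH /tower_var big_ord_recr expnSr /=.
by rewrite mulnACA.
Qed.

Lemma tower_var_sqr d : (0 < d)%N -> (tower_var h d ^ 2 = h ^ (d.-1 * d.-2))%N.
Proof.
case: d => // d _; elim: d => [|d IH].
  by rewrite /tower_var big_ord1.
rewrite /tower_var big_ord_recr expnMn -/(tower_var h d.+1) IH -expnM -expnD /=.
congr (_ ^ _)%N; case: d {IH} => // d /=; lia.
Qed.

End TowerFlat.

Definition hom_admissible (R : realType) (d K : nat) (c : R) : Prop :=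
  forall n (B : 'I_(K ^ 2) -> 'M[R[i]]_K) (A : tensor_mx R K n),
    normalized_local_basis B -> H_hom d A ->
    lp_norm (BH_exp R d) (fourier_coef B A) <= c * op_norm A.

Section Lower.
Variable R : realType.
Local Notation C := R[i].

Lemma tower_good_sample (K h b d : nat) : (1 < h)%N -> h = (2 ^ b)%N -> (2 * h <= K)%N ->
  (K <= 4 ^ h)%N -> (0 < d)%N ->
  exists w : letters (tower K h d) -> C, (forall e, normc (w e) = 1) /\
    op_norm (flat_mx w) ^+ 2 <= tower_const R ^+ d * K%:R * tower_mean R K h d.
Proof.
move=> h1 hb hK Kh d0; set Y := _ * tower_mean _ _ _ _; set m := (h ^ d.-1)%N.
have m0 : (0 < m)%N by rewrite expn_gt0 ltnW.
have [v gv] := roots_of_unity R (ltn0Sn m).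
have Y0 : 0 <= Y.
  by rewrite mulr_ge0 ?mulr_ge0 ?exprn_ge0 // /tower_const mulr_ge0 ?expR_ge0.
(* A single copy, T = 1, and roots of order m + 1, the smallest order for which the moment is
   controlled. *)
have := @tower_boundP R K h b h1 hb hK Kh d d0 1%N m.+1 v isT (ltnSn _) gv.
rewrite mulr1 -/Y -/m; set f := rand_norm v _ => hf.
have [z hz] : exists z, f z ^+ (2 * m) <= Y ^+ m.
  apply: contrapT => /forallNP no; move: hf; apply/negP; rewrite -ltNge.
  rewrite (_ : _%:R * Y ^+ m = \sum_(z : {ffun 'I_1 * letters (tower K h d) -> 'I_m.+1}) Y ^+ m).
    have z0 : {ffun 'I_1 * letters (tower K h d) -> 'I_m.+1} := [ffun=> ord0].
    rewrite (bigD1 z0)//= [ltRHS](bigD1 z0)//=; apply: ltr_leD.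
      by rewrite ltNge; apply/negP/no.
    by apply: ler_sum => z _; rewrite leNgt; apply/negP => /ltW/no.
  by rewrite sumr_const card_ffun card_ord mulr_natl.
exists (fun e => v (z (ord0, e))); split=> [e|]; first by case: gv.
have -> : op_norm (flat_mx (fun e => v (z (ord0, e)))) = f z.
  rewrite /f /rand_norm /flat_mx; congr op_norm.
  rewrite [RHS](eq_bigr (fun c => v (z (c.1, c.2)) *: sys_mx R c.2)); last by case.
  by rewrite -(pair_bigA _ (fun a e => v (z (a, e)) *: sys_mx R e)) big_ord1.
by move: hz; rewrite exprM ler_pXn2r// nnegrE ?exprn_ge0// op_norm_ge0.
Qed.

Lemma admissible_gt0 (K d : nat) (c : R) (S : system K) (w : letters S -> C) :
  (0 < K)%N -> (0 < d)%N -> flat_system S d -> (0 < #|letters S|)%N ->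
  (forall e, normc (w e) = 1) -> hom_admissible d K c ->
  0 < c /\ #|letters S|%:R ^+ d.+1 * K%:R ^- (d * d) <= (c * op_norm (flat_mx w)) ^+ (2 * d).
Proof.
move=> K0 d0 Sf L0 w1 hc; have [B Bb Boff] := fourier_basis R K0.
have lpE := lp_flat K0 Bb Boff Sf d0 w1.
have := hc _ B _ Bb (flat_mx_H K0 Bb Boff Sf w); set lp := lp_norm _ _ in lpE *.
have lp0 : 0 < lp ^+ (2 * d).
  by rewrite lpE mulr_gt0 ?exprn_gt0 ?invr_gt0 ?exprn_gt0 ?ltr0n.
have lpp : 0 < lp.
  by rewrite lt_def lp_norm_ge0 andbT; apply: contraTneq lp0 => ->; rewrite expr0n muln_eq0 /= (gtn_eqF d0) ltxx.
move=> le; split.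
  rewrite ltNge; apply/negP => c0; have := lt_le_trans lpp le.
  by rewrite ltNge mulr_le0_ge0 ?op_norm_ge0.
by rewrite -lpE lerXn2r ?nnegrE ?(ltW lpp)// (le_trans (ltW lpp) le).
Qed.

(** With V = [tower_var h d], the coefficients carry V^(d+1) and the norm V^d, so one V remains. The
    powers of K cancel up to d^2 quotients K / (K - 1) <= 2, the source of the factor 2 beside
    [tower_const]. *)
Lemma tower_lower (K h b d : nat) (c : R) : (1 < h)%N -> h = (2 ^ b)%N -> (2 * h <= K)%N ->
  (K <= 4 ^ h)%N -> (0 < d)%N -> hom_admissible d K c ->
  0 < c /\ (tower_var h d)%:R <= c ^+ (2 * d) * (2 * tower_const R) ^+ (d * d).
Proof.
move=> h1 hb hK Kh d0 hc; have [w [w1 hw]] := @tower_good_sample K h b d h1 hb hK Kh d0.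
have K0 : (0 < K)%N by apply: leq_trans hK; rewrite muln_gt0 (ltnW h1).
have K1 : (1 < K)%N by apply: leq_trans hK; rewrite leq_pmulr// ltnW.
have V0 := tower_var_gt0 h1 d.
have L0 : (0 < #|letters (tower K h d)|)%N.
  by rewrite card_letters_tower muln_gt0 V0 expn_gt0 muln_gt0 K0 -subn1 subn_gt0 K1.
have [c0 le1] := admissible_gt0 K0 d0 (flat_tower K h d) L0 w1 hc.
split=> //; set k := tower_const R in hw *; set V := tower_var h d in V0 *.
have k0 : 0 < k by rewrite /k /tower_const mulr_gt0 ?expR_gt0.
have le2 : #|letters (tower K h d)|%:R ^+ d.+1 * K%:R ^- (d * d) <=
    c ^+ (2 * d) * (k ^+ d * K%:R * tower_mean R K h d) ^+ d.
  apply: le_trans le1 _; rewrite exprMn ler_wpM2l ?exprn_ge0 ?(ltW c0)// exprM.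
  by rewrite lerXn2r ?nnegrE ?exprn_ge0 ?op_norm_ge0// (le_trans _ hw)// sqr_ge0.
have Kp : 0 < K%:R :> R by rewrite ltr0n.
move: le2; rewrite card_letters_tower -/V ler_pdivrMr ?exprn_gt0//.
rewrite /tower_mean -/V !natrM !natrX !natrM.
set x : R := K%:R in Kp *; set y : R := K.-1%:R.
have y1 : 1 <= y by rewrite ler1n -subn1 subn_gt0.
have xy : x <= 2 * y by rewrite -natrM ler_nat; lia.
have Vp : 0 < V%:R :> R by rewrite ltr0n.
have -> : (V%:R * (x * y) ^+ d) ^+ d.+1 =
    V%:R * y ^+ (d * d) * y ^+ d * (V%:R ^+ d * x ^+ (d * d) * x ^+ d).
  rewrite !exprMn -!exprM mulnS !exprD [V%:R ^+ d.+1]exprS; ring.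
have -> : c ^+ (2 * d) * (k ^+ d * x * (V%:R * x ^+ d)) ^+ d * x ^+ (d * d) =
    c ^+ (2 * d) * k ^+ (d * d) * x ^+ (d * d) * (V%:R ^+ d * x ^+ (d * d) * x ^+ d).
  rewrite !exprMn -!exprM; ring.
rewrite ler_pM2r; last by rewrite !mulr_gt0 ?exprn_gt0.
move=> le3; have yp : 0 < y ^+ (d * d) by rewrite exprn_gt0// (lt_le_trans ltr01 y1).
rewrite -(ler_pM2r yp); apply: le_trans (_ : V%:R * y ^+ (d * d) * y ^+ d <= _).
  by rewrite ler_peMr ?exprn_ege1// mulr_ge0 ?(ltW Vp) ?(ltW yp).
apply: le_trans le3 _.
apply: le_trans (_ : c ^+ (2 * d) * k ^+ (d * d) * (2 * y) ^+ (d * d) <= _).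
  apply: ler_wpM2l; first by rewrite mulr_ge0 ?exprn_ge0 ?(ltW c0) ?(ltW k0).
  by rewrite lerXn2r ?nnegrE ?(ltW Kp)// (le_trans (ltW Kp) xy).
by rewrite !exprMn le_eqVlt; apply/orP; left; apply/eqP; ring.
Qed.

(** One off-diagonal unit on each of d sites has norm at most 1 and a single coefficient K^(-d/2).
    It shows that admissible constants are positive, and it settles K < 4 in the lower bound. *)
Lemma unit_lower (K d : nat) (c : R) : (1 < K)%N -> (0 < d)%N -> hom_admissible d K c ->
  0 < c /\ (Num.sqrt K%:R)^-1 ^+ d <= c.
Proof.
move=> K1 d0 hc; have K0 := ltnW K1.
pose S : system K := @System K d unit (fun _ _ => Some (Ordinal K0, Ordinal K1)).
have Sf : flat_system S d.
  split=> [e j _ [<-]|[] []|e]//.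
  by rewrite -[RHS]card_ord; apply: eq_card => j; rewrite !inE.
have L1 : #|letters S| = 1%N by rewrite card_unit.
have [c0 le1] := @admissible_gt0 K d c S (fun=> 1) K0 d0 Sf (eq_leq (esym L1))
  (fun _ => Normc.normc1 _) hc.
split=> //; have s0 : 0 <= (Num.sqrt K%:R : R)^-1 by rewrite invr_ge0 sqrtr_ge0.
have d2 : (0 < 2 * d)%N by rewrite muln_gt0.
rewrite -(ler_pXn2r d2) ?nnegrE ?exprn_ge0 ?(ltW c0)//.
have -> : (Num.sqrt K%:R)^-1 ^+ d ^+ (2 * d) = #|letters S|%:R ^+ d.+1 * K%:R ^- (d * d) :> R.
  rewrite L1 expr1n mul1r -exprM mulnCA exprM exprVn sqr_sqrtr//.
  by rewrite exprVn.
apply: le_trans le1 _; have op1 : op_norm (flat_mx (fun _ : letters S => 1 : C)) <= 1.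
  have -> : flat_mx (fun _ : letters S => 1 : C) = sys_mx R (tt : letters S).
    by rewrite /flat_mx (bigD1 tt)//= big1 ?addr0 ?scale1r// => -[].
  exact: op_letter_le1.
rewrite lerXn2r ?nnegrE ?mulr_ge0 ?op_norm_ge0 ?(ltW c0)//.
by rewrite ler_piMr// ltW.
Qed.

End Lower.

(** * Growth rates *)

Section LimsupRoot.
Variable R : realType.
Implicit Types (u : nat -> \bar R) (b : R).

Lemma root_expr b (d : nat) : (0 < d)%N -> 0 <= b -> (b ^+ d) `^ d%:R^-1 = b.
Proof. by move=> d0 b0; rewrite -powR_mulrn// -powRrM mulfV ?powRr1// pnatr_eq0 -lt0n. Qed.

Lemma limsup_root_le u b (N : nat) : 0 <= b ->
  (forall d, (N <= d)%N -> (0 < d)%N -> exists2 r, u d = r%:E & 0 <= r <= b ^+ d) ->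
  (limsup_root u <= b%:E)%E.
Proof.
move=> b0 h; apply: le_trans (_ : (ereal_sup [set poweR (u r) r%:R^-1 |
    r in [set n | (maxn N 1 <= n)%N]]%classic <= b%:E)%E); last first.
  apply: ge_ereal_sup => _ [d /= + <-]; rewrite geq_max => /andP[Nd d0].
  have [r -> /andP[r0 rb]] := h d Nd d0.
  rewrite poweR_EFin lee_fin -[leRHS](root_expr d0 b0) ge0_ler_powR ?nnegrE ?invr_ge0 ?exprn_ge0//.
apply: ereal_inf_lbound; exists [set n | (maxn N 1 <= n)%N]%classic => //; by exists (maxn N 1).
Qed.

Lemma limsup_root_ge u b (N : nat) : 0 <= b ->
  (forall d, (N <= d)%N -> (0 < d)%N -> exists2 r, u d = r%:E & b ^+ d <= r) ->
  (b%:E <= limsup_root u)%E.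
Proof.
move=> b0 h; apply: le_ereal_inf_tmp => _ [V [N' _ hV] <-].
pose d := maxn (maxn N N') 1.
have [r ud br] : exists2 r, u d = r%:E & b ^+ d <= r.
  by apply: h; rewrite !leq_max leqnn ?orbT.
have d0 : (0 < d)%N by rewrite leq_max leqnn orbT.
apply: le_trans (_ : poweR (u d) d%:R^-1 <= _)%E; last first.
  apply: ereal_sup_ubound; exists d => //; apply: hV => /=.
  by rewrite !leq_max leqnn ?orbT.
rewrite ud poweR_EFin lee_fin -[leLHS](root_expr d0 b0) ge0_ler_powR ?nnegrE ?invr_ge0 ?exprn_ge0//.
by apply: le_trans br; rewrite exprn_ge0.
Qed.

Lemma limsup_root_lt u b : (limsup_root u < b%:E)%E ->
  exists N, forall d, (N <= d)%N -> (poweR (u d) d%:R^-1 < b%:E)%E.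
Proof.
move=> /ereal_inf_lt[_ [V [N _ hV] <-] hb]; exists N => d Nd.
by apply: le_lt_trans hb; apply: ereal_sup_ubound; exists d => //; apply: hV.
Qed.

Lemma root_lt_expr (r b : R) (d : nat) : (0 < d)%N -> 0 <= r -> r `^ d%:R^-1 < b -> r <= b ^+ d.
Proof.
move=> d0 r0 /ltW h; rewrite -[r](powRr1 r0) -(mulVf (_ : d%:R != 0)) ?pnatr_eq0 -?lt0n// powRrM.
by rewrite powR_mulrn ?powR_ge0// lerXn2r ?nnegrE ?powR_ge0// (le_trans _ h) ?powR_ge0.
Qed.

Lemma poly_le_expr (M t : R) : 0 <= M -> 1 < t ->
  exists N : nat, forall d, (N <= d)%N -> M * d.+1%:R ^+ 3 <= t ^+ d.
Proof.
(* Four roots of t: three absorb the cube of d + 1, the fourth the constant. *)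
move=> M0 t1; pose s := t `^ (4%:R^-1).
have t0 : 0 <= t by apply: ltW; exact: lt_trans t1.
have s4 : s ^+ 4 = t by rewrite -powR_mulrn ?powR_ge0// -powRrM mulVf ?powRr1.
have s0 : 0 <= s by exact: powR_ge0.
have s1 : 1 < s.
  by rewrite ltNge; apply/negP => s1; move: t1; rewrite ltNge -s4 exprn_ile1.
pose e := s - 1; have e0 : 0 < e by rewrite subr_gt0.
have bern (d : nat) : 1 + d%:R * e <= s ^+ d.
  elim: d => [|d IH]; first by rewrite mul0r addr0.
  rewrite exprS; apply: le_trans (ler_wpM2l s0 IH).
  rewrite -subr_ge0 [leRHS](_ : _ = d%:R * e ^+ 2); last by rewrite -natr1 /e; ring.
  by rewrite mulr_ge0// sqr_ge0.
pose k := Num.max 1 e^-1; have k1 : 1 <= k by rewrite le_max lexx.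
have ke : e^-1 <= k by rewrite le_max lexx orbT.
have k0 : 0 < k by exact: lt_le_trans k1.
have lin (d : nat) : d.+1%:R <= k * s ^+ d.
  apply: le_trans (ler_wpM2l (ltW k0) (bern d)); rewrite mulrDr mulr1 -natr1 addrC lerD//.
  rewrite mulrCA -[leLHS]mulr1 ler_wpM2l// -ler_pdivrMr// div1r //.
have [N hN] : exists N : nat, M * k ^+ 3 <= 1 + N%:R * e.
  exists (Num.bound (M * k ^+ 3 / e)); apply: le_trans (_ : M * k ^+ 3 / e * e <= _).
    by rewrite divfK// gt_eqF.
  apply: le_trans (_ : (Num.bound (M * k ^+ 3 / e))%:R * e <= _); last by rewrite lerDr.
  rewrite ler_wpM2r ?(ltW e0)//; apply/ltW/archi_boundP.
  by rewrite divr_ge0 ?(ltW e0)// mulr_ge0// exprn_ge0// ltW.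
exists N => d Nd; apply: le_trans (_ : M * (k * s ^+ d) ^+ 3 <= _).
  by rewrite ler_wpM2l// lerXn2r ?nnegrE ?mulr_ge0 ?exprn_ge0 ?(ltW k0).
have -> : t ^+ d = s ^+ d * (s ^+ d) ^+ 3 by rewrite -exprS -s4 -!exprM mulnC.
rewrite exprMn mulrA ler_wpM2r ?exprn_ge0//.
apply: le_trans hN _; apply: le_trans (bern d); rewrite lerD2l ler_wpM2r ?(ltW e0)//.
by rewrite ler_nat.
Qed.

Lemma limsup_root_le_poly u (M b : R) : 0 <= M -> 0 < b ->
  (forall d, (0 < d)%N -> exists2 r, u d = r%:E & 0 <= r <= M * d.+1%:R ^+ 3 * b ^+ d) ->
  (limsup_root u <= b%:E)%E.
Proof.
move=> M0 b0 h; apply/lee_addgt0Pr => e e0.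
have be0 : 0 <= b + e by rewrite addr_ge0 ?ltW.
have [|N hN] := @poly_le_expr M ((b + e) / b) M0; first by rewrite ltr_pdivlMr// mul1r ltrDl.
rewrite -EFinD; apply: (@limsup_root_le u (b + e) N) => // d Nd d0.
have [r -> /andP[r0 rb]] := h d d0; exists r => //; rewrite r0 (le_trans rb)//.
by rewrite -ler_pdivlMr ?exprn_gt0// -expr_div_n hN.
Qed.

Lemma limsup_root_ge_geom u (a b : R) : 0 < a -> 0 < b ->
  (forall d, (0 < d)%N -> exists2 r, u d = r%:E & a * b ^+ d <= r) ->
  (b%:E <= limsup_root u)%E.
Proof.
move=> a0 b0 h; apply/lee_addgt0Pr => e e0.
pose b' := b - Num.min e (b / 2).
have m0 : 0 < Num.min e (b / 2) by rewrite lt_min e0 divr_gt0.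
have b'0 : 0 < b'.
  by rewrite subr_gt0 gt_min ltr_pdivrMr// ltr_pMr// ltr1n orbT.
have ai : 0 <= a^-1 by rewrite invr_ge0 ltW.
have [|N hN] := @poly_le_expr a^-1 (b / b') ai.
  by rewrite ltr_pdivlMr// mul1r /b' gtrBl.
have le1 : (b'%:E <= limsup_root u)%E.
  apply: (@limsup_root_ge u b' N); first exact: ltW.
  move=> d Nd d0; have [r -> rb] := h d d0; exists r => //; apply: le_trans rb.
  have := hN d Nd; rewrite expr_div_n ler_pdivlMr ?exprn_gt0// -[in X in X -> _]mulrA.
  rewrite ler_pdivrMl//; apply: le_trans.
  by rewrite ler_peMl ?exprn_ge0 ?(ltW b'0)// exprn_ege1// ler1n.
apply: le_trans (leeD2r e%:E le1); rewrite -EFinD lee_fin /b'.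
have : Num.min e (b / 2) <= e by rewrite ge_min lexx.
by lra.
Qed.

End LimsupRoot.

Definition le_admissible (R : realType) (d K : nat) (c : R) : Prop :=
  forall n (B : 'I_(K ^ 2) -> 'M[R[i]]_K) (A : tensor_mx R K n),
    normalized_local_basis B -> H_le d A ->
    lp_norm (BH_exp R d) (fourier_coef B A) <= c * op_norm A.

Section LeastConstants.
Variables (R : realType) (K : nat).
Hypothesis K2 : (2 <= K)%N.
Local Notation C := R[i].

Let K0 : (0 < K)%N. Proof. exact: ltnW. Qed.

(** Shows that the infimum of the admissible constants is itself admissible; [o] is an operator norm
    and may be 0. *)
Lemma inf_mul_bound (S : set R) (l o c0 : R) : S c0 -> 0 <= o ->
  (forall c, S c -> l <= c * o) -> l <= inf S * o.
Proof.
move=> Sc0 o0 h; have [oz|on] := eqVneq o 0.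
  by have := h _ Sc0; rewrite oz !mulr0.
have op : 0 < o by rewrite lt_def on.
rewrite -ler_pdivrMr//; apply: lb_le_inf; first by exists c0.
by move=> c Sc; rewrite ler_pdivrMr// h.
Qed.

Lemma le_hom_admissible d c : le_admissible d K c -> hom_admissible d K (c : R).
Proof. by move=> h n B A Bb HA; apply: h => //; exact: H_hom_le HA. Qed.

Lemma le_admissible_upper d : (0 < d)%N -> le_admissible d K (upper_const R K d).
Proof. by move=> d0 n B A Bb HA; apply: upper_bound. Qed.

Lemma hom_admissible_gt0 d (c : R) : (0 < d)%N -> hom_admissible d K c -> 0 < c.
Proof. by move=> d0 /(unit_lower K2 d0)[]. Qed.

(* [BH_exp 0 = 0] makes [C_le 0] infinite, hence the hypothesis of [C_leE]. *)
Definition c_hom (r : nat) : R := if r == 0%N then 1 else inf [set c | hom_admissible r K c]%classic.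
Definition c_le (d : nat) : R := inf [set c | le_admissible d K c]%classic.

Lemma C_homE r : C_hom R r K = (c_hom r)%:E.
Proof.
rewrite /C_hom /c_hom; case: eqP => // /eqP; rewrite -lt0n => r0.
apply: (@ereal_inf_EFin _ [set c | hom_admissible r K c]%classic).
  by exists 0 => c /= hc; apply/ltW/(hom_admissible_gt0 r0 hc).
by exists (upper_const R K r); apply/le_hom_admissible/le_admissible_upper.
Qed.

Lemma C_leE d : (0 < d)%N -> C_le R d K = (c_le d)%:E.
Proof.
move=> d0; apply: (@ereal_inf_EFin _ [set c | le_admissible d K c]%classic).
  by exists 0 => c /= hc; apply/ltW/(hom_admissible_gt0 d0)/le_hom_admissible.
by exists (upper_const R K d); apply: le_admissible_upper.
Qed.

Lemma c_hom_admissible r : (0 < r)%N -> hom_admissible r K (c_hom r).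
Proof.
move=> r0 n B A Bb HA; rewrite /c_hom eqn0Ngt r0 /=.
apply: (@inf_mul_bound _ _ _ (upper_const R K r)); [|exact: op_norm_ge0|].
  by apply/le_hom_admissible/le_admissible_upper.
by move=> c /= hc; apply: hc.
Qed.

Lemma c_le_admissible d : (0 < d)%N -> le_admissible d K (c_le d).
Proof.
move=> d0 n B A Bb HA.
apply: (@inf_mul_bound _ _ _ (upper_const R K d)); [|exact: op_norm_ge0|].
  exact: le_admissible_upper.
by move=> c /= hc; apply: hc.
Qed.

Lemma c_le_min d c : (0 < d)%N -> le_admissible d K c -> c_le d <= c.
Proof.
move=> d0 hc; apply: ge_inf => //; exists 0 => c' /= hc'.
by apply/ltW/(hom_admissible_gt0 d0)/le_hom_admissible.
Qed.

Lemma c_hom_min r c : (0 < r)%N -> hom_admissible r K c -> c_hom r <= c.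
Proof.
move=> r0 hc; rewrite /c_hom eqn0Ngt r0; apply: ge_inf => //; exists 0 => c' /= hc'.
exact/ltW/(hom_admissible_gt0 r0).
Qed.

Lemma c_hom_ge0 r : 0 <= c_hom r.
Proof.
case: r => [|r]; first by rewrite /c_hom.
exact/ltW/(hom_admissible_gt0 _ (@c_hom_admissible r.+1 _)).
Qed.

Lemma c_le_ge0 d : (0 < d)%N -> 0 <= c_le d.
Proof. by move=> d0; apply/ltW/(hom_admissible_gt0 d0)/le_hom_admissible/c_le_admissible. Qed.

Lemma le_admissible_sum d : (0 < d)%N ->
  le_admissible d K (8 ^+ d * \sum_(r < d.+1) c_hom r).
Proof.
move=> d0 n B A Bb HA; apply: fourier_le_hom => //; first exact: c_hom_ge0.
by move=> r A' /andP[r0 _] HA'; apply: c_hom_admissible.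
Qed.

(** 72 = 36 * 2, with 36 sqrt K from [Gf_l2_l1] and 2 from the weights of the linear coefficient.
    The remaining factors are at most cubic in d + 1 and do not affect the rate. *)
Lemma upper_const_poly d : (0 < d)%N -> upper_const R K d <=
  (1 + (1 + expR 1) * (16 * K%:R * Num.sqrt K%:R)) * d.+1%:R ^+ 3 * (72 * Num.sqrt K%:R) ^+ d.
Proof.
move=> d0; set k := Num.sqrt K%:R; rewrite /upper_const -/k.
have k1 : 1 <= k by rewrite -sqrtr1 ler_wsqrtr// ler1n.
have k0 : 0 <= k by exact: le_trans k1.
set e := (1 + expR 1 : R); have e0 : 0 <= e by rewrite addr_ge0 ?expR_ge0.
set F := 16 * K%:R * k; have F0 : 0 <= F by rewrite !mulr_ge0.
have dd : (d * d * d.+1)%:R <= d.+1%:R ^+ 3 :> R.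
  by rewrite -natrX ler_nat !expnS expn0 muln1; nia.
have d1 : 1 <= d.+1%:R ^+ 3 :> R by rewrite exprn_ege1// ler1n.
have p1 : 1 <= (72 * k) ^+ d by rewrite exprn_ege1// mulr_ege1// ler1n.
have p2 : (36 * k) ^+ d.-1 * 2 ^+ d <= (72 * k) ^+ d.
  apply: le_trans (_ : (36 * k) ^+ d * 2 ^+ d <= _).
    by rewrite ler_wpM2r ?exprn_ge0// ler_weXn2l ?leq_pred// mulr_ege1// ler1n.
  by rewrite -exprMn le_eqVlt; apply/orP; left; apply/eqP; congr (_ ^+ _); ring.
have -> : d%:R * (e * ((36 * k) ^+ d.-1 * (F * ((d * d.+1)%:R * 2 ^+ d)))) =
    e * F * ((d * d * d.+1)%:R * ((36 * k) ^+ d.-1 * 2 ^+ d)).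
  by rewrite !natrM; ring.
have eF0 : 0 <= e * F by exact: mulr_ge0.
rewrite -[leRHS]mulrA [leRHS]mulrDl mul1r; apply: lerD; first by rewrite mulr_ege1.
apply: ler_wpM2l => //; apply: ler_pM => //; rewrite ?mulr_ge0 ?exprn_ge0//.
by rewrite mulr_ge0.
Qed.

Lemma limsup_le_upper : (limsup_root (fun d => C_le R d K) <= (72 * Num.sqrt K%:R)%:E)%E.
Proof.
have k0 : 0 < Num.sqrt K%:R :> R by rewrite sqrtr_gt0 ltr0n.
apply: (@limsup_root_le_poly R _ (1 + (1 + expR 1) * (16 * K%:R * Num.sqrt K%:R))).
- by rewrite addr_ge0// !mulr_ge0 ?addr_ge0 ?expR_ge0 ?(ltW k0).
- by rewrite mulr_gt0.
move=> d d0; exists (c_le d); first exact: C_leE.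
rewrite c_le_ge0//=; apply: le_trans (upper_const_poly d0).
by apply: c_le_min => //; apply: le_admissible_upper.
Qed.

Lemma limsup_le_beta_lt (b : R) : 1 <= b -> (BH_beta R K < b%:E)%E ->
  (limsup_root (fun d => C_le R d K) <= (8 * b)%:E)%E.
Proof.
move=> b1 /limsup_root_lt[N hN]; have b0 : 0 <= b by exact: le_trans b1.
(* [M] absorbs the finitely many degrees at which the root bound is not yet valid. *)
pose M := 1 + \sum_(r < N) c_hom r.
have M1 : 1 <= M by rewrite lerDl sumr_ge0// => r _; exact: c_hom_ge0.
have hM r : c_hom r <= M * b ^+ r.
  have br : 1 <= b ^+ r by rewrite exprn_ege1.
  have [rN|Nr] := ltnP r N.
    apply: le_trans (_ : M * 1 <= _); last by rewrite ler_wpM2l// (le_trans _ M1).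
    rewrite mulr1 /M (bigD1 (Ordinal rN))//= addrCA lerDl addr_ge0// sumr_ge0// => i _.
    exact: c_hom_ge0.
  apply: le_trans (_ : 1 * b ^+ r <= _); last by rewrite ler_wpM2r// (le_trans _ br).
  rewrite mul1r; case: (posnP r) => [->|r0]; first by rewrite /c_hom expr0.
  apply: root_lt_expr => //; first exact: c_hom_ge0.
  by have := hN r Nr; rewrite C_homE poweR_EFin lte_fin.
apply: (@limsup_root_le_poly R _ M); [exact: le_trans M1|by rewrite mulr_gt0// (lt_le_trans _ b1)|].
move=> d d0; exists (c_le d); first exact: C_leE.
rewrite c_le_ge0//=; apply: le_trans (c_le_min d0 (le_admissible_sum d0)) _.
rewrite exprMn mulrCA; apply: ler_wpM2l; first by rewrite exprn_ge0.
apply: le_trans (_ : \sum_(r < d.+1) M * b ^+ d <= _).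
  apply: ler_sum => r _; apply: le_trans (hM r) _; rewrite ler_wpM2l ?(le_trans _ M1)//.
  by rewrite ler_weXn2l// -ltnS.
rewrite sumr_const card_ord -[(M * b ^+ d) *+ _]mulr_natl mulrA [_ * M]mulrC.
rewrite ler_wpM2r ?exprn_ge0// ler_wpM2l ?(le_trans _ M1)//.
by rewrite -natrX ler_nat -{1}(expn1 d.+1) leq_pexp2l.
Qed.

Lemma limsup_le_beta :
  (limsup_root (fun d => C_le R d K) <= 8%:E * maxe 1 (BH_beta R K))%E.
Proof.
case: (BH_beta R K) (@limsup_le_beta_lt) => [x||] h.
- rewrite -EFin_max -EFinM; apply/lee_addgt0Pr => e e0.
  have := h (Num.max 1 x + e / 8).
  have -> : 8 * (Num.max 1 x + e / 8) = 8 * Num.max 1 x + e by field.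
  have e8 : 0 < e / 8 by rewrite divr_gt0.
  have [m1 mx] : 1 <= Num.max 1 x /\ x <= Num.max 1 x by rewrite !le_max !lexx orbT.
  rewrite EFinD; apply; last by rewrite lte_fin (le_lt_trans mx)// ltrDl.
  by rewrite (le_trans m1)// lerDl ltW.
- rewrite (_ : maxe 1 +oo = +oo)%E; first by rewrite gt0_muley ?leey// lte_fin.
  by apply/max_idPr; rewrite leey.
rewrite (_ : maxe 1 -oo = 1)%E; last by apply/max_idPl; rewrite leNye.
by rewrite mule1; have := h 1 (lexx _) (ltNyr _); rewrite mulr1.
Qed.

End LeastConstants.

Section KhinchinConstant.
Variable R : realType.

(** Take one variable with coefficient 1: the integrand is constantly 1. *)
Lemma khinchin_ge1 (a : R) : khinchin_steinhaus1 a -> 1 <= a.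
Proof.
move=> /(_ 1%N (fun=> 1)); rewrite big_ord1 Normc.normc1 expr1n sqrtr1 /=.
rewrite (_ : (\int[_]_(t in _) _)%E = 1%E) ?mule1 ?lee_fin//.
rewrite (eq_integral (cst 1%E)) => [|t _].
  by rewrite integral_cst//= lebesgue_measure_itv /= lte_fin ltr01 -EFinB subr0 mule1.
rewrite big_ord1 mul1r unlift_none /=; congr (_%:E).
by rewrite cos2Dsin2 sqrtr1.
Qed.

(** Since e >= 2 >= (9/8)^2, the right side is at least 64 * 9/8 = 72 times sqrt K. *)
Lemma upper_le_khinchin (a : R) (K : nat) : khinchin_steinhaus1 a ->
  72 * Num.sqrt K%:R <= 64 * a ^+ 2 * Num.sqrt (expR 1) * Num.sqrt K%:R.
Proof.
move=> /khinchin_ge1 a1; rewrite ler_wpM2r ?sqrtr_ge0//.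
have e1 : 9 / 8 <= Num.sqrt (expR 1) :> R.
  rewrite -(ger0_norm (_ : 0 <= 9 / 8)) ?divr_ge0// -sqrtr_sqr ler_wsqrtr//.
  by have := expR_ge1Dx (1 : R); lra.
have a2 : 1 <= a ^+ 2 by rewrite exprn_ege1.
by nra.
Qed.

End KhinchinConstant.

Section LowerLimsup.
Variable R : realType.

(** Chosen so that x = [lower_const] K^(1/4) solves 16 k^2 x^4 = K with k = [tower_const R]: one
    factor 4 comes from h >= K / 4, the other from the square of 2 k in [tower_lower]. *)
Definition lower_const : R := (16 * tower_const R ^+ 2) `^ (- (1 / 4)).

Lemma lower_const_gt0 : 0 < lower_const.
Proof. by rewrite powR_gt0// mulr_gt0// exprn_gt0// mulr_gt0 ?expR_gt0. Qed.

Let quarterX (x : R) : 0 <= x -> (x `^ (1 / 4)) ^+ 4 = x.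
Proof. by move=> x0; rewrite -powR_mulrn ?powR_ge0// -powRrM div1r mulVf ?powRr1. Qed.

Lemma dyadic_scale (K : nat) : (4 <= K)%N -> exists b : nat, let h := (2 ^ b)%N in
  [/\ (1 < h)%N, (2 * h <= K)%N, (K <= 4 * h)%N & (K <= 4 ^ h)%N].
Proof.
move=> K4; have K0 : (0 < K)%N by apply: leq_trans K4.
have /andP[h1 h2] := @trunc_log_bounds 2 K isT K0.
set t := trunc_log 2 K in h1 h2; have t1 : (1 < t)%N.
  by rewrite -ltnS -(@ltn_exp2l 2)//; apply: leq_ltn_trans K4 h2.
exists t.-1; set h := (2 ^ t.-1)%N.
have ht : (2 * h = 2 ^ t)%N by rewrite /h -expnS prednK// ltnW.
have Kh : (K <= 4 * h)%N by apply: ltnW; rewrite (leq_trans h2)// expnS -ht mulnA.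
have hh : (1 < h)%N by rewrite /h -{1}(expn0 2) ltn_exp2l// -subn1 subn_gt0.
split=> //; first by rewrite ht.
apply: leq_trans Kh _; rewrite -{2}(prednK (ltnW hh)) expnS leq_mul2l /=.
by rewrite -{1}(prednK (ltnW hh)) ltn_expl.
Qed.

Lemma limsup_ge_lower (K : nat) : (2 <= K)%N ->
  ((lower_const * K%:R `^ (1 / 4))%:E <= limsup_root (fun d => C_le R d K))%E.
Proof.
move=> K2; have Kp : 0 < K%:R :> R by rewrite ltr0n ltnW.
have adm d (d0 : (0 < d)%N) := le_hom_admissible (@c_le_admissible R K K2 d d0).
set k := tower_const R; have kg : 128 <= k.
  by rewrite /k /tower_const; have := expR_ge1Dx (64 : R); lra.
have k0 : 0 < k by exact: lt_le_trans kg.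
set x := lower_const * _.
have x0 : 0 < x by rewrite mulr_gt0 ?lower_const_gt0// powR_gt0.
have x4 : x ^+ 4 * (16 * k ^+ 2) = K%:R.
  rewrite exprMn (quarterX (ltW Kp)) /lower_const powRN exprVn quarterX; last first.
    by rewrite mulr_ge0// exprn_ge0// ltW.
  by rewrite -/k mulrAC mulVf ?mul1r// mulf_neq0 ?expf_neq0 ?lt0r_neq0.
(* For K < 4 no h > 1 with 2 h <= K exists. There [unit_lower] gives at least 1/2 per degree, and x
   <= 1/2 because k >= 128. *)
have [K4|K4] := ltnP K 4.
  apply: (@limsup_root_ge_geom R _ 1 x) => // d d0; exists (c_le R K d); first exact: C_leE.
  have [_ +] := unit_lower K2 d0 (adm d d0); apply: le_trans; rewrite mul1r.
  have s0 : 0 < Num.sqrt K%:R :> R by rewrite sqrtr_gt0.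
  rewrite lerXn2r ?nnegrE ?invr_ge0 ?(ltW s0) ?(ltW x0)//.
  have s2 : Num.sqrt K%:R <= 2 :> R.
    rewrite -(ger0_norm (ler0n R 2)) -sqrtr_sqr ler_wsqrtr// -natrX ler_nat.
    exact: ltnW.
  apply: le_trans (_ : 2^-1 <= _); last by rewrite lef_pV2 ?posrE.
  rewrite -(@ler_pXn2r _ 4) ?nnegrE ?(ltW x0)//.
  have K4' : K%:R <= 4 :> R by rewrite ler_nat ltnW.
  have k2 : 128 ^+ 2 <= k ^+ 2 by rewrite lerXn2r ?nnegrE// ltW.
  have X0 : 0 <= x ^+ 4 by rewrite exprn_ge0// ltW.
  have := ler_wpM2l X0 k2; rewrite -x4 in K4'; rewrite exprVn; move: K4'.
  move: (x ^+ 4) (k ^+ 2) => a b; lra.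
have [b [h1 hK Kh Kh4]] := dyadic_scale K4; set h := (2 ^ b)%N in h1 hK Kh Kh4.
(* With z = K / 4 this satisfies y^4 z^3 = 1. It pays for the missing exponent d^2 - (d - 1)(d - 2)
   <= 3 d of z and, being independent of d, disappears in the d-th root. *)
set y : R := ((4 / K%:R) ^+ 3) `^ (1 / 4).
have yp : 0 < y by rewrite powR_gt0// exprn_gt0// divr_gt0.
have y4 : y ^+ 4 = (4 / K%:R) ^+ 3 by rewrite quarterX// exprn_ge0// divr_ge0// ltW.
apply: (@limsup_root_ge_geom R _ y x) => // d d0; exists (c_le R K d); first exact: C_leE.
have [c0 le1] := @tower_lower R K h b d _ h1 erefl hK Kh4 d0 (adm d d0).
set c := c_le R K d in c0 le1 *.
have d4 : (0 < 4 * d)%N by rewrite muln_gt0.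
rewrite -(ler_pXn2r d4) ?nnegrE ?(ltW c0)//; last by rewrite mulr_ge0 ?exprn_ge0 ?(ltW x0) ?(ltW yp).
set z : R := K%:R / 4; have z1 : 1 <= z by rewrite ler_pdivlMr// mul1r ler_nat.
have z0 : 0 < z by exact: lt_le_trans z1.
have le2 : z ^+ (d.-1 * d.-2) <= (c ^+ (2 * d) * (2 * k) ^+ (d * d)) ^+ 2.
  apply: le_trans (_ : (tower_var h d)%:R ^+ 2 <= _).
    rewrite -natrX tower_var_sqr// natrX lerXn2r ?nnegrE ?(ltW z0)//.
    by rewrite ler_pdivrMr// -natrM ler_nat mulnC.
  by rewrite lerXn2r ?nnegrE// mulr_ge0 ?exprn_ge0 ?(ltW c0)// mulr_ge0// ltW.
have kd0 : 0 < ((2 * k) ^+ (d * d)) ^+ 2 by rewrite !exprn_gt0// mulr_gt0.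
rewrite -(ler_pM2r kd0).
have -> : c ^+ (4 * d) * ((2 * k) ^+ (d * d)) ^+ 2 = (c ^+ (2 * d) * (2 * k) ^+ (d * d)) ^+ 2.
  by rewrite [RHS]exprMn -[c ^+ _ ^+ 2]exprM; congr (c ^+ _ * _); rewrite [RHS]mulnAC.
apply: le_trans le2.
have zz : x ^+ 4 * (4 * k ^+ 2) = z by rewrite /z -x4; field.
have yz : y ^+ 4 * z ^+ 3 = 1.
  rewrite y4 -exprMn /z mulrA divfK ?lt0r_neq0// divff ?expr1n//.
have -> : (y * x ^+ d) ^+ (4 * d) * ((2 * k) ^+ (d * d)) ^+ 2 =
    (y ^+ 4) ^+ d * z ^+ (d * d).
  have e1 : (x ^+ d) ^+ (4 * d) = (x ^+ 4) ^+ (d * d) by rewrite -!exprM; congr (_ ^+ _); rewrite mulnCA.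
  have e2 : ((2 * k) ^+ (d * d)) ^+ 2 = (4 * k ^+ 2) ^+ (d * d).
    have e4 : (2 * k) ^+ 2 = 4 * k ^+ 2 by ring.
    by rewrite -exprM mulnC exprM e4.
  by rewrite [(y * _) ^+ _]exprMn e1 e2 -mulrA -exprMn zz exprM.
apply: le_trans (_ : (y ^+ 4) ^+ d * z ^+ (d.-1 * d.-2 + 3 * d) <= _).
  rewrite ler_wpM2l ?exprn_ge0 ?(ltW yp)// ler_weXn2l//.
  by case: d d0 {c c0 le1 d4 kd0} => // -[|d] _ //=; lia.
by rewrite exprD [z ^+ (3 * d)]exprM mulrCA -exprMn yz expr1n mulr1.
Qed.

End LowerLimsup.

Theorem theorem3p11 (R : realType) :
  (* the least constants exist *)
  (forall K r : nat, (2 <= K)%N -> C_hom R r K \is a fin_num) /\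
  (forall K d : nat, (2 <= K)%N -> (2 <= d)%N -> C_le R d K \is a fin_num) /\
  (forall (K d : nat), (2 <= K)%N -> (2 <= d)%N ->
   forall (n : nat) (B : 'I_(K ^ 2) -> 'M[R[i]]_K) (A : tensor_mx R K n),
     normalized_local_basis B -> H_le d A ->
     ((lp_norm (BH_exp R d) (fourier_coef B A))%:E <=
      (8 ^+ d)%:E * (\sum_(0 <= r < d.+1) C_hom R r K) * (op_norm A)%:E)%E) /\
  (forall K : nat, (2 <= K)%N ->
     (limsup_root (fun d => C_le R d K) <= 8%:E * maxe 1 (BH_beta R K))%E) /\
  (forall a1 : R, khinchin_steinhaus1 a1 -> forall K : nat, (2 <= K)%N ->
     (limsup_root (fun d => C_le R d K) <=
      (64 * a1 ^+ 2 * Num.sqrt (expR 1) * Num.sqrt K%:R)%:E)%E) /\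
  (forall K d : nat, (2 <= K)%N -> (2 <= d)%N ->
     (C_hom R d K <= C_le R d K)%E) /\
  (exists c : R, 0 < c /\
     forall K : nat, (2 <= K)%N ->
       ((c * K%:R `^ (1 / 4))%:E <= limsup_root (fun d => C_le R d K))%E /\
       (forall a1 : R, khinchin_steinhaus1 a1 ->
        (limsup_root (fun d => C_le R d K) <=
         (64 * a1 ^+ 2 * Num.sqrt (expR 1) * Num.sqrt K%:R)%:E)%E)).
Proof.
have sum_hom K d : (2 <= K)%N ->
    (\sum_(0 <= r < d.+1) C_hom R r K)%E = (\sum_(r < d.+1) c_hom R K r)%:E.
  by move=> K2; rewrite big_mkord -sumEFin; apply: eq_bigr => r _; rewrite C_homE.
have khin a1 : khinchin_steinhaus1 a1 -> forall K : nat, (2 <= K)%N ->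
    (limsup_root (fun d => C_le R d K) <=
     (64 * a1 ^+ 2 * Num.sqrt (expR 1) * Num.sqrt K%:R)%:E)%E.
  move=> ka K K2; apply: le_trans (limsup_le_upper R K2) _.
  by rewrite lee_fin upper_le_khinchin.
split; first by move=> K r K2; rewrite C_homE.
split; first by move=> K d K2 d2; rewrite C_leE// ltnW.
split.
  move=> K d K2 d2 n B A Bb HA; rewrite sum_hom// -!EFinM lee_fin.
  exact: (le_admissible_sum K2 (ltnW d2)).
split; first by move=> K K2; exact: limsup_le_beta.
split; first exact: khin.
split.
  move=> K d K2 d2; have d0 := ltnW d2; rewrite C_homE// C_leE// lee_fin.
  by apply: c_hom_min => //; apply/le_hom_admissible/c_le_admissible.
exists (lower_const R); split; first exact: lower_const_gt0.
by move=> K K2; split=> [|a1 ka]; [exact: limsup_ge_lower|exact: khin].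
Qed.
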